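(* Let $\{\beta_n\}$ be a sequence of positive numbers with $\lim_{n\to\infty}\beta_n/n=\infty$, and let $V$ and $W$ satisfy Assumptions A, C1 and C2 (stated in the context). For $n\in\mathbb{N}$ let $$P_n(d\mathbf{x}_1,\ldots,d\mathbf{x}_n)=\frac{\exp(-\beta_nH_n(\mathbf{x}_1,\ldots,\mathbf{x}_n))}{Z_n}\,\ell(d\mathbf{x}_1)\cdots\ell(d\mathbf{x}_n)$$ and $Q_n=(L_n)_{\#}P_n$. Then $\{Q_n\}$ satisfies a large deviation principle on $\mathcal{P}(\mathbb{R}^d)$ (with the weak topology) with speed $\alpha_n=\beta_n$ and rate function $$\mathcal{J}_\star(\mu)=\mathcal{J}(\mu)-\inf_{\nu\in\mathcal{P}(\mathbb{R}^d)}\mathcal{J}(\nu).$$ Furthermore, if there exists $\psi\in\Psi$ for which Assumption C3 holds, then $\{Q_n\}$ satisfies a large deviation principle on $(\mathcal{P}_\psi(\mathbb{R}^d),d_\psi)$ (with the same speed $\beta_n$) with rate function $$\mathcal{J}_\star^\psi(\mu):=\mathcal{J}(\mu)-\inf_{\nu\in\mathcal{P}_\psi(\mathbb{R}^d)}\mathcal{J}(\nu).$$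
   Context: Setting. $\ell$ is a $\sigma$-finite Borel measure on $\mathbb{R}^d$ without atoms; $V:\mathbb{R}^d\to(-\infty,+\infty]$ and $W:\mathbb{R}^d\times\mathbb{R}^d\to(-\infty,+\infty]$. For $\mathbf{x}^n=(\mathbf{x}_1,\ldots,\mathbf{x}_n)\in\mathbb{R}^{dn}$, $$H_n(\mathbf{x}^n)=\frac1n\sum_{i=1}^nV(\mathbf{x}_i)+\frac1{2n^2}\sum_{i,j=1,\,i\ne j}^nW(\mathbf{x}_i,\mathbf{x}_j),\qquad L_n(\mathbf{x}^n;\cdot)=\frac1n\sum_{i=1}^n\delta_{\mathbf{x}_i},$$ and $Z_n=\int\cdots\int\exp(-\beta_nH_n)\,\ell(d\mathbf{x}_1)\cdots\ell(d\mathbf{x}_n)$ is the normalizing constant. $(L_n)_{\#}P_n$ is the pushforward (image) of $P_n$ under $\mathbf{x}^n\mapsto L_n(\mathbf{x}^n;\cdot)$. $\mathcal{P}(S)$ is the set of Borel probability measures on $S$; $\overset{w}{\rightarrow}$ denotes weak convergence. For $\mu\in\mathcal{P}(\mathbb{R}^d)$, $$\mathcal{J}(\mu)=\frac12\int_{\mathbb{R}^d\times\mathbb{R}^d}\big(W(\mathbf{x},\mathbf{y})+V(\mathbf{x})+V(\mathbf{y})\big)\mu(d\mathbf{x})\mu(d\mathbf{y}).$$ For $k\in\mathbb{N}$ and $A\subset\mathbb{R}^{kd}$, $A_{\ne}:=A\setminus\{(\mathbf{x}_1,\ldots,\mathbf{x}_k):\mathbf{x}_i=\mathbf{x}_j\text{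 for some }1\le i<j\le k\}$ (the points whose $d$-dimensional components are all distinct). $B(0,r)$ is the closed ball of radius $r$ about $0$ in $\mathbb{R}^d$, and $I_A$ the indicator function of $A$. Assumption A. $V$ and $W$ are lower semicontinuous (lsc), and there exist $a\in[0,1)$ and $c\in\mathbb{R}$ such that $\int_{\mathbb{R}^d}e^{-(1-a)V(\mathbf{x})}\ell(d\mathbf{x})<\infty$, $\inf_{\mathbf{x}}V(\mathbf{x})>c$ and $\inf_{(\mathbf{x},\mathbf{y})}[W(\mathbf{x},\mathbf{y})+a(V(\mathbf{x})+V(\mathbf{y}))]>c$. In addition there is a Borel set $A\subset\mathbb{R}^d$ with $\ell(A)>0$ and $\int_{A\times A}(V(\mathbf{x})+V(\mathbf{y})+W(\mathbf{x},\mathbf{y}))\,\ell(d\mathbf{x})\ell(d\mathbf{y})<\infty$. Assumption C1. There exist a lsc function $\gamma:\mathbb{R}^d\to\mathbb{R}$ of the form $\gamma(\mathbf{x})=\phi(\|\mathbf{x}\|)$ for some $\phi:\mathbb{R}_+\to\mathbb{R}$ with $\lim_{s\to\infty}\phi(s)=\infty$, a Borel set $A\subset\mathbb{R}^d$ (not necessarily the one in Assumption A), a sequence $\{r_n\}\subset(0,\infty)$ with $r_n\to\infty$, and a constant $C\in\mathbb{R}$ such that, with $A_n^1:=A\cap B(0,r_n)$ and $A_n^2:=A\setminus B(0,r_n)$: (i) $\gamma(\mathbf{x})I_{A^c}(\mathbf{x})+\gamma(\mathbf{y})I_{A^c}(\mathbf{y})\le V(\mathbf{x})+V(\mathbf{y})+W(\mathbf{x},\mathbf{y})+C$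 for all $\mathbf{x},\mathbf{y}$; (ii) for every $n\in\mathbb{N}$ and $\mathbf{x}^n\in(\mathbb{R}^{nd})_{\ne}$, $$\int_{A_n^1}\gamma(\mathbf{x})L_n(\mathbf{x}^n;d\mathbf{x})\le\int_{(A_n^1\times A_n^1)_{\ne}}\big(V(\mathbf{x})+V(\mathbf{y})+W(\mathbf{x},\mathbf{y})\big)L_n(\mathbf{x}^n;d\mathbf{x})L_n(\mathbf{x}^n;d\mathbf{y})+C;$$ (iii) with $a$ the constant of Assumption A, $$\sup_{n\in\mathbb{N}}\frac{n}{\beta_n}\log\Big(\int_{A_n^2}e^{\frac{\beta_n}{n}\gamma(\mathbf{x})-(1-a)V(\mathbf{x})}\ell(d\mathbf{x})\Big)<C.$$ Assumption C2. For each $\mu\in\mathcal{P}(\mathbb{R}^d)$ with $\mathcal{J}(\mu)<+\infty$ there is a sequence $\{\mu_n\}\subset\mathcal{P}(\mathbb{R}^d)$ with each $\mu_n\ll\ell$, $\mu_n\overset{w}{\rightarrow}\mu$ and $\mathcal{J}(\mu_n)\to\mathcal{J}(\mu)$. Assumption C3 (for $\psi$). The function $\gamma$ in Assumption C1 is of the form $\gamma(\mathbf{x})=\phi(\psi(\mathbf{x}))$ for some $\phi\in\Phi$, where $\Phi$ is the set of lsc functions $\phi:\mathbb{R}_+\to\mathbb{R}$ with $\lim_{s\to\infty}\phi(s)/s=\infty$. Topologies. $d_w$ is the Lévy–Prohorov metric. $\Psi$ is the set of continuous $\psi:\mathbb{R}^d\to[0,\infty)$ with $\lim_{r\to\infty}\inf_{\|\mathbf{x}\|=r}\psi(\mathbf{x})=\infty$.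 For $\psi\in\Psi$, $\mathcal{P}_\psi(\mathbb{R}^d)=\{\mu\in\mathcal{P}(\mathbb{R}^d):\int\psi\,d\mu<\infty\}$ with metric $d_\psi(\mu,\nu)=d_w(\mu,\nu)+|\int\psi\,d\mu-\int\psi\,d\nu|$; $Q_n$ is viewed as a measure on $\mathcal{P}_\psi(\mathbb{R}^d)$, since $L_n(\mathbf{x}^n;\cdot)\in\mathcal{P}_\psi(\mathbb{R}^d)$ always. Large deviations. A rate function on a topological space $S$ is a function $\mathcal{H}:S\to[0,\infty]$ whose level sets $\{\mathcal{H}\le M\}$, $M\in[0,\infty)$, are compact. $\{R_n\}\subset\mathcal{P}(S)$ satisfies a large deviation principle with speed $\alpha_n\to\infty$ and rate function $\mathcal{H}$ if for every Borel $E\subset S$, $-\inf_{E^\circ}\mathcal{H}\le\liminf_n\alpha_n^{-1}\log R_n(E)\le\limsup_n\alpha_n^{-1}\log R_n(E)\le-\inf_{\bar E}\mathcal{H}$, with $E^\circ$ and $\bar E$ the interior and closure of $E$. *)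

(* Defs.v *)
From HB Require Import structures.
From mathcomp Require Import all_boot all_order all_algebra.
From mathcomp Require Import all_classical all_reals all_analysis.
From mathcomp Require Import measurable_realfun.

Set Implicit Arguments.
Unset Strict Implicit.
Unset Printing Implicit Defensive.

Import Order.TTheory GRing.Theory Num.Theory.
Import numFieldNormedType.Exports.

Local Open Scope classical_set_scope.
Local Open Scope ring_scope.

Definition borel_rV_display : measure_display.
Proof. by constructor. Qed.

Section borel_rV.
Context (R : realType) (d : nat).

Let borel_rV : set_system 'rV[R]_d := <<s @open 'rV[R]_d >>.

Let borel_rV0 : borel_rV set0.
Proof. exact: sigma_algebra0. Qed.

Let borel_rVC (A : set 'rV[R]_d) : borel_rV A -> borel_rV (~` A).
Proof. exact: sigma_algebraC. Qed.

Let borel_rVU (F : (set 'rV[R]_d)^nat) :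
  (forall i, borel_rV (F i)) -> borel_rV (\bigcup_i F i).
Proof. exact: sigma_algebra_bigcup. Qed.

(* R^d is 'rV[R]_d; the library's topology on it is the usual one. *)
HB.instance Definition _ := @isMeasurable.Build borel_rV_display 'rV[R]_d
  borel_rV borel_rV0 borel_rVC borel_rVU.

Lemma open_measurable_rV (A : set 'rV[R]_d) : open A -> measurable A.
Proof. exact: sub_sigma_algebra. Qed.

Lemma continuous_measurable_rV (f : 'rV[R]_d -> R) :
  continuous f -> measurable_fun setT f.
Proof.
move=> /continuousP cf.
apply: (measurability _ (RGenOInfty.measurableE R)).
move=> /= _ [_ [a ->]] <-; apply: measurableI => //.
by apply: open_measurable_rV; apply: cf; exact: interval_open.
Qed.

End borel_rV.

Section euclidean_norm.
Context (R : realType) (d : nat).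
Implicit Types x y : 'rV[R]_d.

(* The library's norm `|x| on 'rV[R]_d is the sup norm, hence this one. *)
Definition enorm x : R := Num.sqrt (\sum_(i < d) x ord0 i ^+ 2).

Definition eball (r : R) : set 'rV[R]_d := [set x | enorm x <= r].

Lemma enorm0 : enorm 0 = 0.
Proof. by rewrite /enorm big1 ?sqrtr0// => i _; rewrite mxE expr0n. Qed.

Lemma enormN x : enorm (- x) = enorm x.
Proof. by congr Num.sqrt; apply: eq_bigr => i _; rewrite mxE sqrrN. Qed.

Lemma cauchy_schwarz x y :
  (\sum_i x ord0 i * y ord0 i) ^+ 2 <=
  (\sum_i x ord0 i ^+ 2) * (\sum_i y ord0 i ^+ 2).
Proof.
suff : 0 <= \sum_i \sum_j (x ord0 i * y ord0 j - x ord0 j * y ord0 i) ^+ 2.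
  set A := \sum_i x ord0 i ^+ 2; set B := \sum_i y ord0 i ^+ 2.
  set C := \sum_i x ord0 i * y ord0 i.
  have -> : \sum_i \sum_j (x ord0 i * y ord0 j - x ord0 j * y ord0 i) ^+ 2 =
      (A * B - C ^+ 2) *+ 2.
    have AB : \sum_i \sum_j (x ord0 i * y ord0 j) ^+ 2 = A * B.
      rewrite mulr_suml; apply: eq_bigr => i _.
      by rewrite mulr_sumr; apply: eq_bigr => j _; rewrite exprMn.
    have CC : \sum_i \sum_j (x ord0 i * y ord0 i) * (x ord0 j * y ord0 j)
        = C ^+ 2.
      rewrite expr2 mulr_suml; apply: eq_bigr => i _.
      by rewrite mulr_sumr.
    rewrite mulrnBl mulr2n -{1}AB -[X in _ + X - _]AB.
    rewrite [X in _ + X - _]exchange_big/= -big_split/=.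
    rewrite -CC -sumrMnl -sumrB; apply: eq_bigr => i _.
    rewrite -big_split/= -sumrMnl -sumrB; apply: eq_bigr => j _.
    rewrite sqrrB addrAC; congr (_ + _ - _ *+ 2).
    by rewrite mulrACA [RHS]mulrACA; congr (_ * _); rewrite mulrC.
  by rewrite pmulrn_lge0// subr_ge0.
by apply: sumr_ge0 => i _; apply: sumr_ge0 => j _; exact: sqr_ge0.
Qed.

Lemma enorm_triangle x y : enorm (x + y) <= enorm x + enorm y.
Proof.
have s0 z : 0 <= \sum_(i < d) z ord0 i ^+ 2 :> R.
  by apply: sumr_ge0 => i _; exact: sqr_ge0.
rewrite -(@ler_pXn2r _ 2)// ?nnegrE ?addr_ge0 ?sqrtr_ge0//.
rewrite sqrrD !sqr_sqrtr//.
have -> : \sum_(i < d) (x + y) ord0 i ^+ 2 = \sum_(i < d) x ord0 i ^+ 2 +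
    (\sum_(i < d) x ord0 i * y ord0 i) *+ 2 + \sum_(i < d) y ord0 i ^+ 2.
  rewrite -sumrMnl -!big_split/=; apply: eq_bigr => i _.
  by rewrite mxE sqrrD.
rewrite lerD2r lerD2l lerMn2r/=.
rewrite (le_trans (ler_norm _))// -sqrtrM// -sqrtr_sqr ler_sqrt ?mulr_ge0//.
exact: cauchy_schwarz.
Qed.

Lemma continuous_enorm : continuous enorm.
Proof.
move=> x; apply: continuous_comp; last exact: sqrt_continuous.
apply: (@continuous_big R _ +%R) => [|i _ y]; first exact: add_continuous.
by apply: (@cvgM _ _ _ (nbhs_filter y)); exact: coord_continuous.
Qed.

End euclidean_norm.

Section weak_topology.
Context (R : realType) (d : nat).

(* The elements are set functions on all subsets, so two of them may agree on
   every Borel set without being equal; the topologies below do not separate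
   such elements, and every construction only evaluates them on Borel sets. *)
Definition Prob : Type := probability 'rV[R]_d R.

Definition Cb : Type := {f : 'rV[R]_d -> R | continuous f /\ bounded_fun f}.

Definition Cb_integral (mu : Prob) : {ptws Cb -> R} :=
  fun f => (\int[mu]_x sval f x)%R.

HB.instance Definition _ := Choice.on Prob.
HB.instance Definition _ := isPointed.Build Prob (dirac (0 : 'rV[R]_d)).

(* The weak topology: the coarsest one for which the integral of every bounded
   continuous function is continuous. *)
HB.instance Definition _ :=
  Topological.copy Prob (initial_topology Cb_integral).

End weak_topology.

Section levy_prokhorov.
Context (R : realType) (d : nat).
Implicit Types (A : set 'rV[R]_d) (mu nu : Prob R d).

Definition thickening A (e : R) : set 'rV[R]_d :=
  [set y | exists2 x, A x & enorm (x - y) < e].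

Lemma open_thickening A e : open (thickening A e).
Proof.
rewrite (_ : thickening A e =
    \bigcup_(x in A) ((fun y => enorm (x - y)) @^-1` [set t | t < e])).
  apply: bigcup_open => x _.
  suff /continuousP : continuous (fun y : 'rV[R]_d => enorm (x - y)).
    by apply; exact: open_lt.
  have cB : continuous (fun y : 'rV[R]_d => x - y).
    move=> y.
    by apply: (@cvgB _ _ _ _ (nbhs_filter y)); [exact: cvg_cst|exact: cvg_id].
  by move=> y; apply: (continuous_comp (cB y)); exact: continuous_enorm.
by apply/seteqP; split => y [x Ax xy]; exists x.
Qed.

Lemma subset_thickening A e : 0 < e -> A `<=` thickening A e.
Proof. by move=> e0 x Ax; exists x => //; rewrite subrr enorm0. Qed.

Lemma thickening_thickening A e1 e2 :
  thickening (thickening A e1) e2 `<=` thickening A (e1 + e2).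
Proof.
move=> z [y [x Ax xy] yz]; exists x => //.
rewrite -(subrKA y) (le_lt_trans (enorm_triangle _ _))//.
exact: ltrD.
Qed.

Definition lp_set mu nu : set R := [set e | 0 < e /\
  forall A, measurable A ->
    (mu A <= nu (thickening A e) + e%:E)%E /\
    (nu A <= mu (thickening A e) + e%:E)%E].

Definition levy_prokhorov mu nu : R := inf (lp_set mu nu).

Lemma lp_set_neq0 mu nu : lp_set mu nu !=set0.
Proof.
exists 1; split=> // A mA.
by split; rewrite (le_trans (probability_le1 _ mA))// leeDr.
Qed.

Lemma lp_set_has_lbound mu nu : has_lbound (lp_set mu nu).
Proof. by exists 0 => e [/ltW]. Qed.

Lemma levy_prokhorov_ge0 mu nu : 0 <= levy_prokhorov mu nu.
Proof. by apply: lb_le_inf; [exact: lp_set_neq0|move=> e [/ltW]]. Qed.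

Lemma levy_prokhorovxx mu : levy_prokhorov mu mu = 0.
Proof.
apply/eqP; rewrite eq_le levy_prokhorov_ge0 andbT.
apply/ler_addgt0Pl => e e0; rewrite addr0.
apply: ge_inf; first exact: lp_set_has_lbound.
split=> // A mA.
have muA : (mu A <= mu (thickening A e) + e%:E)%E.
  rewrite -[leLHS]adde0; apply: leeD; last by rewrite lee_fin ltW.
  apply: le_measure; rewrite ?inE//; last exact: subset_thickening.
  by apply: open_measurable_rV; exact: open_thickening.
by split.
Qed.

Lemma levy_prokhorov_sym mu nu : levy_prokhorov mu nu = levy_prokhorov nu mu.
Proof.
congr inf; apply/seteqP.
by split=> e [e0 h]; split=> // A /h[].
Qed.

Lemma levy_prokhorov_triangle nu mu rho :
  levy_prokhorov mu rho <= levy_prokhorov mu nu + levy_prokhorov nu rho.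
Proof.
apply/ler_addgt0Pl => e e0.
have e20 : 0 < e / 2 by rewrite divr_gt0.
have inf_lt_half m1 m2 : exists2 t, lp_set m1 m2 t &
    t < levy_prokhorov m1 m2 + e / 2.
  by apply: inf_lt; [exact: lp_set_neq0|rewrite ltrDl].
have [s [s0 hs] ltse] := inf_lt_half mu nu.
have [t [t0 ht] ltte] := inf_lt_half nu rho.
have : levy_prokhorov mu rho <= s + t.
  apply: ge_inf; first exact: lp_set_has_lbound.
  split=> [|A mA]; first exact: addr_gt0.
  have mthick B r : measurable (thickening B r).
    by apply: open_measurable_rV; exact: open_thickening.
  have le_thick (m : Prob R d) r1 r2 :
      (m (thickening (thickening A r1) r2) <= m (thickening A (r1 + r2)))%E.
    by apply: le_measure; rewrite ?inE//; exact: thickening_thickening.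
  rewrite EFinD; split.
    have [h1 _] := hs _ mA; have [h2 _] := ht _ (mthick A s).
    apply: (le_trans h1); apply: (le_trans (leeD h2 (lexx _))).
    by rewrite -addeA [X in (_ + X)%E]addeC; apply: leeD.
  have [_ h1] := ht _ mA; have [_ h2] := hs _ (mthick A t).
  apply: (le_trans h1); apply: (le_trans (leeD h2 (lexx _))).
  by rewrite -addeA [s + t]addrC; apply: leeD.
move=> /le_trans; apply; rewrite ltW// (lt_le_trans (ltrD ltse ltte))//.
by rewrite addrACA -splitr addrC.
Qed.

End levy_prokhorov.

Section psi_topology.
Context (R : realType) (d : nat).

Record Psi := {
  Psi_fun :> 'rV[R]_d -> R;
  Psi_continuous : continuous Psi_fun;
  Psi_ge0 : forall x, 0 <= Psi_fun x;
  Psi_growth : (ereal_inf [set (Psi_fun x)%:E | x in [set x | enorm x = r]]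
    @[r --> +oo%R] --> +oo)%E }.

Variable psi : Psi.

Definition Ppsi : Type := {mu : Prob R d | (\int[mu]_x (psi x)%:E < +oo)%E}.

Definition dpsi (mu nu : Ppsi) : R :=
  levy_prokhorov (sval mu) (sval nu) +
  `|(\int[sval mu]_x psi x)%R - (\int[sval nu]_x psi x)%R|.

Let dpsi_ball (mu : Ppsi) (e : R) : set Ppsi := [set nu | dpsi mu nu < e].

Let dpsi_ent : set_system (Ppsi * Ppsi) := entourage_ dpsi_ball.

Let dpsi_ball_center mu (e : R) : 0 < e -> dpsi_ball mu e mu.
Proof.
by move=> e0; rewrite /dpsi_ball/= /dpsi levy_prokhorovxx subrr normr0 addr0.
Qed.

Let dpsi_ball_sym mu nu (e : R) : dpsi_ball mu e nu -> dpsi_ball nu e mu.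
Proof. by rewrite /dpsi_ball/= /dpsi levy_prokhorov_sym distrC. Qed.

Let dpsi_ball_triangle mu nu rho (e1 e2 : R) :
  dpsi_ball mu e1 nu -> dpsi_ball nu e2 rho -> dpsi_ball mu (e1 + e2) rho.
Proof.
rewrite /dpsi_ball/= => h1 h2; apply: le_lt_trans (ltrD h1 h2).
rewrite /dpsi addrACA lerD//; first exact: levy_prokhorov_triangle.
exact: ler_distD.
Qed.

Let dirac0 : Prob R d := dirac (0 : 'rV[R]_d).

Let dirac0_psi : (\int[dirac0]_x (psi x)%:E < +oo)%E.
Proof.
rewrite integral_dirac//; first by rewrite diracT mul1e ltry.
apply/measurable_EFinP; apply: continuous_measurable_rV.
exact: Psi_continuous.
Qed.

HB.instance Definition _ := Choice.on Ppsi.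
HB.instance Definition _ := isPointed.Build Ppsi
  (exist _ dirac0 dirac0_psi).
HB.instance Definition _ := hasNbhs.Build Ppsi (nbhs_ dpsi_ent).
HB.instance Definition _ := @Nbhs_isPseudoMetric.Build R Ppsi
  dpsi_ent erefl dpsi_ball dpsi_ball_center dpsi_ball_sym dpsi_ball_triangle
  erefl.

End psi_topology.

Section large_deviations.
Local Open Scope ereal_scope.
Context (R : realType) (S : ptopologicalType).

Definition borel_set (E : set S) := <<s @open S >> E.

Definition borel_probability (Q : set S -> \bar R) :=
  exists P : probability (g_sigma_algebraType (@open S)) R,
    forall E, borel_set E -> Q E = P E.

Definition rate_function (H : S -> \bar R) :=
  (forall x, 0 <= H x) /\
  (forall M : R, (0 <= M)%R -> compact [set x | H x <= M%:E]).

(* Finitely many Q n may fail to be probability measures: the normalizing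
   constant of a Gibbs measure is only known to be finite for large n. *)
Definition LDP (Q : nat -> set S -> \bar R) (alpha : nat -> R)
    (H : S -> \bar R) :=
  [/\ \forall n \near \oo, borel_probability (Q n),
      alpha n @[n --> \oo] --> +oo%R,
      rate_function H &
      forall E, borel_set E ->
        let rate n := ((alpha n)^-1)%:E * lne (Q n E) in
        [/\ - ereal_inf [set H x | x in E°] <= limn_einf rate,
            limn_einf rate <= limn_esup rate &
            limn_esup rate <= - ereal_inf [set H x | x in closure E]]].

End large_deviations.

Section gibbs.
Local Open Scope ereal_scope.
Context (R : realType) (d : nat).
Implicit Types (ell : {sigma_finite_measure set 'rV[R]_d -> \bar R}).
Implicit Types (V : 'rV[R]_d -> \bar R) (W : 'rV[R]_d * 'rV[R]_d -> \bar R).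

Definition energy V W n (x : n.-tuple 'rV[R]_d) : \bar R :=
  (n%:R^-1)%:E * \sum_(i < n) V (tnth x i) +
  ((2 * n%:R ^+ 2)^-1)%:E *
    \sum_(i < n) \sum_(j < n | i != j) W (tnth x i, tnth x j).

(* \int ... \int f(x_1, ..., x_n) ell(dx_1) ... ell(dx_n) *)
Fixpoint iterated_integral ell n : (n.-tuple 'rV[R]_d -> \bar R) -> \bar R :=
  match n with
  | 0%N => fun f => f [tuple]
  | m.+1 => fun f =>
      \int[ell]_x iterated_integral ell (fun y => f [tuple of x :: y])
  end.

Definition boltzmann V W (beta : nat -> R) n (x : n.-tuple 'rV[R]_d) : \bar R :=
  expeR (- ((beta n)%:E * energy V W x)).

Definition partition_function ell V W beta n : \bar R :=
  iterated_integral ell (@boltzmann V W beta n).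

Definition gibbs ell V W beta n (E : set (n.-tuple 'rV[R]_d)) : \bar R :=
  iterated_integral ell (fun x => (\1_E x)%:E * boltzmann V W beta x) /
  partition_function ell V W beta n.

Section empirical.
Context (n : nat) (x : n.+1.-tuple 'rV[R]_d).

Definition empirical_measure : set 'rV[R]_d -> \bar R :=
  mscale (n.+1%:R^-1)%:nng%R (msum (fun i => dirac (nth 0%R x i)) n.+1).

HB.instance Definition _ := Measure.on empirical_measure.

Let empirical_measureT : empirical_measure setT = 1.
Proof.
rewrite /empirical_measure /mscale/= /msum.
rewrite (eq_bigr (fun=> 1%:E)); last by move=> i _; exact: diracT.
by rewrite sumEFin sumr_const card_ord -EFinM mulVf// pnatr_eq0.
Qed.

HB.instance Definition _ :=
  Measure_isProbability.Build _ _ _ empirical_measure empirical_measureT.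

Definition empirical : Prob R d := empirical_measure.

End empirical.

(* The law Q_{n+1} of the empirical measure L_{n+1}: L_0 does not exist, so the
   sequence of laws starts at index 0 with one particle. *)
Definition empirical_law ell V W beta n (E : set (Prob R d)) : \bar R :=
  gibbs ell V W beta (@empirical n @^-1` E).

(* empirical_law as a measure on the subspace Ppsi psi of Prob R d. *)
Definition empirical_law_psi ell V W beta (psi : Psi R d) n
    (E : set (Ppsi psi)) : \bar R :=
  empirical_law ell V W beta n [set sval mu | mu in E].

Definition J V W (mu : Prob R d) : \bar R :=
  (2^-1)%:E * \int[mu \x mu]_z (W z + V z.1 + V z.2).

Definition Jstar V W (mu : Prob R d) : \bar R :=
  J V W mu - ereal_inf (range (J V W)).

Definition Jstar_psi V W (psi : Psi R d) (mu : Ppsi psi) : \bar R :=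
  J V W (sval mu) - ereal_inf [set J V W (sval nu) | nu in [set: Ppsi psi]].

(* An atom of m is a set A of positive measure all of whose measurable subsets
   of smaller measure are null. *)
Definition atomless (m : set 'rV[R]_d -> \bar R) :=
  ~ exists A, [/\ measurable A, 0 < m A &
      forall B, measurable B -> B `<=` A -> m B < m A -> m B = 0].

Definition assumptionA ell V W (a : R) :=
  [/\ lower_semicontinuous V /\ lower_semicontinuous W,
      (0 <= a < 1)%R,
      \int[ell]_x expeR (- ((1 - a)%:E * V x)) < +oo,
      exists c : R, c%:E < ereal_inf (range V) /\
        c%:E < ereal_inf (range (fun z => W z + a%:E * (V z.1 + V z.2))) &
      exists A, [/\ measurable A, 0 < ell A &
        \int[ell \x ell]_(z in A `*` A) (V z.1 + V z.2 + W z) < +oo]].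

Definition assumptionC1 ell V W (beta : nat -> R) (a : R)
    (gamma : 'rV[R]_d -> R) :=
  [/\ lower_semicontinuous (EFin \o gamma),
      exists phi : R -> R, (forall x, gamma x = phi (enorm x)) /\
        phi s @[s --> +oo%R] --> +oo%R &
      exists (A : set 'rV[R]_d) (r : nat -> R) (C : R),
        let A1 n := A `&` eball (r n) in
        let A2 n := A `\` eball (r n) in
        [/\ measurable A,
            (forall n, (0 < n)%N -> (0 < r n)%R) /\
              r n @[n --> \oo] --> +oo%R,
            forall x y,
              (gamma x * \1_(~` A) x + gamma y * \1_(~` A) y)%:E <=
              V x + V y + W (x, y) + C%:E,
            forall n (x : n.+1.-tuple 'rV[R]_d), uniq x ->
              let L := empirical x in
              \int[L]_(y in A1 n.+1) (gamma y)%:E <=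
              \int[L \x L]_(z in (A1 n.+1 `*` A1 n.+1) `&`
                                   [set z | z.1 != z.2])
                (V z.1 + V z.2 + W z) + C%:E &
            ereal_sup [set (n%:R / beta n)%:E *
                lne (\int[ell]_(x in A2 n)
                  expeR ((beta n / n%:R * gamma x)%:E - (1 - a)%:E * V x))
              | n in [set n | (0 < n)%N]] < C%:E]].

Definition assumptionC2 ell V W :=
  forall mu : Prob R d, J V W mu < +oo ->
    exists mu_ : nat -> Prob R d,
      [/\ forall n, mu_ n `<< ell,
          mu_ n @[n --> \oo] --> mu &
          J V W (mu_ n) @[n --> \oo] --> J V W mu].

(* phi is lsc on R_+, i.e., for the subspace topology. *)
Definition Phi (phi : R -> R) :=
  lower_semicontinuous
    (EFin \o phi : subspace `[0%R, +oo[%classic -> \bar R) /\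
  (phi s / s)%R @[s --> +oo%R] --> +oo%R.

Definition assumptionC3 (psi : Psi R d) (gamma : 'rV[R]_d -> R) :=
  exists2 phi, Phi phi & forall x, gamma x = phi (psi x).

End gibbs.

(* Main.v *)
From HB Require Import structures.
Require Import Defs.
From mathcomp Require Import all_boot all_order all_algebra.
From mathcomp Require Import all_classical all_reals all_analysis.
From mathcomp Require Import measurable_realfun.
From mathcomp Require Import ring lra.

(** The weight that the density [exp (- beta n H_n)] gives to a set of empirical
    measures is estimated at the exponential scale [beta n] before any
    normalization. The normalizing constant is the weight of the whole space,
    so the principle for the laws follows from the one for the weights by
    subtracting the infimum of the rate [J] ([abstract_LDP]).

    With the constants of [assumptionA], [2 * J] is, up to the constant
    [2 * kappa], the double integral of a nonnegative lower semicontinuous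
    function [pair_energy]. Likewise [H_n] is half the double sum of
    [pair_energy] over the pairs of distinct particles, up to a constant close
    to [kappa], once a fraction [n / beta n] of the energy has been set aside
    to produce the factors [exp (- (1 - a) V)], which are integrable
    ([boltzmann_le]). Entropy is absent from the limit: it lives at the scale [n],
    which is negligible with respect to [beta n].

    Upper bound. The double integral of [pair_energy] is approximated from
    below by double integrals of bounded finite sums of products of continuous
    functions of one variable ([lsc_finite_rank_minorant]). These depend
    continuously on the measure, and the diagonal contributes a term of order
    [1 / n], so a small weak neighbourhood of [mu] has weight at most
    [exp (- beta n * r)] for [r] below [J mu] ([local_upper_bound]). Finitely
    many such neighbourhoods cover a compact set. The set of measures with
    integral of [gamma] at most [M] is compact, by the theorem of Prokhorov
    ([sublevel_compact]), and [assumptionC1] makes the weight of its complement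
    as small as wanted ([exponential_tightness]).

    Lower bound. If [nu] is dominated by a multiple of [ell], integrating
    against the product of copies of [nu] in place of [ell] costs a factor
    exponential in [n], which is negligible, and under that product the
    empirical measure is close to [nu] and the energy close to its mean, by the
    second moment method ([dominated_lower_bound]). The measures given by
    [assumptionC2] are limits of dominated ones with the same energy, by
    truncation of their densities ([dominated_approximation]), so that every
    measure of finite energy is reached ([gibbs_lower_bound]).

    Under [assumptionC3] the function [psi] is uniformly integrable on the
    compact sets above, on which the weak topology is therefore as fine as that
    of [dpsi] ([dpsi_near]); as their complements have negligible weight, all
    the estimates pass to the finer topology. *)

Set Implicit Arguments.
Unset Strict Implicit.
Unset Printing Implicit Defensive.

Import Order.TTheory GRing.Theory Num.Theory.
Import numFieldNormedType.Exports.

Local Open Scope classical_set_scope.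
Local Open Scope ring_scope.

(** * Iterated integrals *)

Section monotone_integrals.
Local Open Scope ereal_scope.
Context d (T : measurableType d) (R : realType).
Implicit Types f g : T -> \bar R.

Import HBNNSimple.

(** The integral of a nonnegative function is a supremum over the simple
    functions below it, so monotonicity holds without measurability. *)
Lemma le_integralT (mu : {measure set T -> \bar R}) f g :
  (forall x, f x <= g x) -> \int[mu]_x f x <= \int[mu]_x g x.
Proof.
move=> fg; rewrite integralE [leRHS]integralE; apply: leeB.
  rewrite !ge0_integralTE//; apply: le_ereal_sup => _ [h hf <-].
  exists h => // x; apply: le_trans (hf x) _.
  by rewrite !funeposE ge_max !le_max fg lexx orbT.
rewrite !ge0_integralTE//; apply: le_ereal_sup => _ [h hf <-].
exists h => // x; apply: le_trans (hf x) _.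
by rewrite !funenegE ge_max !le_max leeN2 fg lexx orbT.
Qed.

Lemma le_measure_ge0_integral (mu nu : {measure set T -> \bar R}) f :
  (forall A, measurable A -> mu A <= nu A) -> (forall x, 0 <= f x) ->
  \int[mu]_x f x <= \int[nu]_x f x.
Proof.
move=> munu f0; rewrite !ge0_integralTE//; apply: ge_ereal_sup => _ [h hf <-].
apply: (@le_trans _ _ (sintegral nu h)); first exact: le_measure_sintegral.
by apply: ereal_sup_ubound; exists h.
Qed.

Lemma integral_probability_cst (mu : probability T R) (r : \bar R) :
  \int[mu]_x r = r.
Proof. by rewrite integral_cst//= probability_setT mule1. Qed.

End monotone_integrals.

Lemma closed_measurable_rV (R : realType) (d : nat) (A : set 'rV[R]_d) :
  closed A -> measurable A.
Proof.
move=> cA; rewrite -(setCK A); apply: measurableC.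
by apply: open_measurable_rV; exact: closed_openC.
Qed.

Lemma measurable_set1_rV (R : realType) (d : nat) (x : 'rV[R]_d) :
  measurable [set x].
Proof.
apply: closed_measurable_rV; apply: accessible_closed_set1.
by apply: hausdorff_accessible; exact: norm_hausdorff.
Qed.

Section iterated_integral.
Local Open Scope ereal_scope.
Context (R : realType) (d : nat).
Local Notation E := 'rV[R]_d.
Implicit Types ell : {sigma_finite_measure set E -> \bar R}.

Lemma iterated_integral_ge0 ell n (f : n.-tuple E -> \bar R) :
  (forall x, 0 <= f x) -> 0 <= iterated_integral ell f.
Proof.
by elim: n f => [|n IH] f f0 //=; apply: integral_ge0 => x _; exact: IH.
Qed.

Lemma le_iterated_integral ell n (f g : n.-tuple E -> \bar R) :
  (forall x, f x <= g x) -> iterated_integral ell f <= iterated_integral ell g.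
Proof.
by elim: n f g => [|n IH] f g fg //=; apply: le_integralT => x; exact: IH.
Qed.

Lemma measurable_cons_tuple d' (T : measurableType d') n :
  measurable_fun setT (fun z : T * n.-tuple T => [tuple of z.1 :: z.2]).
Proof. exact: (measurable_cons measurable_fst measurable_snd). Qed.

(** The parameter stands for the variables already fixed, which makes the
    induction on the number of remaining ones possible. *)
Lemma measurable_iterated_integral ell n d' (T : measurableType d')
    (f : T * n.-tuple E -> \bar R) :
  measurable_fun setT f -> (forall z, 0 <= f z) ->
  measurable_fun setT (fun t => iterated_integral ell (fun x => f (t, x))).
Proof.
elim: n d' T f => [|n IH] d' T f mf f0 /=.
  by apply: (measurableT_comp mf); apply: measurable_fun_pair.
pose g (z : (T * E) * n.-tuple E) := f (z.1.1, [tuple of z.1.2 :: z.2]).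
have mg : measurable_fun setT g.
  apply: (measurableT_comp mf); apply: measurable_fun_pair => /=.
    exact: (measurableT_comp measurable_fst measurable_fst).
  apply: measurable_cons => //.
  exact: (measurableT_comp measurable_snd measurable_fst).
have mIg := IH _ _ g mg (fun z => f0 _).
have := @measurable_fun_fubini_tonelli_F _ _ T E R ell _ mIg.
apply => z.
by apply: iterated_integral_ge0 => x; exact: f0.
Qed.

Lemma measurable_iterated_integral_cons ell n (f : n.+1.-tuple E -> \bar R) :
  measurable_fun setT f -> (forall x, 0 <= f x) ->
  measurable_fun setT
    (fun t => iterated_integral ell (fun x => f [tuple of t :: x])).
Proof.
move=> mf f0.
apply: (@measurable_iterated_integral ell n _ E
  (fun z => f [tuple of z.1 :: z.2])) => //.
apply: (measurableT_comp mf).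
exact: measurable_cons_tuple.
Qed.

Lemma measurable_section_cons n (f : n.+1.-tuple E -> \bar R) (t : E) :
  measurable_fun setT f -> measurable_fun setT (fun x : n.-tuple E => f [tuple of t :: x]).
Proof. by move=> mf; apply: (measurableT_comp mf); exact: measurable_cons. Qed.

Lemma iterated_integralD ell n (f g : n.-tuple E -> \bar R) :
  measurable_fun setT f -> measurable_fun setT g ->
  (forall x, 0 <= f x) -> (forall x, 0 <= g x) ->
  iterated_integral ell (fun x => f x + g x) =
  iterated_integral ell f + iterated_integral ell g.
Proof.
elim: n f g => [|n IH] f g mf mg f0 g0 //=.
under eq_integral => x _.
  rewrite IH//; [|exact: measurable_section_cons..].
  over.
rewrite ge0_integralD//.
- by move=> x _; exact: iterated_integral_ge0.
- exact: measurable_iterated_integral_cons.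
- by move=> x _; exact: iterated_integral_ge0.
- exact: measurable_iterated_integral_cons.
Qed.

Lemma iterated_integralZl ell n (f : n.-tuple E -> \bar R) k :
  measurable_fun setT f -> (forall x, 0 <= f x) -> 0 <= k ->
  iterated_integral ell (fun x => k * f x) = k * iterated_integral ell f.
Proof.
elim: n f => [|n IH] f mf f0 k0 //=.
under eq_integral => x _.
  rewrite IH//; [|exact: measurable_section_cons].
  over.
rewrite ge0_integralZl//; first exact: measurable_iterated_integral_cons.
by move=> x _; exact: iterated_integral_ge0.
Qed.

Lemma iterated_integral_sum ell n (I : Type) (s : seq I)
    (f : I -> n.-tuple E -> \bar R) :
  (forall i, measurable_fun setT (f i)) -> (forall i x, 0 <= f i x) ->
  iterated_integral ell (fun x => \sum_(i <- s) f i x) =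
  \sum_(i <- s) iterated_integral ell (f i).
Proof.
move=> mf f0; elim: s => [|i s IH].
  rewrite big_nil; apply/eqP; rewrite eq_le.
  apply/andP; split; last by apply: iterated_integral_ge0 => x; rewrite big_nil.
  apply: (@le_trans _ _ (iterated_integral ell (fun x : n.-tuple E => 0 * 0))).
    by apply: le_iterated_integral => x; rewrite big_nil mule0.
  by rewrite (@iterated_integralZl ell n (cst 0))// mul0e.
rewrite big_cons -IH -iterated_integralD//.
- by congr iterated_integral; apply/funext => x; rewrite big_cons.
- exact: emeasurable_sum.
- by move=> x; exact: sume_ge0.
Qed.

Lemma iterated_integral_nneseries ell n (f : nat -> n.-tuple E -> \bar R) :
  (forall k, measurable_fun setT (f k)) -> (forall k x, 0 <= f k x) ->
  iterated_integral ell (fun x => \sum_(k <oo) f k x) =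
  \sum_(k <oo) iterated_integral ell (f k).
Proof.
elim: n f => [|n IH] f mf f0 //=.
under eq_integral => x _.
  rewrite IH//; last by move=> k; exact: measurable_section_cons.
  over.
rewrite integral_nneseries// => k.
  exact: measurable_iterated_integral_cons.
by move=> x _; exact: iterated_integral_ge0.
Qed.

Lemma iterated_integral_cst (nu : probability E R) n r :
  iterated_integral nu (fun _ : n.-tuple E => r) = r.
Proof.
elim: n => [|n IH] //=.
by under eq_integral do rewrite IH; exact: integral_probability_cst.
Qed.

Lemma measurable_prod_tnth n (f : E -> \bar R) : measurable_fun setT f ->
  measurable_fun setT (fun x : n.-tuple E => \prod_(i < n) f (tnth x i)).
Proof.
move=> mf; elim: (index_enum _) => [|i s IHs].
  by under eq_fun do rewrite big_nil; exact: measurable_cst.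
under eq_fun do rewrite big_cons.
apply: emeasurable_funM => //; apply: (measurableT_comp mf).
exact: measurable_tnth.
Qed.

Lemma iterated_integral_prod ell n (f : E -> \bar R) :
  measurable_fun setT f -> (forall x, 0 <= f x) ->
  iterated_integral ell (fun x : n.-tuple E => \prod_(i < n) f (tnth x i)) =
  (\int[ell]_x f x) ^+ n.
Proof.
move=> mf f0; elim: n => [|n IH]; first by rewrite /= big_ord0.
rewrite expeS [LHS]/=.
have -> : (fun x : E => iterated_integral ell (fun y : n.-tuple E =>
    \prod_(i < n.+1) f (tnth [tuple of x :: y] i))) =
    (fun x => f x * (\int[ell]_x f x) ^+ n).
  apply/funext => x; rewrite -IH -iterated_integralZl//.
  - congr iterated_integral; apply/funext => y; rewrite big_ord_recl; congr (_ * _).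
    by apply: eq_bigr => i _; rewrite tnthS.
  - exact: measurable_prod_tnth.
  - by move=> y; exact: prode_ge0.
by rewrite ge0_integralZr// expe_ge0// integral_ge0.
Qed.

(** When [ell] does not charge points, each variable avoids almost everywhere
    the finitely many points chosen before it, which the induction collects in
    a list. *)
Lemma le_iterated_integral_uniq ell n (f g : n.-tuple E -> \bar R) :
  (forall x, ell [set x] = 0) ->
  measurable_fun setT f -> measurable_fun setT g ->
  (forall x, 0 <= f x) -> (forall x, 0 <= g x) ->
  (forall x : n.-tuple E, uniq x -> f x <= g x) ->
  iterated_integral ell f <= iterated_integral ell g.
Proof.
move=> ell0 mf mg f0 g0 fg.
have {fg} : forall x : n.-tuple E, uniq x ->
    {in [::], forall z, z \notin tval x} -> f x <= g x.
  by move=> x ux _; exact: fg.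
elim: n [::] f g mf mg f0 g0 => [|n IH] s f g mf mg f0 g0 fg /=.
  exact: fg.
have null_s : ell.-negligible [set` s].
  elim: s {fg} => [|z s IHs]; first by rewrite set_nil; exact: negligible_set0.
  apply: (@negligibleS _ _ _ _ ([set z] `|` [set` s])).
    by move=> w /=; rewrite inE => /orP[/eqP|]; [left|right].
  apply: negligibleU => //.
  exists [set z]; split; [exact: measurable_set1_rV|exact: ell0|by []].
apply: ae_ge0_le_integral => //.
- by move=> x _; exact: iterated_integral_ge0.
- exact: measurable_iterated_integral_cons.
- by move=> x _; exact: iterated_integral_ge0.
- exact: measurable_iterated_integral_cons.
apply: negligibleS null_s => z /=; apply: contra_notP => /negP zs _.
apply: (IH (z :: s)) => //; [exact: measurable_section_cons..|].
move=> y uy ys; apply: fg => /=.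
  by rewrite uy andbT; apply: ys; rewrite mem_head.
move=> w ws; rewrite inE negb_or ys ?inE ?ws ?orbT// andbT.
by apply: contraNneq zs => <-.
Qed.

(** Each of the [n] variables costs a factor [M]. *)
Lemma le_measure_iterated_integral ell (nu : probability E R) (M : {nonneg R})
    n (f : n.-tuple E -> \bar R) :
  (forall A, measurable A -> nu A <= M%:num%:E * ell A) ->
  measurable_fun setT f -> (forall x, 0 <= f x) ->
  iterated_integral nu f <= (M%:num ^+ n)%:E * iterated_integral ell f.
Proof.
move=> nuell; elim: n f => [|n IH] f mf f0 /=; first by rewrite mul1e.
apply: (@le_trans _ _ (\int[nu]_x
    ((M%:num ^+ n)%:E * iterated_integral ell (fun y => f [tuple of x :: y])))).
  apply: le_integralT => x; apply: IH => //; exact: measurable_section_cons.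
have mIf := measurable_iterated_integral_cons ell mf f0.
have If0 x : 0 <= iterated_integral ell (fun y => f [tuple of x :: y]).
  exact: iterated_integral_ge0.
rewrite ge0_integralZl//.
rewrite exprSr EFinM -muleA; apply: lee_wpmul2l.
  by rewrite lee_fin exprn_ge0.
rewrite -ge0_integral_mscale//.
exact: le_measure_ge0_integral.
Qed.

Lemma iterated_integral_tnth (nu : probability E R) n (f : E -> \bar R)
    (i : 'I_n) :
  iterated_integral nu (fun x : n.-tuple E => f (tnth x i)) = \int[nu]_x f x.
Proof.
elim: n i => [[]//|n IH] i /=.
case: (unliftP ord0 i) => [j ->|->].
  under eq_integral => x _.
    rewrite (_ : (fun y : n.-tuple E => _) = fun y => f (tnth y j)).
      rewrite IH; over.
    by apply/funext => y; rewrite tnthS.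
  exact: integral_probability_cst.
by apply: eq_integral => x _; exact: (iterated_integral_cst nu n (f x)).
Qed.

Lemma iterated_integral_tnth2 (nu : probability E R) n (f : E * E -> \bar R)
    (i j : 'I_n) : measurable_fun setT f -> (forall z, 0 <= f z) -> i != j ->
  iterated_integral nu (fun x : n.-tuple E => f (tnth x i, tnth x j)) =
  \int[nu \x nu]_z f z.
Proof.
move=> mf f0; elim: n i j => [[]//|n IH] i j ij /=.
case: (unliftP ord0 i) ij => [k ->|->]; case: (unliftP ord0 j) => [l ->|->] kl.
- under eq_integral => x _.
    rewrite (_ : (fun y : n.-tuple E => _) =
        fun y => f (tnth y k, tnth y l)).
      rewrite IH; last by apply: contra_neq kl => ->.
      over.
    by apply/funext => y; rewrite !tnthS.
  exact: integral_probability_cst.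
- rewrite fubini_tonelli2//; apply: eq_integral => x _.
  rewrite /fubini_G -(iterated_integral_tnth nu _ k).
  by congr iterated_integral; apply/funext => y; rewrite tnthS.
- rewrite fubini_tonelli1//; apply: eq_integral => x _.
  rewrite /fubini_F -(iterated_integral_tnth nu _ l).
  by congr iterated_integral; apply/funext => y; rewrite tnthS.
- by rewrite eqxx in kl.
Qed.

End iterated_integral.

(** * Second countability and lower semicontinuous functions *)

Section countable_base.
Context (R : realType) (d : nat).
Local Notation E := 'rV[R]_d.

Definition rational_point (q : 'rV[rat]_d) : E := map_mx ratr q.

Lemma rational_point_dense (x : E) (e : R) : 0 < e ->
  exists q, ball x e (rational_point q).
Proof.
move=> e0; have h i : exists q : rat, ball (x ord0 i) e (ratr q).
  have [||r [br [q _ qE]]] := @dense_rat R (ball (x ord0 i) e).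
  - by exists (x ord0 i); exact: ballxx.
  - exact: ball_open.
  - by exists q; rewrite qE.
have [q hq] := choice h.
exists (\row_i q i); split => // i j; rewrite !mxE (ord1 i); exact: hq.
Qed.

Lemma ball_split_rational (x : E) (e : R) : 0 < e ->
  exists q k, ball (rational_point q) k.+1%:R^-1 x /\
    ball (rational_point q) k.+1%:R^-1 `<=` ball x e.
Proof.
move=> e0; have [k ke] : exists k, k.+1%:R^-1 < e / 2.
  exists (Num.truncn (e / 2)^-1).
  by rewrite invf_plt ?posrE ?divr_gt0// truncnS_gt.
have k0 : 0 < k.+1%:R^-1 :> R by rewrite invr_gt0.
have [q xq] := rational_point_dense x k0.
exists q, k; split; first exact: ball_sym.
move=> y qy; rewrite (splitr e); apply: ball_triangle (le_ball (ltW ke) xq) _.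
exact: le_ball (ltW ke) _ qy.
Qed.

(** This puts the open sets of a product space in the product sigma-algebra,
    the boxes with rational data being a countable base. *)
Lemma countable_base_measurable d' (T : measurableType d') (I : countType)
    (B : I -> set T) (A : set T) : (forall i, measurable (B i)) ->
  (forall x, A x -> exists i, B i x /\ B i `<=` A) -> measurable A.
Proof.
move=> mB AB.
have -> : A = \bigcup_i (if `[< B i `<=` A >] then B i else set0).
  apply/seteqP; split => [x /AB[i [Bix BiA]]|x [i _]].
    by exists i => //; case: asboolP.
  by case: asboolP => // h /h.
apply: countable_bigcupT_measurable => // i.
by case: ifP.
Qed.

Lemma measurable_ball_rV (x : E) e : measurable (ball x e).
Proof.
apply: open_measurable_rV; have [e0|e0] := ltP 0 e.
  exact: ball_open.
rewrite (_ : ball x e = set0) ?open0//; apply/seteqP; split => // y.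
by case=> /lt_le_trans /(_ e0); rewrite ltxx. Qed.

Lemma open_measurable_rV2 (A : set (E * E)) : open A -> measurable A.
Proof.
move=> oA.
pose B (i : 'rV[rat]_d * nat * ('rV[rat]_d * nat)) : set (E * E) :=
  ball (rational_point i.1.1) i.1.2.+1%:R^-1 `*`
  ball (rational_point i.2.1) i.2.2.+1%:R^-1.
apply: (@countable_base_measurable _ _ _ B).
  by move=> i; apply: measurableX; exact: measurable_ball_rV.
move=> [x y] Axy; have [e /= e0 eA] : nbhs_ball (x, y) A.
  by apply/nbhs_ballP; apply: open_nbhs_nbhs.
have [p [k [px pe]]] := ball_split_rational x e0.
have [q [l [qy qe]]] := ball_split_rational y e0.
exists ((p, k), (q, l)); split => //= -[u v] [/= pu qv].
by apply: eA; split; [exact: pe|exact: qe].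
Qed.

(** For sets of tuples the countable base replaces a comparison of two
    sigma-algebras: such sets are the open sets of the product topology. *)
Definition tuple_open n (A : set (n.-tuple E)) := forall x, A x ->
  exists2 e : R, 0 < e &
    forall y, (forall i, ball (tnth x i) e (tnth y i)) -> A y.

Lemma tuple_open_measurable n (A : set (n.-tuple E)) :
  tuple_open A -> measurable A.
Proof.
move=> oA.
pose B (i : n.-tuple ('rV[rat]_d * nat)) : set (n.-tuple E) :=
  [set x | forall j, ball (rational_point (tnth i j).1)
    (tnth i j).2.+1%:R^-1 (tnth x j)].
apply: (@countable_base_measurable _ _ _ B).
  move=> i; rewrite /B.
  rewrite (_ : mkset _ = \bigcap_(j in [set: 'I_n]) [set x : n.-tuple E |
    ball (rational_point (tnth i j).1) (tnth i j).2.+1%:R^-1 (tnth x j)]);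
    last first.
    by apply/seteqP; split => [x h j _|x h j]; [exact: h|exact: (h j)].
  apply: fin_bigcap_measurable => [|j _]; first exact: finite_finset.
  rewrite -[X in measurable X]setTI; apply: measurable_tnth => //.
  exact: measurable_ball_rV.
move=> x Ax; have [e e0 eA] := oA _ Ax.
have h j : exists qk : 'rV[rat]_d * nat,
    ball (rational_point qk.1) qk.2.+1%:R^-1 (tnth x j) /\
    ball (rational_point qk.1) qk.2.+1%:R^-1 `<=` ball (tnth x j) e.
  by have [q [k h]] := ball_split_rational (tnth x j) e0; exists (q, k).
have [qk hqk] := choice h.
exists [tuple of map qk (ord_tuple n)]; split.
  by move=> j; rewrite tnth_map tnth_ord_tuple; apply: (hqk j).1.
move=> y hy; apply: eA => j; apply: (hqk j).2.
by have := hy j; rewrite tnth_map tnth_ord_tuple.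
Qed.

End countable_base.

Section lower_semicontinuity.
Local Open Scope ereal_scope.
Context (R : realType) (d : nat).
Local Notation E := 'rV[R]_d.

Lemma lsc_measurable (f : E -> \bar R) :
  lower_semicontinuous f -> measurable_fun setT f.
Proof.
move=> /lower_semicontinuousP lf.
apply: (measurability _ (ErealGenOInfty.measurableE R)).
move=> /= _ [_ [a ->]] <-; rewrite setTI; apply: open_measurable_rV.
by rewrite preimage_itvoy; exact: lf.
Qed.

Lemma lsc_measurable2 (f : E * E -> \bar R) :
  lower_semicontinuous f -> measurable_fun setT f.
Proof.
move=> /lower_semicontinuousP lf.
apply: (measurability _ (ErealGenOInfty.measurableE R)).
move=> /= _ [_ [a ->]] <-; rewrite setTI; apply: open_measurable_rV2.
by rewrite preimage_itvoy; exact: lf.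
Qed.

Lemma lte_add_split (x y : \bar R) (a : R) : -oo < x -> -oo < y ->
  a%:E < x + y -> exists b c : R, [/\ b%:E < x, c%:E < y & (a <= b + c)%R].
Proof.
case: x => [x| |]// _; case: y => [y| |]// _.
- rewrite lte_fin => axy; exists (x - (x + y - a) / 2)%R.
  by exists (y - (x + y - a) / 2)%R; rewrite !lte_fin; split; lra.
- move=> _; exists (x - 1)%R, (a - (x - 1))%R.
  by rewrite lte_fin ltry; split => //; lra.
- move=> _; exists (a - (y - 1))%R, (y - 1)%R.
  by rewrite lte_fin ltry; split => //; lra.
- by move=> _; exists 0%R, a; rewrite !ltry; split => //; lra.
Qed.

Lemma lscD (X : topologicalType) (f g : X -> \bar R) :
  (forall x, -oo < f x) -> (forall x, -oo < g x) ->
  lower_semicontinuous f -> lower_semicontinuous g ->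
  lower_semicontinuous (fun x => f x + g x).
Proof.
move=> fN gN lf lg x a /lte_add_split[]// b [c [bf cg abc]].
have [A xA Af] := lf _ _ bf; have [B xB Bg] := lg _ _ cg.
exists (A `&` B); first exact: filterI.
move=> y [/Af bfy /Bg cgy]; apply: (@le_lt_trans _ _ (b%:E + c%:E)).
  by rewrite lee_fin.
exact: lteD.
Qed.

Lemma lsc_comp (X Y : topologicalType) (f : Y -> \bar R) (h : X -> Y) :
  continuous h -> lower_semicontinuous f -> lower_semicontinuous (f \o h).
Proof.
move=> ch lf x a /lf[A hxA Af]; exists (h @^-1` A); first exact: ch.
by move=> y; exact: Af.
Qed.

Lemma lsc_cst (X : topologicalType) (r : \bar R) :
  lower_semicontinuous (fun _ : X => r).
Proof. by move=> x a ar; exists setT => //; exact: filterT. Qed.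

Lemma lsc_scale (X : topologicalType) (f : X -> \bar R) (r : R) : (0 <= r)%R ->
  lower_semicontinuous f -> lower_semicontinuous (fun x => r%:E * f x).
Proof.
rewrite le_eqVlt => /predU1P[<- _|r0 lf].
  by under eq_fun do rewrite mul0e; exact: lsc_cst.
move=> x a; rewrite -lte_pdivrMl// -EFinM => /lf[A xA Af].
by exists A => // y /Af; rewrite EFinM lte_pdivrMl.
Qed.

End lower_semicontinuity.

Section weak_convergence.
Context (R : realType) (d : nat).
Local Notation E := 'rV[R]_d.

(** The weak topology is initial for the integrals of the members of [Cb]. *)
Lemma weak_cvgP (F : set_system (Prob R d)) (mu : Prob R d) : Filter F ->
  (F --> mu) <-> forall f : Cb R d,
    (fun nu : Prob R d => (\int[nu]_x sval f x)%R) @ F --> (\int[mu]_x sval f x)%R.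
Proof.
move=> FF; split => [Fmu f|Fmu A].
  have cI := @initial_continuous (Prob R d) {ptws Cb R d -> R} (@Cb_integral R d).
  have h1 := cvg_comp _ _ Fmu (cI mu).
  move=> A nA.
  have /cvg_sup/(_ f) h2 : nbhs (Cb_integral mu : {ptws Cb R d -> R}) -->
    (Cb_integral mu : {ptws Cb R d -> R}) by exact: cvg_id.
  apply: (h1 ((fun g : {ptws Cb R d -> R} => g f) @^-1` A)); apply: h2.
  exact: (@initial_continuous {ptws Cb R d -> R} R (fun g => g f) _ A nA).
have h : (@Cb_integral R d) @ F --> (Cb_integral mu : {ptws Cb R d -> R}).
  apply/cvg_sup => f; apply/cvg_image.
    by apply/seteqP; split=> // y _; exists (fun=> y).
  move=> D nD; exists ((fun g : {ptws Cb R d -> R} => g f) @^-1` D).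
    exact: (Fmu f D nD).
  by apply/seteqP; split=> [_ [g gD <-]//|y yD]; exists (fun=> y).
move=> [_ [[B oB <-] Bmu BA]].
apply: (filterS BA); apply: h.
exact: open_nbhs_nbhs.
Qed.

Definition weak_gap (s : seq (Cb R d)) (mu nu : Prob R d) : R :=
  \sum_(f <- s) ((\int[nu]_x sval f x) - (\int[mu]_x sval f x)) ^+ 2.

Lemma weak_gap_ge0 s mu nu : 0 <= weak_gap s mu nu.
Proof. by apply: sumr_ge0 => f _; exact: sqr_ge0. Qed.

(** Sums of squares are the form of the basic weak neighbourhoods to which
    Chebyshev's inequality applies directly. *)
Lemma weak_nbhs_gap (mu : Prob R d) N : nbhs mu N ->
  exists s e, 0 < e /\ forall nu, weak_gap s mu nu < e -> N nu.
Proof.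
move: N; pose G := filter_from [set se : seq (Cb R d) * R | 0 < se.2]
  (fun se => [set nu | weak_gap se.1 mu nu < se.2]).
have FG : Filter G.
  apply: filter_from_filter; first by exists ([::], 1) => /=.
  move=> [s e] [t e'] /= e0 e'0; exists (s ++ t, Num.min e e') => /=.
    by rewrite lt_min e0.
  move=> nu /=; rewrite /weak_gap big_cat/= lt_min => /andP[h1 h2].
  have hs := weak_gap_ge0 s mu nu; have ht := weak_gap_ge0 t mu nu.
  by rewrite /weak_gap in hs ht; split; lra.
suff : G --> mu by move=> h N /h[[s e] /= e0 h']; exists s, e.
apply/weak_cvgP => f; apply/cvgrPdist_lt => e e0.
exists ([:: f], e ^+ 2) => /=; first by rewrite exprn_gt0.
move=> nu /=; rewrite /weak_gap big_seq1 => h.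
rewrite distrC -(@ltr_pXn2r _ 2)// ?nnegrE ?(ltW e0)//.
by rewrite real_normK ?num_real.
Qed.

End weak_convergence.

Section empirical_measures.
Context (R : realType) (d : nat).
Local Notation E := 'rV[R]_d.

Lemma ge0_integral_empirical n (x : n.+1.-tuple E) (f : E -> \bar R) :
  measurable_fun setT f -> (forall y, 0 <= f y)%E ->
  (\int[empirical x]_y f y =
   (n.+1%:R^-1)%:E * \sum_(i < n.+1) f (tnth x i))%E.
Proof.
move=> mf f0; rewrite /empirical /empirical_measure ge0_integral_mscale//=.
rewrite ge0_integral_measure_sum//; congr (_ * _)%E; apply: eq_bigr => i _.
by rewrite integral_dirac// diracT mul1e (tnth_nth 0).
Qed.

Lemma integral_empirical n (x : n.+1.-tuple E) (f : E -> R) :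
  measurable_fun setT f ->
  (\int[empirical x]_y (f y)%:E =
   (n.+1%:R^-1 * \sum_(i < n.+1) f (tnth x i))%R%:E)%E.
Proof.
move=> mf; have mf' : measurable_fun setT (EFin \o f) by exact/measurable_EFinP.
rewrite integralE !ge0_integral_empirical//; last 2 first.
- exact: measurable_funeneg.
- exact: measurable_funepos.
have posE y : ((EFin \o f)^\+ y = (Num.max (f y) 0)%:E)%E.
  by rewrite funeposE/= -EFin_max.
have negE y : ((EFin \o f)^\- y = (Num.max (- f y) 0)%:E)%E.
  by rewrite funenegE/= -EFin_max.
under eq_bigr do rewrite posE.
under [X in (_ - _ * X)%E]eq_bigr do rewrite negE.
rewrite !sumEFin -!EFinM -EFinB -mulrBr -sumrB; congr (_ * _)%:E.
apply: eq_bigr => i _; rewrite /Num.max.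
by case: ifPn; case: ifPn; rewrite -?leNgt; lra.
Qed.

(** The neighbourhood filter of the product topology on tuples. *)
Definition tuple_nbhs n (x : n.-tuple E) : set_system (n.-tuple E) :=
  filter_from [set e : R | 0 < e]
    (fun e => [set y | forall i, ball (tnth x i) e (tnth y i)]).

#[global] Instance tuple_nbhs_filter n (x : n.-tuple E) : Filter (tuple_nbhs x).
Proof.
apply: filter_from_filter; first by exists 1 => /=.
move=> e e' /= e0 e'0; exists (Num.min e e') => /=; first by rewrite lt_min e0.
by move=> y /= h; split => i; apply: le_ball (h i); rewrite ge_min lexx ?orbT.
Qed.

Lemma tuple_nbhs_open n (A : set (n.-tuple E)) :
  (forall x, A x -> tuple_nbhs x A) -> tuple_open A.
Proof. by move=> h x /h[e e0 eA]; exists e => // y /eA. Qed.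

Lemma average_cvg n (x : n.+1.-tuple E) (f : E -> R) : continuous f ->
  n.+1%:R^-1 * \sum_(i < n.+1) f (tnth y i) @[y --> tuple_nbhs x] -->
  n.+1%:R^-1 * \sum_(i < n.+1) f (tnth x i).
Proof.
move=> cf; have xi i : (fun y => tnth y i) @ tuple_nbhs x --> tnth x i.
  by move=> A /nbhs_ballP[e e0 eA]; exists e => // y /= h; exact: eA.
apply: cvgM; first exact: cvg_cst.
apply: (@cvg_big R _ +%R) => [|i _]; first exact: add_continuous.
exact: (cvg_comp _ _ (xi i) (cf _)).
Qed.

Lemma empirical_cvg n (x : n.+1.-tuple E) :
  (@empirical R d n) @ tuple_nbhs x --> (empirical x : Prob R d).
Proof.
apply/weak_cvgP => f; have [cf bf] := svalP f.
have mf := continuous_measurable_rV cf.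
have RE y : (\int[empirical y]_z sval f z)%R =
    n.+1%:R^-1 * \sum_(i < n.+1) sval f (tnth y i).
  by rewrite /Rintegral integral_empirical.
rewrite RE; have /funext RE' := RE.
rewrite -[X in X --> _]/((fun y => (\int[empirical y]_z sval f z)%R) @ _) RE'.
exact: average_cvg.
Qed.

Lemma tuple_open_preimage_empirical n (G : set (Prob R d)) : open G ->
  tuple_open (@empirical R d n @^-1` G).
Proof.
move=> oG; apply: tuple_nbhs_open => x Gx.
by apply: empirical_cvg; exact: open_nbhs_nbhs.
Qed.

End empirical_measures.

(** * Inferior and superior limits *)

Section limits.
Local Open Scope ereal_scope.
Context (R : realType).
Implicit Types (u : nat -> \bar R) (x y : \bar R).

Lemma lee_fin_approx x y : (forall t : R, t%:E < x -> t%:E <= y) -> x <= y.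
Proof.
case: x => [r| |] h; last by rewrite leNye.
- apply/lee_subgt0Pr => e e0; rewrite -EFinB.
  by apply: h; rewrite lte_fin ltrBlDr ltrDl.
- by rewrite leye_eq; apply/eqP/eqyP => t _; apply: h; rewrite ltry.
Qed.

Lemma limn_esup_le u y : (\forall n \near \oo, u n <= y) -> limn_esup u <= y.
Proof.
move=> h; rewrite /limn_esup limf_esupE.
apply: (@le_trans _ _ (ereal_sup (u @` [set n | u n <= y]))).
  by apply: ereal_inf_lbound; exists [set n | u n <= y].
by apply: ge_ereal_sup => _ [n /= un <-].
Qed.

Lemma limn_einf_ge u y : (\forall n \near \oo, y <= u n) -> y <= limn_einf u.
Proof.
move=> h; rewrite /limn_einf leeNr; apply: limn_esup_le.
by apply: filterS h => n; rewrite leeN2.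
Qed.

Lemma limn_einf_le u y : (forall n, u n <= y) -> limn_einf u <= y.
Proof.
move=> h; apply: le_trans (limn_einf_sup u) _.
by apply: limn_esup_le; apply: nearW.
Qed.

End limits.

(** * Weak lower semicontinuity of double integrals *)

Section finite_rank.
Context (R : realType) (d : nat).
Local Notation E := 'rV[R]_d.

Lemma prod_prob_setT (nu : probability E R) : ((nu \x nu) setT = 1)%E.
Proof.
by rewrite -setXTT product_measure1E//= probability_setT mule1.
Qed.

Lemma is_Cb_cst (r : R) : continuous (fun _ : E => r) /\ bounded_fun (fun _ : E => r).
Proof. by split; [exact: cst_continuous|exact: bounded_cst]. Qed.

Lemma bounded_funP (T : Type) (f : T -> R) :
  (exists M, forall x, `|f x| <= M) -> bounded_fun f.
Proof.
move=> [M fM]; exists M; split; first exact: num_real.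
by move=> y My x _; apply: le_trans (fM x) (ltW My).
Qed.

Lemma bounded_fun_ge0 (T : Type) (f : T -> R) : bounded_fun f ->
  exists2 M, 0 <= M & forall x, `|f x| <= M.
Proof.
move=> [M [_ fM]]; exists (`|M| + 1); first by rewrite addr_ge0.
by move=> x; apply: fM => //; rewrite (le_lt_trans (ler_norm _))// ltrDl.
Qed.

Lemma is_CbM (f g : E -> R) : continuous f /\ bounded_fun f ->
  continuous g /\ bounded_fun g ->
  continuous (fun x => f x * g x) /\ bounded_fun (fun x => f x * g x).
Proof.
move=> [cf /bounded_fun_ge0[M M0 fM]] [cg /bounded_fun_ge0[N N0 gN]]; split.
  by move=> x; apply: (@cvgM _ _ _ (nbhs_filter x)); [exact: cf|exact: cg].
by apply: bounded_funP; exists (M * N) => x; rewrite normrM ler_pM.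
Qed.

Lemma is_CbD (f g : E -> R) : continuous f /\ bounded_fun f ->
  continuous g /\ bounded_fun g ->
  continuous (fun x => f x + g x) /\ bounded_fun (fun x => f x + g x).
Proof.
move=> [cf /bounded_fun_ge0[M M0 fM]] [cg /bounded_fun_ge0[N N0 gN]]; split.
  by move=> x; apply: (@cvgD _ _ _ _ (nbhs_filter x)); [exact: cf|exact: cg].
apply: bounded_funP; exists (M + N) => x.
by rewrite (le_trans (ler_normD _ _))// lerD.
Qed.

Lemma is_CbN (f : E -> R) : continuous f /\ bounded_fun f ->
  continuous (fun x => - f x) /\ bounded_fun (fun x => - f x).
Proof.
move=> [cf /bounded_fun_ge0[M M0 fM]]; split.
  by move=> x; apply: (@cvgN _ _ _ _ (nbhs_filter x)); exact: cf.
by apply: bounded_funP; exists M => x; rewrite normrN.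
Qed.

Lemma Cb_integrable (nu : probability E R) (f : Cb R d) :
  nu.-integrable setT (EFin \o sval f).
Proof.
have [cf bf] := svalP f; apply: measurable_bounded_integrable => //.
- by rewrite -ge0_fin_numE ?fin_num_measure.
- exact: continuous_measurable_rV.
Qed.

(** The double integrals of such functions depend on the measure only through
    finitely many integrals of bounded continuous functions. *)
Definition finite_rank (h : E * E -> R) := exists s : seq (Cb R d * Cb R d),
  forall z, h z = \sum_(p <- s) sval p.1 z.1 * sval p.2 z.2.

Lemma finite_rank0 : finite_rank (fun=> 0).
Proof. by exists [::] => z; rewrite big_nil. Qed.

Lemma finite_rankD h k : finite_rank h -> finite_rank k ->
  finite_rank (fun z => h z + k z).
Proof. by move=> [s hs] [t ht]; exists (s ++ t) => z; rewrite big_cat hs ht. Qed.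

Lemma finite_rank_mull (u : Cb R d) h : finite_rank h ->
  finite_rank (fun z => sval u z.1 * h z).
Proof.
move=> [s hs]; exists [seq (exist _ _ (is_CbM (svalP u) (svalP p.1)), p.2) | p <- s].
move=> z; rewrite hs big_map mulr_sumr; apply: eq_bigr => p _ /=.
by rewrite mulrA.
Qed.

Lemma finite_rank_prod (u v : Cb R d) :
  finite_rank (fun z => sval u z.1 * sval v z.2).
Proof. by exists [:: (u, v)] => z; rewrite big_seq1. Qed.

Lemma integral_prod_Cb (nu : probability E R) (u v : Cb R d) :
  (\int[nu \x nu]_z (sval u z.1 * sval v z.2)%:E =
   ((\int[nu]_x sval u x)%R * (\int[nu]_x sval v x)%R)%:E)%E.
Proof.
have [cu bu] := svalP u; have [cv bv] := svalP v.
have mu := continuous_measurable_rV cu; have mv := continuous_measurable_rV cv.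
have [M M0 uM] := bounded_fun_ge0 bu; have [N N0 vN] := bounded_fun_ge0 bv.
have int_uv : (nu \x nu)%E.-integrable setT
    (fun z : E * E => (sval u z.1 * sval v z.2)%:E).
  apply: (measurable_bounded_integrable (f := fun z : E * E => sval u z.1 * sval v z.2)) => //.
  - by rewrite [ltLHS](prod_prob_setT nu) ltry.
  - by apply: measurable_funM; [exact: (measurableT_comp mu)|exact: (measurableT_comp mv)].
  - by apply: bounded_funP; exists (M * N) => z; rewrite normrM ler_pM.
rewrite -integral12_prod_meas1//.
transitivity (\int[nu]_x ((\int[nu]_y sval v y)%R%:E * (sval u x)%:E))%E.
  apply: eq_integral => x _; rewrite /fubini_F/=.
  under eq_integral do rewrite EFinM.
  rewrite integralZl//; last exact: (Cb_integrable nu v).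
  rewrite muleC; congr (_ * _)%E.
  rewrite /Rintegral fineK//; apply: integrable_fin_num => //.
  exact: (Cb_integrable nu v).
rewrite integralZl//; last exact: (Cb_integrable nu u).
rewrite mulrC EFinM; congr (_ * _)%E.
rewrite /Rintegral fineK//; apply: integrable_fin_num => //.
exact: (Cb_integrable nu u).
Qed.

Lemma integral_finite_rank (s : seq (Cb R d * Cb R d)) (nu : probability E R) :
  (\int[nu \x nu]_z (\sum_(p <- s) sval p.1 z.1 * sval p.2 z.2)%:E =
   (\sum_(p <- s) (\int[nu]_x sval p.1 x)%R * (\int[nu]_x sval p.2 x)%R)%:E)%E.
Proof.
under eq_integral do rewrite -sumEFin.
rewrite integral_sum//=.
  by rewrite -sumEFin; apply: eq_bigr => p _; exact: integral_prod_Cb.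
move=> p.
have [cu /bounded_fun_ge0[M M0 uM]] := svalP p.1.
have [cv /bounded_fun_ge0[N N0 vN]] := svalP p.2.
have mu := continuous_measurable_rV cu; have mv := continuous_measurable_rV cv.
apply: (measurable_bounded_integrable (f := fun z : E * E => sval p.1 z.1 * sval p.2 z.2)) => //.
- by rewrite [ltLHS](prod_prob_setT nu) ltry.
- by apply: measurable_funM; [exact: (measurableT_comp mu)|exact: (measurableT_comp mv)].
- by apply: bounded_funP; exists (M * N) => z; rewrite normrM ler_pM.
Qed.

Lemma Cb_integral_cvg (f : Cb R d) (mu : Prob R d) :
  (fun nu : Prob R d => (\int[nu]_x sval f x)%R) @ nbhs mu -->
  (\int[mu]_x sval f x)%R.
Proof. by move: f; apply/weak_cvgP; exact: cvg_id. Qed.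

Lemma finite_rank_integral_near h (mu : Prob R d) (t : R) : finite_rank h ->
  (t%:E < \int[mu \x mu]_z (h z)%:E)%E ->
  nbhs mu [set nu : Prob R d | (t%:E < \int[nu \x nu]_z (h z)%:E)%E].
Proof.
move=> [s /funext ->]; rewrite integral_finite_rank lte_fin => th.
have : (fun nu : Prob R d => \sum_(p <- s) (\int[nu]_x sval p.1 x)%R *
    (\int[nu]_x sval p.2 x)%R) @ mu --> \sum_(p <- s) (\int[mu]_x sval p.1 x)%R *
    (\int[mu]_x sval p.2 x)%R.
  apply: (@cvg_big R _ +%R _ _ _ _ _ _ _ _ (nbhs_filter mu)) => [|p _].
    exact: add_continuous.
  by apply: (@cvgM _ _ _ (nbhs_filter mu)); exact: Cb_integral_cvg.
move=> /cvgr_gt/(_ _ th); apply: filterS => nu.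
by move=> tnu; rewrite /= (integral_finite_rank s nu) lte_fin.
Qed.

End finite_rank.

Section minorants.
Context (R : realType) (d : nat).
Local Notation E := 'rV[R]_d.
Implicit Types (q x y : E) (r : R) (s : seq E) (c : E -> R).

Definition bump r q x : R := Num.max 0 (Num.min 1 (2 - r^-1 * `|x - q|)).

Lemma bump_ge0 r q x : 0 <= bump r q x.
Proof. by rewrite le_max lexx. Qed.

Lemma bump_le1 r q x : bump r q x <= 1.
Proof. by rewrite ge_max ler01 ge_min lexx. Qed.

Lemma bump_eq1 r q x : 0 < r -> `|x - q| <= r -> bump r q x = 1.
Proof.
move=> r0 xq; rewrite /bump; have : r^-1 * `|x - q| <= 1.
  by rewrite mulrC ler_pdivrMr// mul1r.
move=> h; rewrite min_l ?max_r//; lra.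
Qed.

Lemma bump_gt0 r q x : 0 < r -> 0 < bump r q x -> `|x - q| < 2 * r.
Proof.
move=> r0; rewrite lt_max ltxx/= lt_min ltr01/= subr_gt0 mulrC.
by rewrite ltr_pdivrMr.
Qed.

Lemma continuous_dist q : continuous (fun x : E => `|x - q|).
Proof.
move=> x; apply: (@cvg_norm _ _ _ _ (nbhs_filter x)).
by apply: (@cvgB _ _ _ _ (nbhs_filter x)); [exact: cvg_id|exact: cvg_cst].
Qed.

Lemma is_Cb_bump r q : continuous (bump r q) /\ bounded_fun (bump r q).
Proof.
split; last first.
  apply: bounded_funP; exists 1 => x.
  by rewrite ger0_norm ?bump_ge0// bump_le1.
have -> : bump r q = (fun u : R => Num.max 0 (Num.min 1 (2 - r^-1 * u))) \o
    (fun x => `|x - q|) by [].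
move=> x; apply: continuous_comp; first exact: continuous_dist.
move: (`|x - q|) => u.
have cm : continuous (fun u : R => 2 - r^-1 * u).
  move=> v; apply: cvgB; first exact: cvg_cst.
  by apply: cvgM; [exact: cvg_cst|exact: cvg_id].
apply: (@continuous_max _ R (cst 0) (fun u => Num.min 1 (2 - r^-1 * u))).
  exact: cvg_cst.
apply: (@continuous_min _ R (cst 1) (fun u => 2 - r^-1 * u)).
  exact: cvg_cst.
exact: cm.
Qed.

Definition Cb_bump r q : Cb R d := exist _ _ (is_Cb_bump r q).

(** The values [c q] glued by bumps around the points [q] of [s], the earlier
    points taking precedence. Covering by bumps in this sequential way replaces
    a partition of unity and is amenable to induction on [s]. *)
Fixpoint blend r s c x : R := if s is q :: s' then
  bump r q x * c q + (1 - bump r q x) * blend r s' c x else 0.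

Lemma blend_ge0 r s c x : (forall q, 0 <= c q) -> 0 <= blend r s c x.
Proof.
move=> c0; elim: s => //= q s IH.
by rewrite addr_ge0// mulr_ge0// ?bump_ge0// subr_ge0 bump_le1.
Qed.

Lemma convex_le (b u v w : R) : 0 <= b -> b <= 1 -> (0 < b -> u <= w) ->
  v <= w -> b * u + (1 - b) * v <= w.
Proof.
rewrite le_eqVlt => /predU1P[<- _ _|b0 b1 /(_ b0) uw vw]; first by lra.
by nra.
Qed.

Lemma convex_ge (b u v w : R) : 0 <= b -> b <= 1 -> (0 < b -> w <= u) ->
  (b < 1 -> w <= v) -> w <= b * u + (1 - b) * v.
Proof.
rewrite le_eqVlt => /predU1P[<- _ _|b0]; first by move=> h; have := h ltr01; lra.
rewrite le_eqVlt => /predU1P[-> /(_ ltr01)|b1 /(_ b0) uw /(_ b1) vw]; first by lra.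
by nra.
Qed.

Lemma blend_le r s c x w : 0 <= w -> (forall q, 0 < bump r q x -> c q <= w) ->
  blend r s c x <= w.
Proof.
move=> w0 cw; elim: s => //= q s IH.
by apply: convex_le => //; [exact: bump_ge0|exact: bump_le1|exact: cw].
Qed.

(** The values glued after a point whose bump equals 1 at [x] get no weight, so
    only values at points near [x] matter. *)
Lemma blend_ge r s c x w : (forall q, 0 < bump r q x -> w <= c q) ->
  (exists2 q, q \in s & bump r q x = 1) -> w <= blend r s c x.
Proof.
move=> cw; elim: s => [[//]|q s IH [p]] /=; rewrite inE => ps p1.
apply: convex_ge; [exact: bump_ge0|exact: bump_le1|exact: cw|].
move=> q1; apply: IH; exists p => //.
by case/predU1P : ps => // pq; rewrite -pq p1 ltxx in q1.
Qed.

Lemma is_Cb_blend r s c :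
  continuous (blend r s c) /\ bounded_fun (blend r s c).
Proof.
elim: s => [|q s IH] /=; first exact: is_Cb_cst.
apply: is_CbD; apply: is_CbM => //.
- exact: is_Cb_bump.
- exact: is_Cb_cst.
- by apply: is_CbD; [exact: is_Cb_cst|apply: is_CbN; exact: is_Cb_bump].
Qed.

Lemma finite_rank_blend r s s' (c : E -> E -> R) :
  finite_rank (fun z : E * E => blend r s (fun q => blend r s' (c q) z.2) z.1).
Proof.
elim: s => [|q s IH] /=; first exact: finite_rank0.
apply: finite_rankD.
  exact: (finite_rank_prod (Cb_bump r q) (exist _ _ (is_Cb_blend r s' (c q)))).
have cC := is_CbD (is_Cb_cst d 1) (is_CbN (is_Cb_bump r q)).
exact: (finite_rank_mull (exist _ _ cC) IH).
Qed.

Lemma finite_net (k : nat) (r : R) : 0 < r ->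
  exists s : seq E, forall x, `|x| <= k%:R -> exists2 q, q \in s & `|x - q| <= r.
Proof.
move=> r0.
have : compact [set x : E | `|x| <= k%:R].
  apply: bounded_closed_compact.
    exists k%:R; split; first exact: num_real.
    by move=> M kM x /= xk; apply: le_trans xk (ltW kM).
  rewrite (_ : [set x : E | _] = (fun x : E => `|x - 0|) @^-1` [set t | t <= k%:R]).
    apply: preimage_closed => [x _|]; [exact: continuous_dist|exact: closed_le].
  by apply/seteqP; split => x /=; rewrite subr0.
rewrite compact_cover => /(_ E setT (fun q => ball q r)).
case=> [q _|x _|D _ Dcov]; [exact: ball_open|by exists x => //; exact: ballxx|].
exists (finmap.enum_fset D) => x /Dcov[q /= qD].
rewrite -ball_normE/= => /ltW h; exists q => //.
by rewrite distrC.
Qed.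

Section lsc_minorant.
Local Open Scope ereal_scope.
Context (g : E * E -> \bar R) (lg : lower_semicontinuous g)
  (g0 : forall z, 0 <= g z).

(** The radius [2 * r] is that of the support of [bump r], so that gluing these
    values gives a function below [g]; the cap [k] makes it bounded. *)
Definition capped_inf (k : nat) (r : R) (p q : E) : R :=
  fine (Order.min k%:R%:E (ereal_inf
    [set g z | z in [set z | `|z.1 - p| < 2 * r /\ `|z.2 - q| < 2 * r]%R])).

Lemma capped_infE k r p q : (capped_inf k r p q)%:E = Order.min k%:R%:E (ereal_inf
    [set g z | z in [set z | `|z.1 - p| < 2 * r /\ `|z.2 - q| < 2 * r]%R]).
Proof.
rewrite fineK// ge0_fin_numE; first by rewrite gt_min ltry.
rewrite le_min lee_fin ler0n/=; apply: le_ereal_inf_tmp => _ [z _ <-].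
exact: g0.
Qed.

Lemma capped_inf_ge0 k r p q : (0 <= capped_inf k r p q)%R.
Proof.
rewrite -lee_fin capped_infE le_min lee_fin ler0n/=.
by apply: le_ereal_inf_tmp => _ [z _ <-]; exact: g0.
Qed.

Lemma capped_inf_le k r p q : (capped_inf k r p q <= k%:R)%R.
Proof. by rewrite -lee_fin capped_infE ge_min lexx. Qed.

Lemma capped_inf_leg k r p q z : (`|z.1 - p| < 2 * r)%R ->
  (`|z.2 - q| < 2 * r)%R -> (capped_inf k r p q)%:E <= g z.
Proof.
move=> z1 z2; rewrite capped_infE ge_min; apply/orP; right.
by apply: ereal_inf_lbound; exists z.
Qed.

Definition minorant k r s (z : E * E) : R :=
  blend r s (fun p => blend r s (capped_inf k r p) z.2) z.1.

Lemma minorant_ge0 k r s z : (0 <= minorant k r s z)%R.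
Proof. by apply: blend_ge0 => p; apply: blend_ge0 => q; exact: capped_inf_ge0. Qed.

Lemma minorant_le k r s z : (minorant k r s z <= k%:R)%R.
Proof.
by apply: blend_le => // p _; apply: blend_le => // q _; exact: capped_inf_le.
Qed.

Lemma minorant_leg k r s z : (0 < r)%R -> (minorant k r s z)%:E <= g z.
Proof.
move=> r0; case gz: (g z) => [w| |]; last 2 first.
- by rewrite leey.
- by have := g0 z; rewrite gz.
rewrite lee_fin; have w0 : (0 <= w)%R by rewrite -lee_fin -gz.
apply: blend_le => // p /(bump_gt0 r0) zp.
apply: blend_le => // q /(bump_gt0 r0) zq.
by rewrite -lee_fin -gz; exact: capped_inf_leg.
Qed.

(** At small radius all the points that contribute at [z] lie in a neighbourhood
    of [z] where [g] exceeds [t]. *)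
Lemma minorant_cvg (r_ : nat -> R) (s_ : nat -> seq E) (z : E * E) (t : R) :
  (forall k, (0 < r_ k)%R) -> r_ @ \oo --> (0%R : R) ->
  (forall k x, `|x| <= k%:R -> exists2 q, q \in s_ k & `|x - q| <= r_ k)%R ->
  t%:E < g z -> \forall k \near \oo, (t <= minorant k (r_ k) (s_ k) z)%R.
Proof.
move=> r0 r_cvg s_net /lg[A zA Ag].
have [e /= e0 eA] : nbhs_ball z A by apply/nbhs_ballP.
near=> k.
have rk : (4 * r_ k < e)%R.
  have : (r_ k < e / 4)%R.
    by near: k; apply: (cvgr_lt (0%R : R)) => //; rewrite divr_gt0.
  by lra.
have k1 : (`|z.1| <= k%:R)%R by near: k; exact: nbhs_infty_ger.
have k2 : (`|z.2| <= k%:R)%R by near: k; exact: nbhs_infty_ger.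
have k3 : (t <= k%:R)%R by near: k; exact: nbhs_infty_ger.
have bump1 x : (`|x| <= k%:R)%R -> exists2 q, q \in s_ k & bump (r_ k) q x = 1%R.
  by move=> /s_net[q qs xq]; exists q => //; rewrite bump_eq1.
apply: blend_ge; last exact: bump1.
move=> p /(bump_gt0 (r0 k)) zp; apply: blend_ge; last exact: bump1.
move=> q /(bump_gt0 (r0 k)) zq.
rewrite -lee_fin capped_infE le_min lee_fin k3/=.
apply: le_ereal_inf_tmp => _ [w [w1 w2] <-]; apply/ltW/Ag/eA.
split; rewrite -ball_normE/=.
  rewrite -(subrKA p) (le_lt_trans (ler_normD _ _))// (distrC p).
  by apply: lt_trans rk; lra.
rewrite -(subrKA q) (le_lt_trans (ler_normD _ _))// (distrC q).
by apply: lt_trans rk; lra.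
Unshelve. all: by end_near. Qed.

(** A lower semicontinuous interaction is the limit of bounded finite rank
    functions below it, and Fatou's lemma transfers this to the integrals. *)
Lemma lsc_finite_rank_minorant (mu : probability E R) (t : R) :
  t%:E < \int[mu \x mu]_z g z ->
  exists h : E * E -> R, [/\ finite_rank h, forall z, (0 <= h z)%R,
    exists B : R, forall z, (h z <= B)%R,
    forall z, (h z)%:E <= g z & t%:E < \int[mu \x mu]_z (h z)%:E].
Proof.
move=> tg.
pose r_ (k : nat) : R := k.+1%:R^-1%R.
have r0 k : (0 < r_ k)%R by rewrite invr_gt0.
have r_cvg : r_ @ \oo --> (0%R : R) by exact: cvg_harmonic.
have [s_ s_net] := choice (fun k => finite_net k (r0 k)).
pose h k z := (minorant k (r_ k) (s_ k) z)%:E.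
have mh k : measurable_fun setT (h k).
  apply/measurable_EFinP; have [s /funext] := finite_rank_blend (r_ k) (s_ k)
    (s_ k) (capped_inf k (r_ k)).
  rewrite -/(minorant k (r_ k) (s_ k)) => ->.
  apply: measurable_sum => p; apply: measurable_funM.
    apply: (measurableT_comp _ measurable_fst) => /=.
    by apply: continuous_measurable_rV; have [] := svalP p.1.
  apply: (measurableT_comp _ measurable_snd) => /=.
  by apply: continuous_measurable_rV; have [] := svalP p.2.
have gh : \int[mu \x mu]_z g z <= limn_einf (fun k => \int[mu \x mu]_z h k z).
  apply: le_trans (fatou _ _ mh _) => //; last first.
    by move=> k z _; rewrite lee_fin minorant_ge0.
  apply: le_integralT => z; apply: lee_fin_approx => w wg.
  apply: limn_einf_ge; apply: filterS (minorant_cvg r0 r_cvg s_net wg) => k.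
  by rewrite lee_fin.
have [k hk] : exists k, t%:E < \int[mu \x mu]_z h k z.
  apply/not_existsP => h_le; have := lt_le_trans tg gh.
  apply/negP; rewrite -leNgt; apply: limn_einf_le => k.
  by rewrite leNgt; apply/negP.
exists (minorant k (r_ k) (s_ k)); split => //.
- exact: finite_rank_blend.
- exact: minorant_ge0.
- by exists k%:R; exact: minorant_le.
- by move=> z; exact: minorant_leg.
Qed.

End lsc_minorant.

End minorants.

Section weak_lsc.
Local Open Scope ereal_scope.
Context (R : realType) (d : nat).
Local Notation E := 'rV[R]_d.

Lemma lsc_integral2_near (g : E * E -> \bar R) (mu : Prob R d) (t : R) :
  lower_semicontinuous g -> (forall z, 0 <= g z) ->
  t%:E < \int[mu \x mu]_z g z ->
  nbhs mu [set nu : Prob R d | t%:E < \int[nu \x nu]_z g z].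
Proof.
move=> lg g0 /(lsc_finite_rank_minorant lg g0)[h [frh h0 hB hg]].
move=> /(finite_rank_integral_near frh); apply: filterS => nu /= tnu.
by apply: lt_le_trans tnu _; exact: le_integralT.
Qed.

Lemma integral_prod_fst (mu : probability E R) (f : E -> \bar R) :
  measurable_fun setT f -> (forall x, 0 <= f x) ->
  \int[mu \x mu]_z f z.1 = \int[mu]_x f x.
Proof.
move=> mf f0; rewrite (fubini_tonelli1 (m1 := mu) (m2 := mu) (fun z => f z.1))//=.
  by apply: eq_integral => x _; rewrite /fubini_F/= integral_probability_cst.
exact: (measurableT_comp mf measurable_fst).
Qed.

(** A function of the first of two variables has the same double integral, which
    reduces the claim to the case of two variables. *)
Lemma lsc_integral_near (f : E -> \bar R) (mu : Prob R d) (t : R) :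
  lower_semicontinuous f -> (forall x, 0 <= f x) ->
  t%:E < \int[mu]_x f x ->
  nbhs mu [set nu : Prob R d | t%:E < \int[nu]_x f x].
Proof.
move=> lf f0; have mf := lsc_measurable lf.
rewrite -integral_prod_fst// => tmu.
have lf1 : lower_semicontinuous (fun z : E * E => f z.1).
  by apply: (lsc_comp (h := fst)) => //; move=> z; exact: cvg_fst.
have := lsc_integral2_near lf1 (fun z => f0 z.1) tmu.
by apply: filterS => nu /=; rewrite integral_prod_fst.
Qed.

End weak_lsc.

(** * Open sets determine weak convergence *)

Section portmanteau.
Context (R : realType) (d : nat).
Local Notation E := 'rV[R]_d.

Lemma probE (m : probability E R) A : measurable A -> (fine (m A))%:E = m A.
Proof. by move=> mA; rewrite fineK ?fin_num_measure. Qed.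

Lemma staircase_le (e u : R) N : 0 <= e -> 0 <= u ->
  \sum_(k < N) e * \1_[set v | k.+1%:R * e < v] u <= u.
Proof.
move=> e0 u0; elim: N => [|N IH]; first by rewrite big_ord0.
rewrite big_ord_recr/= [\1__ u in X in _ + X]indicE.
case: (boolP (u \in _)) => [/set_mem/= Nu|_]; last by rewrite mulr0 addr0.
rewrite (le_trans _ (ltW Nu))// mulr1 -natr1 mulrDl mul1r lerD2r.
rewrite -[N in leRHS]card_ord mulr_natl -sumr_const.
by apply: ler_sum => i _; rewrite indicE; case: (_ \in _); rewrite ?mulr1 ?mulr0.
Qed.

Lemma staircase_ge (e u : R) N : 0 <= e -> u <= N.+1%:R * e ->
  u <= e + \sum_(k < N) e * \1_[set v | k.+1%:R * e < v] u.
Proof.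
move=> e0; elim: N => [|N IH] uN; first by rewrite big_ord0 addr0; rewrite mul1r in uN.
case: (ltP (N.+1%:R * e) u) => [Nu|/IH h]; last first.
  rewrite big_ord_recr/= addrA (le_trans h)// lerDl mulr_ge0//.
rewrite (le_trans uN)// -natr1 mulrDl mul1r addrC lerD2l.
rewrite (eq_bigr (fun=> e)).
  by rewrite sumr_const card_ord mulr_natl.
move=> k _; rewrite indicE mem_set ?mulr1//=.
apply: le_lt_trans Nu; rewrite ler_wpM2r// ler_nat; exact: ltn_ord.
Qed.

Lemma filter_forall_ltn (T : Type) (F : set_system T) (P : nat -> set T) N :
  Filter F -> (forall k, F (P k)) -> F [set x | forall k, (k < N)%N -> P k x].
Proof.
move=> FF FP; elim: N => [|N IH]; first by apply: filterS filterT => x _ k.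
apply: filterS (filterI IH (FP N)) => x [h PN] k.
by rewrite ltnS leq_eqVlt => /predU1P[->|/h].
Qed.

(** The graph of [f] is sandwiched between staircases built on finitely many
    open superlevel sets, to each of which the hypothesis applies. *)
Lemma portmanteau_ge0 (F : set_system (Prob R d)) (mu : Prob R d) (f : E -> R)
    (B e : R) : Filter F ->
  (forall U, open U -> forall e : R, 0 < e ->
    F [set nu : Prob R d | mu U <= nu U + e%:E]%E) ->
  continuous f -> (forall x, 0 <= f x <= B) -> 0 < e ->
  F [set nu : Prob R d | (\int[mu]_x (f x)%:E <= \int[nu]_x (f x)%:E + e%:E)%E].
Proof.
move=> FF hF cf fB e0.
have B0 : 0 <= B by have /andP[] := fB 0; exact: le_trans.
pose N := Num.truncn (2 * (B + 1) / e).
pose dl := (B + 1) / N.+1%:R.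
have dl0 : 0 < dl by rewrite divr_gt0// ltr_wpDl.
have dle : dl < e / 2.
  rewrite /dl ltr_pdivrMr// -ltr_pdivrMl ?divr_gt0// invf_div mulrAC.
  exact: truncnS_gt.
have Ndl : N.+1%:R * dl = B + 1 by rewrite /dl mulrC divfK.
pose U k := f @^-1` [set u | k.+1%:R * dl < u].
have oU k : open (U k) by move/continuousP: cf; apply; exact: open_gt.
have mU k : measurable (U k) by exact: open_measurable_rV.
(* The steps of total height [B + 1] multiply the error on each open set. *)
pose eta := e / 2 / (B + 1).
have eta0 : 0 < eta by rewrite !divr_gt0// ltr_wpDl.
have FU := filter_forall_ltn N FF (fun k => hF _ (oU k) _ eta0).
pose st x := \sum_(k < N) dl * \1_(U k) x.
have stair (m : Prob R d) :
    (\int[m]_x (st x)%:E = \sum_(k < N) dl%:E * m (U k))%E.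
  under eq_integral do rewrite -sumEFin.
  rewrite ge0_integral_sum//=; last 2 first.
  - by move=> k; apply/measurable_EFinP; exact: measurable_funM.
  - by move=> k x _; rewrite lee_fin mulr_ge0// ltW.
  apply: eq_bigr => k _; under eq_integral do rewrite EFinM.
  rewrite ge0_integralZl_EFin ?(ltW dl0)//.
  - by rewrite integral_indic ?setIT.
  - by apply/measurable_EFinP; exact: measurable_indic.
apply: filterS FU => nu /= hnu.
apply: (@le_trans _ _ (\int[mu]_x (dl%:E + (st x)%:E))%E).
  apply: le_integralT => x; rewrite -EFinD lee_fin; apply: staircase_ge.
    exact: ltW.
  by rewrite Ndl; have /andP[_] := fB x; lra.
rewrite ge0_integralD//; last 3 first.
- by move=> x _; rewrite lee_fin ltW.
- by move=> x _; rewrite lee_fin sumr_ge0// => k _; rewrite mulr_ge0// ltW.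
- apply/measurable_EFinP; apply: measurable_sum => k.
  by apply: measurable_funM => //; exact: measurable_indic.
rewrite integral_probability_cst stair.
have step : (\sum_(k < N) dl%:E * mu (U k) <=
    \sum_(k < N) dl%:E * nu (U k) + (e / 2)%:E)%E.
  apply: (@le_trans _ _ (\sum_(k < N) (dl%:E * nu (U k) + (dl * eta)%:E))%E).
    apply: lee_sum => k _; rewrite EFinM.
    have := @lee_wpmul2l _ dl%:E _ _ _ (hnu k (ltn_ord k)).
    by rewrite ge0_muleDr ?lee_fin ?(ltW eta0) ?(ltW dl0)//; apply.
  rewrite big_split/= leeD2l// sumEFin lee_fin sumr_const card_ord.
  have B1 : 0 < B + 1 by rewrite ltr_wpDl.
  have <- : (B + 1) * eta = e / 2 by rewrite /eta mulrC divfK ?gt_eqF.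
  rewrite -mulr_natl mulrA ler_pM2r// -Ndl ler_pM2r//.
  by rewrite ler_nat.
have st_le : (\sum_(k < N) dl%:E * nu (U k) <= \int[nu]_x (f x)%:E)%E.
  rewrite -stair; apply: le_integralT => x; rewrite lee_fin.
  by apply: staircase_le; [exact: ltW|have /andP[] := fB x].
apply: (@le_trans _ _ ((e / 2)%:E + (\int[nu]_x (f x)%:E + (e / 2)%:E))%E).
  apply: leeD; first by rewrite lee_fin ltW.
  by apply: le_trans step _; exact: leeD2r.
by rewrite addeCA -EFinD -splitr.
Qed.

(** The one-sided bound applies to both [f + M] and [M - f], which are nonnegative
    when [M] bounds [f]. *)
Lemma portmanteau (F : set_system (Prob R d)) (mu : Prob R d) : Filter F ->
  (forall U, open U -> forall e : R, 0 < e ->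
    F [set nu : Prob R d | mu U <= nu U + e%:E]%E) ->
  F --> mu.
Proof.
move=> FF hF; apply/weak_cvgP => f; have [cf bf] := svalP f.
have [M M0 fM] := bounded_fun_ge0 bf.
apply/cvgrPdist_le => e e0.
have fM' x : - M <= sval f x <= M by rewrite -ler_norml.
have cp : continuous (fun x => sval f x + M).
  by have [] := is_CbD (svalP f) (is_Cb_cst d M).
have cm : continuous (fun x => M + - sval f x).
  by have [] := is_CbD (is_Cb_cst d M) (is_CbN (svalP f)).
have h1 := @portmanteau_ge0 F mu _ (M + M) e FF hF cp _ e0.
have h2 := @portmanteau_ge0 F mu _ (M + M) e FF hF cm _ e0.
have Im (m : Prob R d) : (\int[m]_x (sval f x)%:E =
    (\int[m]_x sval f x)%R%:E)%E.
  by rewrite /Rintegral fineK//; apply: integrable_fin_num => //;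
    exact: (Cb_integrable m f).
have I1 (m : Prob R d) : (\int[m]_x (sval f x + M)%:E =
    (\int[m]_x sval f x + M)%R%:E)%E.
  under eq_integral do rewrite EFinD.
  rewrite integralD//=.
  - by rewrite Im integral_probability_cst.
  - exact: (Cb_integrable m f).
  - exact: finite_measure_integrable_cst.
have I2 (m : Prob R d) : (\int[m]_x (M + - sval f x)%:E =
    (M - \int[m]_x sval f x)%R%:E)%E.
  under eq_integral do rewrite EFinB.
  rewrite integralB//=.
  - by rewrite Im integral_probability_cst.
  - exact: finite_measure_integrable_cst.
  - exact: (Cb_integrable m f).
apply: filterS (filterI (h1 _) (h2 _)) => [nu /= []||]; last 2 first.
- by move=> x; have /andP[] := fM' x; lra.
- by move=> x; have /andP[] := fM' x; lra.
rewrite !I1 !I2 !lee_fin => g1 g2.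
by rewrite ler_norml; apply/andP; split; lra.
Qed.

End portmanteau.

(** * Tight families are relatively compact *)

Section ultra_limits.
Context (R : realType).

Lemma ultra_fmap (T U : Type) (f : T -> U) (F : set_system T) :
  UltraFilter F -> UltraFilter (f @ F).
Proof.
move=> FU; split; first exact: fmap_proper_filter.
move=> G GG FG; apply/seteqP; split => // A GA.
have [//|FnA] := in_ultra_setVsetC (f @^-1` A) FU.
have GnA : G (~` A) by exact: FG.
have : G set0 by rewrite -(setICr A); exact: filterI.
by move=> /(@filter_not_empty _ G GG).
Qed.

Lemma ultra_bounded_cvg (T : Type) (f : T -> R) (F : set_system T) (a b : R) :
  UltraFilter F -> (forall x, a <= f x <= b) -> cvg (f @ F).
Proof.
move=> FU fab; have FU' := ultra_fmap f FU.
have := @segment_compact R a b; rewrite compact_ultra => /(_ _ FU')[].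
  by apply: (@filterS _ F _ setT) => [x _|]; [rewrite /= in_itv/=|exact: filterT].
by move=> l [_ fl]; apply/cvg_ex; exists l.
Qed.

End ultra_limits.

Section tight_ultrafilter.
Context (R : realType) (d : nat).
Local Notation E := 'rV[R]_d.

Lemma closed_norm_le (T : R) : closed [set x : E | `|x| <= T].
Proof.
rewrite (_ : mkset _ = (fun x : E => `|x - 0|) @^-1` [set t | t <= T]).
  apply: preimage_closed => [x _|]; [exact: continuous_dist|exact: closed_le].
by apply/seteqP; split => x /=; rewrite subr0.
Qed.

(** Closed sets that exhaust the open set [U] as [e] decreases to 0. *)
Definition inner (U : set E) (e : R) : set E :=
  [set x | forall y, ~ U y -> e <= `|x - y|].

Lemma inner_closed U e : closed (inner U e).
Proof.
rewrite (_ : inner U e =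
    \bigcap_(y in ~` U) ((fun x => `|x - y|) @^-1` [set t | e <= t])).
  apply: closed_bigI => y _; apply: preimage_closed => [x _|].
    exact: continuous_dist.
  exact: closed_ge.
by apply/seteqP; split => x h y; exact: h.
Qed.

Lemma inner_measurable U e : measurable (inner U e).
Proof. by apply: closed_measurable_rV; exact: inner_closed. Qed.

Lemma inner_sub U e : 0 < e -> inner U e `<=` U.
Proof.
move=> e0 x hx; apply: contrapT => /hx; rewrite subrr normr0.
by rewrite leNgt e0.
Qed.

Lemma innerS U V e e' : U `<=` V -> e' <= e -> inner U e `<=` inner V e'.
Proof.
by move=> UV ee x hx y Vy; apply: le_trans ee _; apply: hx => /UV.
Qed.

Lemma open_inner (U : set E) x : open U -> U x ->
  exists k : nat, forall k', (k <= k')%N -> (inner U k'.+1%:R^-1)° x.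
Proof.
move=> oU Ux; have [e /= e0 eU] : nbhs_ball x U.
  by apply/nbhs_ballP; exact: open_nbhs_nbhs.
exists (Num.truncn (e / 2)^-1) => k' kk'.
have k'e : k'.+1%:R^-1 <= e / 2.
  rewrite invf_ple ?posrE ?divr_gt0// (le_trans (ltW (truncnS_gt _)))//.
  by rewrite ler_nat.
apply/nbhs_ballP; exists (e / 2) => /=; first by rewrite divr_gt0.
move=> y xy z; apply: contra_notP => /negP; rewrite -ltNge => yz.
apply: eU; rewrite (splitr e); apply: ball_triangle xy _.
rewrite -ball_normE/=; exact: lt_le_trans yz k'e.
Qed.

Lemma compact_nondecreasing_cover (K : set E) (O : nat -> set E) :
  compact K -> (forall n, open (O n)) ->
  (forall n m, (n <= m)%N -> O n `<=` O m) -> K `<=` \bigcup_n O n ->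
  exists n, K `<=` O n.
Proof.
rewrite compact_cover => cK oO ndO KO.
have [D _ KD] := cK nat setT O (fun i _ => oO i) KO.
exists (\max_(i <- finmap.enum_fset D) i)%N => x /KD[i /= iD].
by apply: ndO; exact: leq_bigmax_seq.
Qed.

Context (F : set_system (Prob R d)) (FU : UltraFilter F).
Context (F_tight : forall e : R, 0 < e ->
  exists T : R, F [set m | fine (m (~` [set x | `|x| <= T])) <= e]).

Definition mass (A : set E) (m : Prob R d) : R := fine (m A).

Lemma mass_itv A m : measurable A -> 0 <= mass A m <= 1.
Proof.
by move=> mA; rewrite -!lee_fin probE// measure_ge0 probability_le1.
Qed.

(** Along an ultrafilter the mass of every measurable set converges. The limits are only
    finitely additive, so the limit measure is rebuilt from their values on the
    closed inner parts of open sets. *)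
Definition lmass A : R := lim (mass A @ F).

Lemma lmass_cvg A : measurable A -> mass A @ F --> lmass A.
Proof.
by move=> mA; apply: (ultra_bounded_cvg (a := 0) (b := 1)) => m; exact: mass_itv.
Qed.

Lemma lmass_ge0 A : measurable A -> 0 <= lmass A.
Proof.
move=> mA; apply: limr_ge; first exact: (lmass_cvg mA).
by apply: nearW => m; have /andP[] := mass_itv m mA.
Qed.

Lemma lmass_le1 A : measurable A -> lmass A <= 1.
Proof.
move=> mA; apply: limr_le; first exact: (lmass_cvg mA).
by apply: nearW => m; have /andP[] := mass_itv m mA.
Qed.

Lemma lmass_le A B : measurable A -> measurable B -> A `<=` B ->
  lmass A <= lmass B.
Proof.
move=> mA mB AB; apply: ler_lim (lmass_cvg mA) (lmass_cvg mB) _.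
apply: nearW => m; rewrite -lee_fin !probE//.
by apply: le_measure; rewrite ?inE.
Qed.

Lemma lmassT : lmass setT = 1.
Proof.
apply: cvg_lim => //; rewrite (_ : mass setT = cst 1); first exact: cvg_cst.
by apply/funext => m; rewrite /mass probability_setT.
Qed.

Lemma lmass0 : lmass set0 = 0.
Proof.
apply: cvg_lim => //; rewrite (_ : mass set0 = cst 0); first exact: cvg_cst.
by apply/funext => m; rewrite /mass measure0.
Qed.

Lemma lmassU A B : measurable A -> measurable B ->
  lmass (A `|` B) <= lmass A + lmass B.
Proof.
move=> mA mB.
have mAB : measurable (A `|` B) by exact: measurableU.
apply: (ler_cvg_to (lmass_cvg mAB) (cvgD (lmass_cvg mA) (lmass_cvg mB))).
apply: nearW => m; rewrite -lee_fin EFinD !probE//.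
exact: measureU2.
Qed.

Lemma lmass_disjoint A B C : measurable A -> measurable B -> measurable C ->
  A `&` B = set0 -> A `|` B `<=` C -> lmass A + lmass B <= lmass C.
Proof.
move=> mA mB mC AB0 ABC.
apply: (ler_cvg_to (cvgD (lmass_cvg mA) (lmass_cvg mB)) (lmass_cvg mC)).
apply: nearW => m; rewrite -lee_fin EFinD !probE//.
rewrite -measureU//; apply: le_measure; rewrite ?inE//.
exact: measurableU.
Qed.

Lemma lmass_bigcup (A : nat -> set E) n : (forall i, measurable (A i)) ->
  lmass (\big[setU/set0]_(i < n) A i) <= \sum_(i < n) lmass (A i).
Proof.
move=> mA; elim: n => [|n IH]; first by rewrite !big_ord0 lmass0.
rewrite !big_ord_recr/=; apply: le_trans (lmassU _ _) _ => //.
  exact: bigsetU_measurable.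
by rewrite lerD2r.
Qed.

Local Open Scope ereal_scope.

(** Mass that escapes to the boundary of [U] in the limit is not counted, as
    suits a measure that gives open sets at most their limit mass. *)
Definition inner_mass (U : set E) : \bar R :=
  ereal_sup [set (lmass (inner U e))%:E | e in [set e : R | (0 < e)%R]].

Lemma lmass_inner_mass U e : (0 < e)%R -> (lmass (inner U e))%:E <= inner_mass U.
Proof. by move=> e0; apply: ereal_sup_ubound; exists e. Qed.

Lemma inner_mass_ge0 U : 0 <= inner_mass U.
Proof.
apply: le_trans (lmass_inner_mass U ltr01).
by rewrite lee_fin lmass_ge0//; exact: inner_measurable.
Qed.

Lemma inner_mass_le_lmass U : measurable U -> inner_mass U <= (lmass U)%:E.
Proof.
move=> mU; apply: ge_ereal_sup => _ [e /= e0 <-]; rewrite lee_fin.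
by apply: lmass_le => //; [exact: inner_measurable|exact: inner_sub].
Qed.

Lemma inner_mass_fin_num U : inner_mass U \is a fin_num.
Proof.
rewrite ge0_fin_numE ?inner_mass_ge0//; apply: (@le_lt_trans _ _ 1%E); last first.
  by rewrite ltry.
apply: ge_ereal_sup => _ [e /= e0 <-].
by rewrite lee_fin lmass_le1//; exact: inner_measurable.
Qed.

Lemma inner_massS U V : U `<=` V -> inner_mass U <= inner_mass V.
Proof.
move=> UV; apply: ge_ereal_sup => _ [e /= e0 <-].
apply: le_trans (lmass_inner_mass V e0); rewrite lee_fin.
by apply: lmass_le; [exact: inner_measurable..|exact: innerS].
Qed.

Lemma inner_massT : inner_mass setT = 1.
Proof.
apply/eqP; rewrite eq_le; apply/andP; split.
  by rewrite -lmassT; apply: inner_mass_le_lmass.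
apply: le_trans (lmass_inner_mass setT ltr01); rewrite -lmassT lee_fin.
by apply: lmass_le => //; [exact: inner_measurable|move=> x _ y []].
Qed.

(** Tightness is what turns the finite subadditivity of the limit masses into
    countable subadditivity: up to a small mass, a set lying well inside a
    union of open sets is compact. *)
Lemma inner_mass_bigcup (U : nat -> set E) : (forall n, open (U n)) ->
  inner_mass (\bigcup_n U n) <= \sum_(n <oo) inner_mass (U n).
Proof.
move=> oU; apply: ge_ereal_sup => _ [e /= e0 <-].
apply/lee_addgt0Pr => dl dl0; have [T FT] := F_tight dl0.
pose K := inner (\bigcup_n U n) e `&` [set x | (`|x| <= T)%R].
have cBT : closed [set x : E | (`|x| <= T)%R] by exact: closed_norm_le.
have cK : compact K.
  apply: bounded_closed_compact.
    exists T; split; first exact: num_real.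
    by move=> M TM x [_ xT]; apply: le_trans xT (ltW TM).
  by apply: closedI => //; exact: inner_closed.
pose O n := \bigcup_(i < n) (inner (U i) n.+1%:R^-1)°.
have [n Kn] : exists n, K `<=` O n.
  apply: compact_nondecreasing_cover => //.
  - by move=> n; apply: bigcup_open => i _; exact: open_interior.
  - move=> n m nm x [i /= ni xi]; exists i; first exact: leq_trans nm.
    apply: interiorS xi; apply: innerS => //.
    by rewrite lef_pV2 ?posrE// ler_nat ltnS.
  - move=> x [/(inner_sub e0)[i _ Uix] _].
    have [k hk] := open_inner (oU i) Uix.
    exists (maxn k i.+1) => //; exists i => /=; first by rewrite leq_max ltnSn orbT.
    by apply: hk; rewrite leq_max leqnn.
have mI i : measurable (inner (U i) n.+1%:R^-1) by exact: inner_measurable.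
apply: (@le_trans _ _ (\sum_(i < n) lmass (inner (U i) n.+1%:R^-1) + dl)%:E).
  rewrite lee_fin.
  have mT : measurable [set x : E | (`|x| <= T)%R] by exact: closed_measurable_rV.
  have mK : measurable K.
    by apply: measurableI => //; exact: inner_measurable.
  apply: (@le_trans _ _ (lmass K + lmass (~` [set x | (`|x| <= T)%R]))%R).
    apply: le_trans (lmassU _ _) => //; last exact: measurableC.
    apply: lmass_le; [exact: inner_measurable| |].
      by apply: measurableU => //; exact: measurableC.
    by move=> x Ux; have [xT|xT] := pselect (`|x| <= T)%R; [left|right].
  apply: lerD; last first.
    apply: limr_le; first by apply: lmass_cvg; exact: measurableC.
    exact: FT.
  apply: le_trans (lmass_bigcup n mI); apply: lmass_le => //.
    exact: bigsetU_measurable.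
  move=> x /Kn[i Ni h]; rewrite -(bigcup_mkord n (fun i => inner (U i) n.+1%:R^-1)).
  exists i => //.
  exact: interior_subset h.
rewrite EFinD leeD2r//.
apply: (@le_trans _ _ (\sum_(i < n) inner_mass (U i))).
  rewrite -sumEFin; apply: lee_sum => i _; apply: lmass_inner_mass.
  by rewrite invr_gt0.
rewrite -(big_mkord xpredT (fun i => inner_mass (U i))).
by apply: nneseries_lim_ge => k _ _; exact: inner_mass_ge0.
Qed.

Definition outer_mass (A : set E) : \bar R :=
  ereal_inf [set inner_mass U | U in [set U | open U /\ A `<=` U]].

Lemma outer_mass_ge0 A : 0 <= outer_mass A.
Proof. by apply: le_ereal_inf_tmp => _ [U _ <-]; exact: inner_mass_ge0. Qed.

Lemma outer_mass_open U : open U -> outer_mass U = inner_mass U.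
Proof.
move=> oU; apply/eqP; rewrite eq_le; apply/andP; split.
  by apply: ereal_inf_lbound; exists U => //; split.
by apply: le_ereal_inf_tmp => _ [V [oV UV] <-]; exact: inner_massS.
Qed.

Lemma outer_mass0 : outer_mass set0 = 0.
Proof.
rewrite outer_mass_open; last exact: open0.
apply/eqP; rewrite eq_le inner_mass_ge0 andbT -[leRHS]/(0%R%:E) -lmass0.
exact: inner_mass_le_lmass.
Qed.

Lemma le_outer_mass : {homo outer_mass : A B / A `<=` B >-> A <= B}.
Proof.
move=> A B AB; apply: le_ereal_inf_tmp => _ [V [oV BV] <-].
by apply: ereal_inf_lbound; exists V => //; split => //; exact: subset_trans BV.
Qed.

Lemma outer_mass_fin_num A : outer_mass A \is a fin_num.
Proof.
rewrite ge0_fin_numE ?outer_mass_ge0//.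
apply: (@le_lt_trans _ _ 1); last by rewrite ltry.
by rewrite -inner_massT -outer_mass_open ?le_outer_mass//; exact: openT.
Qed.

Lemma outer_mass_adherent A (e : R) : (0 < e)%R ->
  exists U, [/\ open U, A `<=` U & inner_mass U <= outer_mass A + e%:E].
Proof.
move=> e0; have [_ [U [oU AU] <-] /ltW h] :=
  lb_ereal_inf_adherent e0 (outer_mass_fin_num A).
by exists U.
Qed.

Lemma outer_mass_sigma_subadditive : sigma_subadditive outer_mass.
Proof.
move=> A; apply/lee_addgt0Pr => e e0.
have h n : exists U, [/\ open U, A n `<=` U &
    inner_mass U <= outer_mass (A n) + (e / (2 ^ n.+1)%:R)%:E].
  by apply: outer_mass_adherent; rewrite divr_gt0// ltr0n expn_gt0.
have [U hU] := choice h.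
apply: le_trans (epsilon_trick xpredT (fun n => outer_mass_ge0 (A n)) (ltW e0)).
apply: (@le_trans _ _ (\sum_(n <oo) inner_mass (U n))); last first.
  apply: lee_nneseries => n _; first by move=> _; exact: inner_mass_ge0.
  by have [] := hU n.
apply: le_trans (inner_mass_bigcup _); last by move=> n; have [] := hU n.
apply: ereal_inf_lbound; exists (\bigcup_n U n) => //; split.
  by apply: bigcup_open => n _; have [] := hU n.
by apply: subset_bigcup => n _; have [] := hU n.
Qed.

Definition outer : {outer_measure set E -> \bar R} :=
  HB.pack outer_mass (isOuterMeasure.Build R E outer_mass outer_mass0
    outer_mass_ge0 le_outer_mass outer_mass_sigma_subadditive).

(** Nearly all the inner mass of [V `&` U] sits on a closed part at a positive
    distance from the complement; removing this part from [V] leaves an open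
    set that covers the points of [V] outside of [U]. *)
Lemma open_caratheodory U : open U -> caratheodory_measurable outer U.
Proof.
move=> oU; apply: le_caratheodory_measurable => X /=.
apply: le_ereal_inf_tmp => _ [V [oV XV] <-].
apply/lee_addgt0Pr => e e0.
have oVU : open (V `&` U) by exact: openI.
have e20 : (0 < e / 2)%R by rewrite divr_gt0.
have [_ [a /= a0 <-] ha] := ub_ereal_sup_adherent e20 (inner_mass_fin_num (V `&` U)).
pose V' := V `&` ~` inner (V `&` U) a.
have oV' : open V'.
  by apply: openI => //; apply: closed_openC; exact: inner_closed.
have [_ [b /= b0 <-] hb] := ub_ereal_sup_adherent e20 (inner_mass_fin_num V').
have h1 : outer_mass (X `&` U) <= inner_mass (V `&` U).
  by apply: ereal_inf_lbound; exists (V `&` U) => //; split => //; exact: setSI.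
have h2 : outer_mass (X `&` ~` U) <= inner_mass V'.
  apply: ereal_inf_lbound; exists V' => //; split => //.
  move=> x [/XV Vx nUx]; split => // /(inner_sub a0)[].
  by [].
apply: le_trans (leeD h1 h2) _.
have h3 : (lmass (inner (V `&` U) a))%:E + (lmass (inner V' b))%:E <= inner_mass V.
  have c0 : (0 < Num.min a b)%R by rewrite lt_min a0.
  apply: le_trans (lmass_inner_mass V c0); rewrite -EFinD lee_fin.
  apply: lmass_disjoint; [exact: inner_measurable..| |].
    by apply/seteqP; split => // x [xa /(inner_sub b0)[]].
  move=> x [] h; apply: innerS h.
  - by move=> ? [].
  - by rewrite ge_min lexx.
  - by move=> ? [].
  - by rewrite ge_min lexx orbT.
rewrite -/(inner_mass (V `&` U)) in ha; rewrite -/(inner_mass V') in hb.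
move: ha hb h3.
rewrite -(fineK (inner_mass_fin_num (V `&` U))) -(fineK (inner_mass_fin_num V')).
rewrite -(fineK (inner_mass_fin_num V)) -!EFinD !lte_fin !lee_fin.
by lra.
Qed.

Lemma borel_caratheodory (A : set E) : measurable A -> caratheodory_measurable outer A.
Proof.
apply: smallest_sub; last exact: open_caratheodory.
split.
- exact: caratheodory_measurable_set0.
- by move=> B; rewrite setTD; exact: caratheodory_measurable_setC.
- exact: caratheodory_measurable_bigcup.
Qed.

Lemma outer_sigma_additive : semi_sigma_additive outer_mass.
Proof.
move=> A mA tA mUA.
apply: (@caratheodory_measure_sigma_additive R E outer A) => //.
  by move=> n; exact: borel_caratheodory.
exact: borel_caratheodory.
Qed.

(** The measure gives an open set its inner mass, which is at most the limit
    mass: this is the criterion of [portmanteau]. *)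
Lemma tight_ultra_cvg : exists mu : Prob R d, F --> mu.
Proof.
pose m := HB.pack_for {measure set E -> \bar R} outer_mass
  (isMeasure.Build _ E R outer_mass outer_mass0 outer_mass_ge0 outer_sigma_additive).
have mT : outer_mass setT = 1.
  by rewrite outer_mass_open; [exact: inner_massT|exact: openT].
pose mu : probability E R := HB.pack (Measure.sort m)
  (Measure_isProbability.Build _ E R m mT).
exists mu; apply: portmanteau => U oU e e0.
have mU : measurable U by exact: open_measurable_rV.
have hmu : mu U <= (lmass U)%:E.
  by rewrite /= outer_mass_open//; exact: inner_mass_le_lmass.
have /cvgrPdist_lt/(_ _ e0) := lmass_cvg mU.
apply: filterS => nu; rewrite ltr_norml => /andP[_ h]; apply: le_trans hmu _.
by rewrite -probE// -EFinD lee_fin; rewrite /mass in h; lra.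
Qed.

End tight_ultrafilter.

(** * Sublevel sets of coercive integrals *)

Section coercive_sublevels.
Context (R : realType) (d : nat).
Local Notation E := 'rV[R]_d.

Definition coercive (G : E -> R) := forall k : R, exists T : R,
  forall x, T < `|x| -> k <= G x.

Definition sublevel (G : E -> R) (M : R) : set (Prob R d) :=
  [set mu | (\int[mu]_x (G x)%:E <= M%:E)%E].

Lemma sublevel_closed G M : lower_semicontinuous (EFin \o G) ->
  (forall x, 0 <= G x) -> closed (sublevel G M).
Proof.
move=> lG G0; rewrite -[sublevel G M]setCK; apply: open_closedC.
rewrite openE => mu /= /negP; rewrite -ltNge => Mmu.
have G0' x : (0 <= (EFin \o G) x)%E by rewrite lee_fin.
apply: filterS (lsc_integral_near lG G0' Mmu) => nu /= h.
by apply/negP; rewrite -ltNge.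
Qed.

Lemma markov_tail (m : probability E R) (G : E -> R) (M k T : R) :
  measurable_fun setT G -> (forall x, 0 <= G x) ->
  (\int[m]_x (G x)%:E <= M%:E)%E -> 0 < k ->
  (forall x, T < `|x| -> k <= G x) -> fine (m (~` [set x | `|x| <= T])) <= M / k.
Proof.
move=> mG G0 IM k0 kG.
have mA : measurable (~` [set x : E | `|x| <= T]).
  by apply: measurableC; apply: closed_measurable_rV; exact: closed_norm_le.
rewrite ler_pdivlMr// -lee_fin EFinM probE// muleC.
apply: le_trans IM; rewrite -[X in (_ * m X)%E]setIT -integral_indic//.
rewrite -ge0_integralZl_EFin ?(ltW k0)//; last first.
  by apply/measurable_EFinP; exact: measurable_indic.
apply: le_integralT => x; rewrite -EFinM lee_fin indicE.
case: (boolP (x \in _)) => [/set_mem/= /negP|_]; last by rewrite mulr0.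
by rewrite -ltNge mulr1 => /kG.
Qed.

(** The inequality of Markov makes the measures of a sublevel set tight. *)
Lemma sublevel_compact G M : lower_semicontinuous (EFin \o G) ->
  (forall x, 0 <= G x) -> coercive G -> compact (sublevel G M).
Proof.
move=> lG G0 cG; rewrite compact_ultra => F FU FK.
have mG : measurable_fun setT G by apply/measurable_EFinP; exact: lsc_measurable lG.
have [mu Fmu] : exists mu : Prob R d, F --> mu.
  apply: tight_ultra_cvg => e e0.
  have M1 : M < `|M| + 1 by rewrite (le_lt_trans (ler_norm _))// ltrDl.
  have k0 : 0 < (`|M| + 1) / e by rewrite divr_gt0// ltr_wpDl.
  have [T hT] := cG ((`|M| + 1) / e).
  exists T; apply: filterS FK => m /= mM.
  apply: le_trans (markov_tail mG G0 mM k0 hT) _.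
  rewrite invf_div mulrA ler_pdivrMr ?ltr_wpDl// mulrC ler_pM2l//.
  exact: ltW.
exists mu; split => //.
apply: contrapT => nK.
have FnK : F (~` sublevel G M).
  apply: Fmu; apply: open_nbhs_nbhs; split => //.
  by apply: closed_openC; exact: sublevel_closed.
have : F set0 by rewrite -(setICr (sublevel G M)); exact: filterI.
exact: filter_not_empty.
Qed.

Lemma lsc_indic (U : set E) : open U ->
  lower_semicontinuous (fun x : E => (\1_U x : R)%:E).
Proof.
move=> oU; apply/lower_semicontinuousP => a.
have [a0|a0] := ltP a 0.
  rewrite (_ : mkset _ = setT); first exact: openT.
  by apply/seteqP; split => // x _ /=; rewrite lte_fin (lt_le_trans a0).
have [a1|a1] := ltP a 1.
  rewrite (_ : mkset _ = U) //; apply/seteqP; split => x /=.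
    rewrite lte_fin indicE; case: (boolP (x \in U)) => [/set_mem//|_].
    by rewrite ltNge a0.
  by move=> Ux; rewrite lte_fin indicE mem_set.
rewrite (_ : mkset _ = set0); first exact: open0.
apply/seteqP; split => // x /=; rewrite lte_fin ltNge => /negP; apply.
by apply: le_trans a1; rewrite indicE; case: (x \in U).
Qed.

Lemma open_mass_near (mu : Prob R d) U (e : R) : open U -> 0 < e ->
  nbhs mu [set nu : Prob R d | (mu U <= nu U + e%:E)%E].
Proof.
move=> oU e0; have mU : measurable U by exact: open_measurable_rV.
have IU (m : Prob R d) : (\int[m]_x (\1_U x : R)%:E = m U)%E.
  by rewrite integral_indic// setIT.
have : ((fine (mu U) - e)%:E < \int[mu]_x (\1_U x : R)%:E)%E.
  by rewrite IU -[ltRHS]probE// lte_fin ltrBlDr ltrDl.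
move=> /(lsc_integral_near (lsc_indic oU)) h; apply: filterS (h _) => [nu /=|x].
  by rewrite IU EFinB probE// lteBlDr// => /ltW.
by rewrite lee_fin.
Qed.

Lemma prob_tight (mu : Prob R d) (e : R) : 0 < e ->
  exists T : R, (mu (~` [set x | `|x| <= T]%R) <= e%:E)%E.
Proof.
move=> e0; pose B k := [set x : E | `|x| <= k%:R].
have mB k : measurable (B k) by apply: closed_measurable_rV; exact: closed_norm_le.
have : (mu \o B) @ \oo --> mu (\bigcup_k B k).
  apply: nondecreasing_cvg_mu => //; first exact: bigcupT_measurable.
  by move=> k l kl; apply/subsetPset => x /= /le_trans; apply; rewrite ler_nat.
rewrite (_ : \bigcup_k B k = setT); last first.
  apply/seteqP; split => // x _; exists (Num.truncn `|x|).+1 => //=.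
  by apply: ltW; exact: truncnS_gt.
rewrite probability_setT => /fine_cvgP[_ /cvgrPdist_lt/(_ _ e0)[k _ /(_ k (leqnn k))]].
rewrite /= ltr_norml => /andP[_ h]; exists k%:R.
rewrite -/(B k) probability_setC// -[mu (B k)]probE// -EFinB lee_fin.
exact: ltW.
Qed.

(** The Levy-Prokhorov distance to [mu] is controlled by the masses of the
    finitely many unions of small open sets covering most of the mass of
    [mu]. *)
Lemma levy_prokhorov_near (mu : Prob R d) (e : R) : 0 < e ->
  nbhs mu [set nu : Prob R d | levy_prokhorov mu nu <= e].
Proof.
move=> e0; have e20 : 0 < e / 2 by rewrite divr_gt0.
have e40 : 0 < e / 4 by rewrite divr_gt0.
have [T hT] := prob_tight mu e20.
pose B (x : E) := thickening [set x] (e / 4).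
have [s hs] : exists s : seq E, forall x, `|x| <= T -> exists2 y, y \in s & B y x.
  have : compact [set x : E | `|x| <= T].
    apply: bounded_closed_compact; last exact: closed_norm_le.
    exists T; split; first exact: num_real.
    by move=> N TN x /= xT; apply: le_trans xT (ltW TN).
  rewrite compact_cover => /(_ E setT B); case=> [x _|x _|D _ Dcov].
  - exact: open_thickening.
  - by exists x => //; exact: subset_thickening.
  - by exists (finmap.enum_fset D) => x /Dcov[q /= qD h]; exists q.
(* One open set for each subset of the net. *)
pose U (b : (size s).-tuple bool) := \bigcup_(x in [set` mask b s]) B x.
have oU b : open (U b) by apply: bigcup_open => x _; exact: open_thickening.
have FU : nbhs mu [set nu : Prob R d | forall b, (mu (U b) <= nu (U b) + (e / 2)%:E)%E].
  apply: (@filter_forall _ _ (fun b => [set nu : Prob R d |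
    (mu (U b) <= nu (U b) + (e / 2)%:E)%E]) _ (nbhs_filter mu)) => b.
  exact: open_mass_near.
apply: filterS FU => nu /= hnu.
have mth (A : set E) r : measurable (thickening A r).
  by apply: open_measurable_rV; exact: open_thickening.
have half A : measurable A -> (mu A <= nu (thickening A e) + e%:E)%E.
  move=> mA; pose b := [tuple of map (fun x => `[< B x `&` A !=set0 >]) (in_tuple s)].
  have bs x : x \in mask b s <-> x \in s /\ B x `&` A !=set0.
    rewrite /= -filter_mask mem_filter; split => [/andP[/asboolP]|[xs xA]] //.
    by rewrite xs andbT; apply/asboolP.
  have mU : measurable (U b) by exact: open_measurable_rV.
  have mC : measurable (~` [set x : E | `|x| <= T]).
    by apply: measurableC; apply: closed_measurable_rV; exact: closed_norm_le.
  apply: (@le_trans _ _ (mu (U b) + (e / 2)%:E)%E).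
    apply: (@le_trans _ _ (mu (U b) + mu (~` [set x : E | (`|x| <= T)%R])))%E.
      apply: le_trans (measureU2 _ _ _) => //.
      apply: le_measure; rewrite ?inE//; first exact: measurableU.
      move=> x Ax; have [xT|xT] := pselect (`|x| <= T); [left|by right].
      have [y ys Byx] := hs _ xT; exists y => //.
      by apply/bs; split => //; exists x.
    exact: leeD2l.
  apply: (@le_trans _ _ (nu (U b) + (e / 2)%:E + (e / 2)%:E)%E).
    exact: leeD2r.
  rewrite -addeA -EFinD -splitr leeD2r//.
  apply: le_measure; rewrite ?inE//.
  move=> x [y /= /bs[_ [z [[_ -> yz] Az]]] [_ -> yx]]; exists z => //.
  rewrite -(subrKA y) (le_lt_trans (enorm_triangle _ _))//.
  by rewrite -enormN opprB; lra.
rewrite /levy_prokhorov; apply: ge_inf; first exact: lp_set_has_lbound.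
split=> // A mA; split; first exact: half.
have mt := mth A e.
have := half _ (measurableC mt).
set B' := thickening (~` _) _.
have B'A : B' `<=` ~` A.
  move=> y [x nx xy] Ay; apply: nx; exists y => //.
  by rewrite -enormN opprB.
have : (nu B' <= nu (~` A))%E.
  by apply: le_measure; rewrite ?inE//; [exact: mth|exact: measurableC].
rewrite !probability_setC//.
rewrite -[nu B']probE; last exact: mth.
rewrite -[nu A]probE// -[mu (thickening A e)]probE//.
rewrite -!EFinB -!EFinD !lee_fin; lra.
Qed.

End coercive_sublevels.

Section uniform_integrability.
Context (R : realType) (d : nat).
Local Notation E := 'rV[R]_d.
Context (psi G : E -> R) (c_psi : continuous psi)
  (psi0 : forall x, 0 <= psi x) (lG : lower_semicontinuous (EFin \o G))
  (G0 : forall x, 0 <= G x)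
  (psiG : forall e : R, 0 < e -> exists T : R, 0 <= T /\
    forall x, psi x <= Num.min (psi x) T + e * G x).

Lemma is_Cb_min (T : R) : 0 <= T -> continuous (fun x => Num.min (psi x) T) /\
  bounded_fun (fun x => Num.min (psi x) T).
Proof.
move=> T0; split; last first.
  apply: bounded_funP; exists T => x.
  by rewrite ger0_norm ?ge_min ?lexx ?orbT// le_min psi0.
move=> x; apply: (@continuous_min _ E psi (cst T)); first exact: c_psi.
exact: cst_continuous.
Qed.

Definition Cb_min T (T0 : 0 <= T) : Cb R d := exist _ _ (is_Cb_min T0).

(** Truncating [psi] at [T] changes its integral by at most [e * M], uniformly
    over the sublevel set. *)
Lemma sublevel_psi_bound (M e : R) : 0 < e -> exists T (T0 : 0 <= T),
  forall mu : Prob R d, sublevel G M mu ->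
    (\int[mu]_x (psi x)%:E < +oo)%E /\
    (\int[mu]_x sval (Cb_min T0) x <= \int[mu]_x psi x <=
     \int[mu]_x sval (Cb_min T0) x + e * M)%R.
Proof.
move=> e0; have [T [T0 hT]] := psiG e0; exists T, T0 => mu /= GM.
have mG : measurable_fun setT G by apply/measurable_EFinP; exact: lsc_measurable lG.
have mpsi : measurable_fun setT psi by exact: continuous_measurable_rV.
have IT : (\int[mu]_x (Num.min (psi x) T)%:E =
    (\int[mu]_x sval (Cb_min T0) x)%R%:E)%E.
  rewrite /Rintegral fineK//; apply: integrable_fin_num => //.
  exact: (Cb_integrable mu (Cb_min T0)).
have up : (\int[mu]_x (psi x)%:E <=
    (\int[mu]_x sval (Cb_min T0) x + e * M)%R%:E)%E.
  apply: (@le_trans _ _ (\int[mu]_x ((Num.min (psi x) T)%:E + e%:E * (G x)%:E))%E).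
    by apply: le_integralT => x; rewrite -EFinM -EFinD lee_fin.
  rewrite ge0_integralD//=; last 4 first.
  - by move=> x _; rewrite lee_fin le_min psi0.
  - apply/measurable_EFinP; apply: continuous_measurable_rV.
    by have [] := is_Cb_min T0.
  - by move=> x _; rewrite -EFinM lee_fin mulr_ge0// ltW.
  - by apply: measurable_funeM; exact/measurable_EFinP.
  rewrite IT EFinD leeD2l// ge0_integralZl_EFin ?(ltW e0)//; last 2 first.
  - by move=> x _; rewrite lee_fin.
  - exact/measurable_EFinP.
  by rewrite EFinM lee_pmul2l// lte_fin.
have fin : (\int[mu]_x (psi x)%:E < +oo)%E by rewrite (le_lt_trans up)// ltry.
split => //; have psiE : (\int[mu]_x (psi x)%:E = (\int[mu]_x psi x)%R%:E)%E.
  rewrite /Rintegral fineK// ge0_fin_numE// integral_ge0// => x _.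
  by rewrite lee_fin.
move: up; rewrite psiE lee_fin => ->; rewrite andbT -lee_fin -psiE -IT.
by apply: le_integralT => x; rewrite lee_fin ge_min lexx.
Qed.

Lemma sublevel_psi_near (M e : R) (mu : Prob R d) : 0 < e -> sublevel G M mu ->
  nbhs mu [set nu : Prob R d | sublevel G M nu ->
    `|(\int[mu]_x psi x)%R - (\int[nu]_x psi x)%R| < e].
Proof.
move=> e0 Kmu; pose dl := e / 2 / (`|M| + 1).
have M1 : 0 < `|M| + 1 by rewrite ltr_wpDl.
have dl0 : 0 < dl by rewrite !divr_gt0.
have dlM : dl * M < e / 2.
  rewrite /dl mulrAC ltr_pdivrMr// ltr_pM2l ?divr_gt0//.
  by rewrite (le_lt_trans (ler_norm _))// ltrDl.
have [T [T0 hT]] := sublevel_psi_bound M dl0.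
have e20 : 0 < e / 2 by rewrite divr_gt0.
have /cvgrPdist_lt/(_ _ e20) := @Cb_integral_cvg R d (Cb_min T0) mu.
apply: filterS => nu /= + /hT[_ /andP[n1 n2]].
have [_ /andP[m1 m2]] := hT _ Kmu.
rewrite !ltr_norml => /andP[h1 h2]; apply/andP; split; lra.
Qed.

End uniform_integrability.

(** * From exponential bounds to a large deviation principle *)

Section exponential_scale.
Local Open Scope ereal_scope.
Context (R : realType).

Lemma lne_expR_ge (x : \bar R) (u : R) : (expR u)%:E <= x -> u%:E <= lne x.
Proof.
move=> h; have x0 : 0 <= x by apply: le_trans h; rewrite lee_fin expR_ge0.
by rewrite -lee_expeR lneK// in_itv/= x0 leey.
Qed.

Lemma lne_expR_le (x : \bar R) (u : R) : 0 <= x -> x <= (expR u)%:E ->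
  lne x <= u%:E.
Proof. by move=> x0 h; rewrite -lee_expeR lneK// in_itv/= x0 leey. Qed.

Lemma ge_div_expR (x z : \bar R) (u v : R) : (expR u)%:E <= x -> 0 < z ->
  z <= (expR v)%:E -> (expR (u - v))%:E <= x / z.
Proof.
move: z => [z| |]//; rewrite ?lte_fin ?lee_fin// => ux z0 zv.
rewrite inver gt_eqF// lee_pdivlMr//; apply: le_trans ux.
rewrite -EFinM lee_fin expRD -mulrA ler_piMr ?expR_ge0//.
by rewrite expRN mulrC ler_pdivrMr ?expR_gt0// mul1r.
Qed.

Lemma le_div_expR (x z : \bar R) (u v : R) : x <= (expR u)%:E ->
  (expR v)%:E <= z -> z < +oo -> x / z <= (expR (u - v))%:E.
Proof.
move: z => [z| |]//; rewrite ?lte_fin ?lee_fin// => ux vz _.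
have z0 : (0 < z)%R by apply: lt_le_trans vz; rewrite expR_gt0.
rewrite inver gt_eqF// lee_pdivrMr//; apply: le_trans ux _.
rewrite -EFinM lee_fin expRD -mulrA ler_peMr ?expR_ge0//.
by rewrite expRN mulrC ler_pdivlMr ?expR_gt0// mul1r.
Qed.

Lemma le_limn_esup (u v : nat -> \bar R) : (forall n, u n <= v n) ->
  limn_esup u <= limn_esup v.
Proof.
move=> uv; rewrite /limn_esup !limf_esupE.
apply: le_ereal_inf_tmp => _ [A FA <-].
apply: (@le_trans _ _ (ereal_sup (u @` A))).
  by apply: ereal_inf_lbound; exists A.
apply: ge_ereal_sup => _ [n An <-]; apply: le_trans (uv n) _.
by apply: ereal_sup_ubound; exists n.
Qed.

(** A factor independent of [n] disappears at the exponential scale. *)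
Lemma absorb_constant (alpha : nat -> R) (e C : R) :
  alpha n @[n --> \oo] --> +oo%R -> (0 < e)%R ->
  \forall n \near \oo, (C <= expR (alpha n * e))%R.
Proof.
move=> ay e0; near=> n.
apply: (@le_trans _ _ (alpha n * e)%R).
  rewrite -ler_pdivrMr//; near: n.
  by apply: (@cvgry_ge _ _ _ _ alpha _) => //; exact: num_real.
by apply: le_trans (expR_ge1Dx _); rewrite lerDr.
Unshelve. all: by end_near. Qed.

End exponential_scale.

Section abstract_LDP.
Local Open Scope ereal_scope.
Context (R : realType) (S : ptopologicalType).
Implicit Types (E F G : set S).

Definition lower_bound (U : nat -> set S -> \bar R) (alpha : nat -> R)
    (J : S -> \bar R) :=
  forall G x (r : R), open G -> G x -> J x < r%:E ->
  \forall n \near \oo, (expR (- (alpha n * r)))%:E <= U n G.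

(** The slack [e] absorbs factors that are subexponential at the speed [alpha]. *)
Definition upper_bound (U : nat -> set S -> \bar R) (alpha : nat -> R)
    (J : S -> \bar R) :=
  forall F (r e : R), closed F -> (forall x, F x -> r%:E < J x) -> (0 < e)%R ->
  \forall n \near \oo, U n F <= (expR (- (alpha n * (r - e))))%:E.

Context (U : nat -> set S -> \bar R) (alpha : nat -> R) (J : S -> \bar R).
Context (U_ge0 : forall n E, 0 <= U n E)
  (le_U : forall n E F, E `<=` F -> U n E <= U n F)
  (alpha_gt0 : forall n, (0 < alpha n)%R)
  (alpha_cvg : alpha n @[n --> \oo] --> +oo%R)
  (lb : lower_bound U alpha J) (ub : upper_bound U alpha J).
Context (m : R) (Jm : ereal_inf (range J) = m%:E).

Lemma J_ge_inf x : m%:E <= J x.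
Proof. by rewrite -Jm; apply: ereal_inf_lbound; exists x. Qed.

Lemma normalization_le (e : R) : (0 < e)%R ->
  \forall n \near \oo, U n setT <= (expR (- (alpha n * (m - e))))%:E.
Proof.
move=> e0; have e20 : (0 < e / 2)%R by rewrite divr_gt0.
have := @ub setT (m - e / 2)%R (e / 2)%R closedT _ e20.
have -> : (m - e / 2 - e / 2 = m - e)%R by lra.
apply=> x _; apply: lt_le_trans (J_ge_inf x).
by rewrite lte_fin; lra.
Qed.

Lemma normalization_ge (e : R) : (0 < e)%R ->
  \forall n \near \oo, (expR (- (alpha n * (m + e))))%:E <= U n setT.
Proof.
move=> e0; have [_ [x _ <-] xm] :
    exists2 y, range J y & y < (m + e)%:E.
  have : ereal_inf (range J) < (m + e)%:E by rewrite Jm lte_fin ltrDl.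
  by move=> /ereal_inf_lt[y [x _ <-] h]; exists (J x) => //; exists x.
by apply: (@lb setT x) => //; exact: openT.
Qed.

Lemma normalization_fin : \forall n \near \oo, 0 < U n setT /\ U n setT < +oo.
Proof.
apply: filterS (filterI (normalization_ge ltr01) (normalization_le ltr01)).
move=> n [h1 h2]; split.
  by apply: lt_le_trans h1; rewrite lte_fin expR_gt0.
by apply: le_lt_trans h2 _; rewrite ltry.
Qed.

Let Q n E := U n E / U n setT.
Let rate E n := ((alpha n)^-1)%:E * lne (Q n E).

Lemma rate_lower G : open G ->
  - ereal_inf [set J x - m%:E | x in G] <= limn_einf (rate G).
Proof.
move=> oG; rewrite leeNl; apply: le_ereal_inf_tmp => _ [x Gx <-].
rewrite leeNl; case Jx : (J x) => [j| |]; last 2 first.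
- by rewrite leNye.
- by have := J_ge_inf x; rewrite Jx.
apply/lee_subgt0Pr => e e0; apply: limn_einf_ge.
have e20 : (0 < e / 2)%R by rewrite divr_gt0.
have lbG : J x < (j + e / 2)%:E by rewrite Jx lte_fin ltrDl.
apply: filterS (filterI (lb oG Gx lbG) (filterI normalization_fin
  (normalization_le e20))) => n [h1 [[z0 _] h2]].
have := lne_expR_ge (ge_div_expR h1 z0 h2).
rewrite -/(Q n G) => h.
rewrite /rate lee_pdivlMl//; apply: le_trans h.
have -> : - (j%:E - m%:E) - e%:E = (- (j - m) - e)%:E by [].
by rewrite -EFinM lee_fin; lra.
Qed.

Lemma rate_upper F : closed F ->
  limn_esup (rate F) <= - ereal_inf [set J x - m%:E | x in F].
Proof.
move=> cF; rewrite leeNr; apply: lee_fin_approx => t tF.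
rewrite leeNr; apply/lee_addgt0Pr => e e0; apply: limn_esup_le.
have e20 : (0 < e / 2)%R by rewrite divr_gt0.
have Fr x : F x -> (t + m)%:E < J x.
  move=> Fx; have : t%:E < J x - m%:E.
    by apply: lt_le_trans tF _; apply: ereal_inf_lbound; exists x.
  by rewrite lteBrDr.
apply: filterS (filterI (ub cF Fr e20) (filterI normalization_fin
  (normalization_ge e20))) => n [h1 [[_ zy] h2]].
have Q0 : 0 <= Q n F.
  by rewrite /Q mule_ge0// inve_ge0.
have := lne_expR_le Q0 (le_div_expR h1 h2 zy) => h.
rewrite /rate lee_pdivrMl//; apply: le_trans h _.
have -> : - t%:E + e%:E = (- t + e)%:E by [].
by rewrite -EFinM lee_fin; lra.
Qed.

(** The total mass is [exp (- alpha n * m)] at this scale, so dividing by it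
    shifts [J] by [m]. *)
Lemma abstract_LDP (H : S -> \bar R) : H = (fun x => J x - m%:E) ->
  (\forall n \near \oo, borel_probability (Q n)) -> rate_function H ->
  LDP Q alpha H.
Proof.
move=> -> bQ rH; split => // E _ /=.
have le_rate A B n : A `<=` B -> rate A n <= rate B n.
  move=> AB; apply: lee_wpmul2l; first by rewrite lee_fin invr_ge0 ltW.
  have Q0 C : 0 <= Q n C by rewrite /Q mule_ge0// inve_ge0.
  rewrite lee_lne ?in_itv/= ?Q0 ?leey//.
  by apply: lee_wpmul2r; [rewrite inve_ge0|exact: le_U].
split.
- apply: le_trans (rate_lower (@open_interior _ E)) _.
  rewrite /limn_einf leeN2; apply: le_limn_esup => n /=.
  by rewrite leeN2; apply: le_rate; exact: interior_subset.
- exact: limn_einf_sup.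
- apply: le_trans (rate_upper (@closed_closure _ E)).
  by apply: le_limn_esup => n; apply: le_rate; exact: subset_closure.
Qed.

End abstract_LDP.

Section upper_bound_from_tightness.
Local Open Scope ereal_scope.
Context (R : realType) (S : ptopologicalType).
Context (U : nat -> set S -> \bar R) (alpha : nat -> R) (J : S -> \bar R).
Context (U_ge0 : forall n E, 0 <= U n E)
  (le_U : forall n E F, E `<=` F -> U n E <= U n F)
  (U_add : forall n E F, borel_set E -> borel_set F ->
    U n (E `|` F) <= U n E + U n F)
  (alpha_cvg : alpha n @[n --> \oo] --> +oo%R).

Lemma borel_open (E : set S) : open E -> borel_set E.
Proof. exact: sub_gen_smallest. Qed.

Lemma borel_closed (E : set S) : closed E -> borel_set E.
Proof.
move=> cE; rewrite -(setCK E) -setTD; apply: sigma_algebraCD.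
by apply: borel_open; exact: closed_openC.
Qed.

(** The union bound over a finite subcover of the compact part. *)
Lemma tight_upper_bound :
  (forall x (r : R), r%:E < J x -> exists N, [/\ open N, N x &
    \forall n \near \oo, U n N <= (expR (- (alpha n * r)))%:E]) ->
  (forall L : R, exists K, [/\ compact K, closed K &
    \forall n \near \oo, U n (~` K) <= (expR (- (alpha n * L)))%:E]) ->
  upper_bound U alpha J.
Proof.
move=> local tight F r e cF Fr e0.
have [K [cK clK UK]] := tight r.
have cFK : compact (F `&` K) by rewrite setIC; exact: compact_closedI.
have [N hN] : exists N : S -> set S, forall x, F x -> [/\ open (N x), N x x &
    \forall n \near \oo, U n (N x) <= (expR (- (alpha n * r)))%:E].
  have : forall x, exists N : set S, F x -> [/\ open N, N x &
      \forall n \near \oo, U n N <= (expR (- (alpha n * r)))%:E].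
    move=> x; have [Fx|nFx] := pselect (F x); last by exists setT.
    by have [N hN] := local _ _ (Fr _ Fx); exists N.
  by move=> /choice[N hN]; exists N.
move: cFK; rewrite compact_cover => /(_ S (F `&` K) N)[x [Fx _]|x FKx|D DF Dcov].
- by have [] := hN _ Fx.
- by exists x => //; have [] := hN _ FKx.1.
pose s := finmap.enum_fset D.
have sF x : x \in s -> F x by move=> /DF/set_mem[].
have Us : \forall n \near \oo, U n (\big[setU/set0]_(x <- s) N x) <=
    ((size s).+1%:R * expR (- (alpha n * r)))%:E.
  have : forall t : seq S, {subset t <= s} ->
    open (\big[setU/set0]_(x <- t) N x) /\
    \forall n \near \oo, U n (\big[setU/set0]_(x <- t) N x) <=
    ((size t).+1%:R * expR (- (alpha n * r)))%:E.
    elim=> [_|x t IH xts].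
      split; first by rewrite big_nil; exact: open0.
      apply: filterS UK => n h; rewrite big_nil mul1r.
      by apply: le_trans h; exact: le_U.
    have [|bt Ut] := IH; first by move=> y yt; apply: xts; rewrite inE yt orbT.
    have Fx : F x by apply: sF; apply: xts; rewrite mem_head.
    have [oN _ UN] := hN _ Fx; split.
      by rewrite big_cons; exact: openU.
    apply: filterS (filterI Ut UN) => n [h1 h2]; rewrite big_cons.
    apply: le_trans (U_add n (borel_open oN) (borel_open bt)) _.
    rewrite -natr1 mulrDl mul1r addrC EFinD.
    exact: leeD.
  by move=> /(_ s)[].
have bs : borel_set (\big[setU/set0]_(x <- s) N x).
  rewrite -bigcup_seq; apply: borel_open; apply: bigcup_open => x /sF Fx.
  by have [] := hN _ Fx.
apply: filterS (filterI (filterI UK Us) (absorb_constant ((size s).+2)%:R alpha_cvg e0)).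
move=> n [[h1 h2] h3].
apply: (@le_trans _ _ (U n (~` K `|` \big[setU/set0]_(x <- s) N x))).
  apply: le_U => x Fx; have [Kx|nKx] := pselect (K x); [right|by left].
  have [y /= yD Ny] := Dcov _ (conj Fx Kx).
  by rewrite -bigcup_seq; exists y.
apply: le_trans (U_add n _ bs) _.
  by apply: borel_open; exact: closed_openC.
apply: le_trans (leeD h1 h2) _.
rewrite -EFinD lee_fin -{1}[expR _]mul1r -mulrDl nat1r.
rewrite (_ : (- (alpha n * (r - e)) = alpha n * e + - (alpha n * r))%R); last by lra.
by rewrite expRD ler_pM2r ?expR_gt0.
Qed.

End upper_bound_from_tightness.

Section good_rate.
Local Open Scope ereal_scope.
Context (R : realType) (S : ptopologicalType).
Context (U : nat -> set S -> \bar R) (alpha : nat -> R) (J : S -> \bar R).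
Context (alpha_gt0 : forall n, (0 < alpha n)%R)
  (lb : lower_bound U alpha J).

(** The lower bound forbids finite values of [J] on an open set of too small
    mass: exponential tightness bounds the sublevel sets of [J]. *)
Lemma lower_bound_open_null (G : set S) (L : R) x : open G ->
  (\forall n \near \oo, U n G <= (expR (- (alpha n * L)))%:E) ->
  G x -> L%:E <= J x.
Proof.
move=> oG UG Gx; rewrite leNgt; apply/negP => JL.
have [r [Jr rL]] : exists r : R, J x < r%:E /\ (r < L)%R.
  move: JL; case: (J x) => [j| |]//; rewrite ?lte_fin => jL.
    by exists ((j + L) / 2)%R; rewrite lte_fin; split; lra.
  by exists (L - 1)%R; rewrite ltNyr; split => //; lra.
have /(filterI UG) [n _ /(_ n (leqnn n)) [h1 h2]] := lb oG Gx Jr.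
have := le_trans h2 h1; rewrite lee_fin ler_expR.
by rewrite lerN2 ler_pM2l// leNgt rL.
Qed.

(** The levels of [J] lie in the compact sets of exponential tightness. *)
Lemma good_rate_function (m : R) (H : S -> \bar R) :
  H = (fun x => J x - m%:E) -> ereal_inf (range J) = m%:E ->
  (forall r : R, closed [set x | J x <= r%:E]) ->
  (forall L : R, exists K, [/\ compact K, closed K &
    \forall n \near \oo, U n (~` K) <= (expR (- (alpha n * L)))%:E]) ->
  rate_function H.
Proof.
move=> -> Jm cJ tight; split => [x|M M0].
  by rewrite sube_ge0// -Jm; apply: ereal_inf_lbound; exists x.
rewrite (_ : [set x | _] = [set x | J x <= (M + m)%:E]); last first.
  by apply/seteqP; split => x; rewrite /mkset leeBlDr.
have [K [cK clK UK]] := tight (M + m + 1)%R.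
apply: (subclosed_compact _ cK) => //.
move=> x /= JM; apply: contrapT => nKx.
have := lower_bound_open_null (closed_openC clK) UK nKx.
by move=> /le_trans/(_ JM); rewrite lee_fin; lra.
Qed.

End good_rate.

(** * The Gibbs measure *)

Section gibbs_measure.
Local Open Scope ereal_scope.
Context (R : realType) (d : nat).
Local Notation E := 'rV[R]_d.
Context (ell : {sigma_finite_measure set E -> \bar R})
  (V : E -> \bar R) (W : E * E -> \bar R) (beta : nat -> R)
  (mV : measurable_fun setT V) (mW : measurable_fun setT W).

Lemma measurable_tnth_comp n (f : E -> \bar R) (i : 'I_n) :
  measurable_fun setT f -> measurable_fun setT (fun x : n.-tuple E => f (tnth x i)).
Proof. by move=> mf; apply: (measurableT_comp mf); exact: measurable_tnth. Qed.

Lemma measurable_tnth2_comp n (f : E * E -> \bar R) (i j : 'I_n) :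
  measurable_fun setT f ->
  measurable_fun setT (fun x : n.-tuple E => f (tnth x i, tnth x j)).
Proof.
move=> mf; apply: (measurableT_comp mf).
by apply: measurable_fun_pair; exact: measurable_tnth.
Qed.

Lemma measurable_sum_pairs n (f : E * E -> \bar R) : measurable_fun setT f ->
  measurable_fun setT (fun x : n.-tuple E =>
    \sum_(i < n) \sum_(j < n | i != j) f (tnth x i, tnth x j)).
Proof.
move=> mf; apply: emeasurable_sum => i.
under eq_fun do rewrite big_mkcond.
apply: emeasurable_sum => j.
by case: (i != j); [exact: measurable_tnth2_comp|exact: measurable_cst].
Qed.

Lemma measurable_sum_tnth n (f : E -> \bar R) : measurable_fun setT f ->
  measurable_fun setT (fun x : n.-tuple E => \sum_(i < n) f (tnth x i)).
Proof. by move=> mf; apply: emeasurable_sum => i; exact: measurable_tnth_comp. Qed.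

Lemma measurable_expeR : measurable_fun setT (@expeR R).
Proof.
apply: (measurability _ (ErealGenOInfty.measurableE R)).
move=> /= _ [_ [a ->]] <-; rewrite setTI.
have [a0|a0] := ltP a 0%R.
  rewrite (_ : _ @^-1` _ = setT) //; apply/seteqP; split => // x _ /=.
  by rewrite in_itv/= andbT (lt_le_trans _ (expeR_ge0 x))// lte_fin.
have ax x : (a%:E < expeR x) = (lne a%:E < x).
  by rewrite -[RHS]lte_expeR lneK// in_itv/= lee_fin a0 leey.
move: (lne a%:E) ax => la ax.
rewrite (_ : _ @^-1` _ = `]la, +oo[%classic); first exact: emeasurable_itv.
by apply/seteqP; split => x /=; rewrite !in_itv/= !andbT ax.
Qed.

Lemma measurable_boltzmann n : measurable_fun setT (@boltzmann R d V W beta n).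
Proof.
apply: (measurableT_comp measurable_expeR).
under eq_fun do rewrite -mulN1e; apply: measurable_funeM.
apply: measurable_funeM; apply: emeasurable_funD.
  by apply: measurable_funeM; exact: measurable_sum_tnth.
by apply: measurable_funeM; exact: measurable_sum_pairs.
Qed.

Lemma boltzmann_ge0 n x : 0 <= @boltzmann R d V W beta n x.
Proof. exact: expeR_ge0. Qed.

Definition gibbs_mass n (A : set (n.-tuple E)) : \bar R :=
  iterated_integral ell (fun x => (\1_A x)%:E * boltzmann V W beta x).

Lemma gibbs_mass_ge0 n (A : set (n.-tuple E)) : 0 <= gibbs_mass A.
Proof.
apply: iterated_integral_ge0 => x; rewrite mule_ge0// ?lee_fin//.
exact: boltzmann_ge0.
Qed.

Lemma le_gibbs_mass n (A B : set (n.-tuple E)) :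
  A `<=` B -> gibbs_mass A <= gibbs_mass B.
Proof.
move=> AB; apply: le_iterated_integral => x; apply: lee_wpmul2r.
  exact: boltzmann_ge0.
rewrite lee_fin !indicE; case: (boolP (x \in A)) => [/set_mem/AB Bx|//].
by rewrite (mem_set Bx).
Qed.

Lemma gibbs_massT n : gibbs_mass [set: n.-tuple E] = partition_function ell V W beta n.
Proof. by congr iterated_integral; apply/funext => x; rewrite indicT mul1e. Qed.

Lemma gibbs_mass0 n : gibbs_mass (set0 : set (n.-tuple E)) = 0.
Proof.
rewrite /gibbs_mass; under [X in iterated_integral _ X]eq_fun do rewrite indic0 mul0e.
apply/eqP; rewrite eq_le iterated_integral_ge0// andbT.
have := @iterated_integralZl R d ell n (cst 0) 0 (measurable_cst _) (fun=> lexx _) (lexx _).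
by rewrite mul0e => h; rewrite -{2}h; apply: le_iterated_integral => x; rewrite mul0e.
Qed.

Lemma measurable_indic_boltzmann n (A : set (n.-tuple E)) : measurable A ->
  measurable_fun setT (fun x => (\1_A x)%:E * boltzmann V W beta x).
Proof.
move=> mA; apply: emeasurable_funM; last exact: measurable_boltzmann.
by apply/measurable_EFinP; exact: measurable_indic.
Qed.

Lemma gibbs_mass_sigma_additive n :
  semi_sigma_additive (@gibbs_mass n).
Proof.
move=> A mA tA mUA.
rewrite [X in _ --> X](_ : _ = \sum_(k <oo) gibbs_mass (A k)).
  exact: (is_cvg_nneseries (fun n _ _ => gibbs_mass_ge0 (A n))).
rewrite /gibbs_mass -iterated_integral_nneseries.
- congr iterated_integral; apply/funext => x.
  have h0 k : 0 <= (\1_(A k) x)%:E * boltzmann V W beta x.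
    by rewrite mule_ge0 ?lee_fin//; exact: boltzmann_ge0.
  have [[k _ Akx]|nAx] := pselect ((\bigcup_k A k) x); last first.
    rewrite indicE memNset// mul0e eseries0// => k _ _.
    by rewrite indicE memNset ?mul0e// => Akx; apply: nAx; exists k.
  rewrite (nneseriesD1 (n := k))// eseries0 ?adde0.
    by rewrite !indicE !mem_set//; exists k.
  move=> j _ jk; rewrite indicE memNset ?mul0e// => Ajx.
  move: jk; rewrite (tA j k) ?eqxx//.
  by exists x.
- by move=> k; exact: measurable_indic_boltzmann.
- by move=> k x; rewrite mule_ge0 ?lee_fin//; exact: boltzmann_ge0.
Qed.

Lemma gibbs_massU n (A B : set (n.-tuple E)) : measurable A -> measurable B ->
  gibbs_mass (A `|` B) <= gibbs_mass A + gibbs_mass B.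
Proof.
move=> mA mB.
rewrite /gibbs_mass -iterated_integralD; [|exact: measurable_indic_boltzmann..| |].
- apply: le_iterated_integral => x; rewrite -ge0_muleDl ?lee_fin//.
  apply: lee_wpmul2r; first exact: boltzmann_ge0.
  rewrite -EFinD lee_fin !indicE in_setU.
  by case: (x \in A); case: (x \in B); rewrite /= ?addr0 ?add0r ?lerDl.
- by move=> x; rewrite mule_ge0 ?lee_fin//; exact: boltzmann_ge0.
- by move=> x; rewrite mule_ge0 ?lee_fin//; exact: boltzmann_ge0.
Qed.

Lemma borel_preimage_measurable (S : ptopologicalType) n (f : n.-tuple E -> S) :
  (forall G, open G -> measurable (f @^-1` G)) ->
  forall A, borel_set A -> measurable (f @^-1` A).
Proof.
move=> mf A bA.
suff : [set A | measurable (f @^-1` A)] A by [].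
apply: (bA _); split => //; split.
- by rewrite /= preimage_set0.
- move=> B /= mB; rewrite setTD preimage_setC; exact: measurableC.
- by move=> F /= mF; rewrite preimage_bigcup; exact: bigcupT_measurable.
Qed.

Lemma gibbs_borel_probability (S : ptopologicalType) n (f : n.-tuple E -> S) :
  (forall G, open G -> measurable (f @^-1` G)) ->
  0 < gibbs_mass [set: n.-tuple E] -> gibbs_mass [set: n.-tuple E] < +oo ->
  borel_probability (fun A => gibbs ell V W beta (f @^-1` A)).
Proof.
move=> mf Z0 Zoo; have mf' := borel_preimage_measurable mf.
have Zfin : gibbs_mass [set: n.-tuple E] \is a fin_num by rewrite ge0_fin_numE ?gibbs_mass_ge0.
pose T := g_sigma_algebraType (@open S).
pose P0 : set T -> \bar R := fun A => gibbs ell V W beta (f @^-1` A).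
have gE (A : set (n.-tuple E)) : gibbs ell V W beta A =
    (fine (gibbs_mass [set: n.-tuple E]))^-1%:E * gibbs_mass A.
  rewrite /gibbs -/(gibbs_mass A) -gibbs_massT muleC; congr (_ * _).
  by rewrite -{1}(fineK Zfin) inver gt_eqF// fine_gt0// Z0.
have Zi0 : 0 <= (fine (gibbs_mass [set: n.-tuple E]))^-1%:E :> \bar R.
  by rewrite lee_fin invr_ge0 fine_ge0// gibbs_mass_ge0.
have P00 : P0 set0 = 0 by rewrite /P0 preimage_set0 gE gibbs_mass0 mule0.
have P0_ge0 A : 0 <= P0 A by rewrite /P0 gE mule_ge0// gibbs_mass_ge0.
have P0_sa : semi_sigma_additive P0.
  move=> F mF tF mUF; rewrite /P0; under eq_fun do under eq_bigr do rewrite gE.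
  rewrite gE preimage_bigcup.
  have := @gibbs_mass_sigma_additive n (fun k => f @^-1` (F k)).
  move=> /(_ (fun k => mf' _ (mF k))) h.
  set z := (_^-1)%:E in Zi0 gE *.
  rewrite (_ : (fun k => _) = fun k => z * \sum_(0 <= i < k) gibbs_mass (f @^-1` F i));
    last by apply/funext => k; rewrite ge0_sume_distrr// => i _; exact: gibbs_mass_ge0.
  apply: cvgeZl => //; apply: h.
  - apply/trivIsetP => i j _ _ ij; rewrite -preimage_setI.
    by move/trivIsetP : tF => ->//; rewrite preimage_set0.
  - by rewrite -preimage_bigcup; exact: mf'.
pose m := HB.pack_for {measure set T -> \bar R} P0
  (isMeasure.Build _ T R P0 P00 P0_ge0 P0_sa).
have mT : m setT = 1.
  rewrite /= /P0 preimage_setT gE -{2}(fineK Zfin) -EFinM mulVf//.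
  by rewrite gt_eqF// fine_gt0// Z0.
pose mu : probability T R := HB.pack (Measure.sort m)
  (Measure_isProbability.Build _ T R m mT).
by exists mu.
Qed.

End gibbs_measure.

(** * The energy as a double integral *)

(** As the integral of [f] may be infinite and [r] negative, the identity is
    obtained from the positive and negative parts of [f + r]. *)
Lemma integral_addr_cst d' (T : measurableType d') (R : realType)
    (mu : probability T R) (f : T -> \bar R) (r : R) :
  measurable_fun setT f -> (forall x, 0 <= f x)%E ->
  (\int[mu]_x (f x + r%:E) = \int[mu]_x f x + r%:E)%E.
Proof.
move=> mf f0; have [r0|r0] := leP 0 r.
  by rewrite ge0_integralD// integral_probability_cst.
pose q x : \bar R := ((fun x => f x + r%:E)^\- x)%E; pose p x := ((fun x => f x + r%:E)^\+ x)%E.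
have mfr : measurable_fun setT (fun x => f x + r%:E)%E by exact: emeasurable_funD.
have mp : measurable_fun setT p by exact: measurable_funepos.
have mq : measurable_fun setT q by exact: measurable_funeneg.
have p0 x : (0 <= p x)%E by exact: funepos_ge0.
have q0 x : (0 <= q x)%E by exact: funeneg_ge0.
have qr x : (q x <= (- r)%:E)%E.
  rewrite /q funenegE ge_max lee_fin oppr_ge0 (ltW r0) andbT oppeD ?fin_num_adde_defl//.
  by rewrite -EFinN geeDr// oppe_le0.
have fq x : (f x + q x = p x + (- r)%:E)%E.
  have := funeposneg (fun x => f x + r%:E)%E; move=> /(congr1 (fun h => h x))/=.
  rewrite -/(p x) -/(q x); move: (q0 x) (qr x) (p0 x) (f0 x).
  case: (q x) => [u| |]//; case: (p x) => [v| |]//; case: (f x) => [w| |]//= _ _ _ _ [].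
  by move=> h; rewrite -!EFinD; congr (_)%:E; lra.
have : (\int[mu]_x (f x + q x) = \int[mu]_x (p x + (- r)%:E))%E by apply: eq_integral.
rewrite ge0_integralD// ge0_integralD//; last by move=> x _; rewrite lee_fin; lra.
rewrite integral_probability_cst.
have -> : (\int[mu]_x (f x + r%:E) = \int[mu]_x p x - \int[mu]_x q x)%E by exact: integralE.
have : (\int[mu]_x q x <= (- r)%:E)%E.
  by rewrite -(integral_probability_cst mu (- r)%:E); apply: le_integralT.
have := @integral_ge0 _ _ _ mu setT q (fun x _ => q0 x).
have := @integral_ge0 _ _ _ mu setT p (fun x _ => p0 x).
have := @integral_ge0 _ _ _ mu setT f (fun x _ => f0 x).
case: (\int[mu]_x q x)%E => [u| |]//; case: (\int[mu]_x p x)%E => [v| |]//.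
  case: (\int[mu]_x f x)%E => [w| |]//= _ _ _ _ []h.
  by rewrite -!EFinD; congr (_)%:E; lra.
by case: (\int[mu]_x f x)%E.
Qed.

Section energy.
Context (R : realType) (d : nat).
Local Notation E := 'rV[R]_d.
Context (V : E -> \bar R) (W : E * E -> \bar R) (a c : R)
  (V_gtNy : forall x, (-oo < V x)%E) (W_gtNy : forall z, (-oo < W z)%E)
  (a0 : 0 <= a) (a1 : a < 1)
  (Vc : forall x, (c%:E <= V x)%E)
  (Wc : forall z, (c%:E <= W z + a%:E * (V z.1 + V z.2))%E).

(** The external and interaction energies shifted to be nonnegative, and the
    nonnegative interaction whose double integral is, up to the constant
    [kappa], the energy functional [J]. *)
Definition V0 x : \bar R := (V x - c%:E)%E.
Definition W0 z : \bar R := (W z + a%:E * (V z.1 + V z.2) - c%:E)%E.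
Definition pair_energy z : \bar R := (W0 z + (1 - a)%:E * (V0 z.1 + V0 z.2))%E.
Definition kappa : R := c / 2 + (1 - a) * c.
(** The constant left over with [N] particles; it tends to [kappa]. *)
Definition kappa_ (N : R) : R := (1 - a) * c + a * c / N + c * (N - 1) / (2 * N).

Lemma V0_ge0 x : (0 <= V0 x)%E.
Proof. by rewrite /V0 sube_ge0. Qed.

Lemma W0_ge0 z : (0 <= W0 z)%E.
Proof. by rewrite /W0 sube_ge0. Qed.

Lemma pair_energy_ge0 z : (0 <= pair_energy z)%E.
Proof.
apply: adde_ge0; first exact: W0_ge0.
apply: mule_ge0; first by rewrite lee_fin subr_ge0 ltW.
by apply: adde_ge0; exact: V0_ge0.
Qed.

Lemma pair_energyE z :
  (W z + V z.1 + V z.2 = pair_energy z + (2 * kappa)%:E)%E.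
Proof.
have a1' : 0 < 1 - a by rewrite subr_gt0.
have ge0N (t : \bar R) : (0 <= t)%E -> t != -oo%E by case: t.
have sumy : (W z + V z.1 + V z.2 = +oo)%E -> pair_energy z = +oo%E ->
    (W z + V z.1 + V z.2 = pair_energy z + (2 * kappa)%:E)%E by move=> -> ->.
have W0N := ge0N _ (W0_ge0 z).
have [V1|V1] := eqVneq (V z.1) +oo%E.
  apply: sumy.
    by rewrite V1 addey ?addye// gt_eqF.
  rewrite /pair_energy [V0 z.1]/V0 V1/= addye ?ge0N ?V0_ge0//.
  by rewrite gt0_muley ?lte_fin// addey.
have [V2|V2] := eqVneq (V z.2) +oo%E.
  apply: sumy.
    rewrite V2 addey//; move: (W_gtNy z) (V_gtNy z.1).
    by case: (W z) => [w| |]//; case: (V z.1).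
  rewrite /pair_energy [V0 z.2]/V0 V2/= addey ?ge0N ?V0_ge0//.
  by rewrite gt0_muley ?lte_fin// addey.
rewrite /pair_energy /W0 /V0.
move: (V_gtNy z.1) (V_gtNy z.2) (W_gtNy z) V1 V2.
case: (V z.1) => [v1| |]//; case: (V z.2) => [v2| |]// _ _; case: (W z) => [w| |]// _ _ _.
by rewrite -!(EFinB, EFinD, EFinM); congr (_)%:E; rewrite /kappa; field.
Qed.

Section finite_configurations.
Context (n : nat).
Local Notation N := (n.+1%:R : R).
Implicit Types x : n.+1.-tuple E.

Definition finite_energy x := (forall i, V (tnth x i) \is a fin_num) /\
  forall i j, i != j -> W (tnth x i, tnth x j) \is a fin_num.

(** The double integral of [pair_energy] against the empirical measure, without
    the diagonal. *)
Definition Xi x : \bar R := ((N ^+ 2)^-1%:E *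
  \sum_(i < n.+1) \sum_(j < n.+1 | i != j) pair_energy (tnth x i, tnth x j))%E.

(** Twice the energy of the configuration, up to the constant [2 * kappa_ N], as
    a sum of nonnegative terms. *)
Definition shifted_energy x : \bar R :=
  ((2 * ((1 - a) + a / N) / N)%:E * \sum_(i < n.+1) V0 (tnth x i) +
  (N ^+ 2)^-1%:E *
  \sum_(i < n.+1) \sum_(j < n.+1 | i != j) W0 (tnth x i, tnth x j))%E.

Lemma energy_eqy x : ~ finite_energy x -> energy V W x = +oo%E.
Proof.
have N0 : 0 < N^-1 by rewrite invr_gt0.
have N20 : 0 < (2 * N ^+ 2)^-1 by rewrite invr_gt0 mulr_gt0// exprn_gt0.
have VN i : V (tnth x i) != -oo%E by rewrite gt_eqF.
have WN i j : W (tnth x i, tnth x j) != -oo%E by rewrite gt_eqF.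
have sVN : (\sum_(i < n.+1) V (tnth x i))%E != -oo%E.
  apply/negP => /eqP/esum_eqNyP[i [_ _ h]]; move: (VN i); by rewrite h.
have sWN i : (\sum_(j < n.+1 | i != j) W (tnth x i, tnth x j))%E != -oo%E.
  apply/negP => /eqP/esum_eqNyP[j [_ _ h]]; move: (WN i j); by rewrite h.
have ssWN : (\sum_(i < n.+1) \sum_(j < n.+1 | i != j) W (tnth x i, tnth x j))%E != -oo%E.
  apply/negP => /eqP/esum_eqNyP[i [_ _ h]]; move: (sWN i); by rewrite h.
have mulN (r : R) (t : \bar R) : 0 < r -> t != -oo%E -> (r%:E * t)%E != -oo%E.
  by move=> r0; case: t => //= _; rewrite gt0_muley ?lte_fin.
move=> nf; rewrite /energy.
have [Vfin|] := pselect (forall i, V (tnth x i) \is a fin_num).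
  have [i [j [ij Wij]]] : exists i j, i != j /\ W (tnth x i, tnth x j) = +oo%E.
    apply: contrapT => h; apply: nf; split => // i j ij.
    rewrite fin_numE WN/=; apply/eqP => Wy; apply: h; exists i, j; by [].
  have -> : (\sum_(i < n.+1) \sum_(j < n.+1 | i != j) W (tnth x i, tnth x j) = +oo)%E.
    apply/esum_eqyP; first by move=> k _; exact: sWN.
    exists i; rewrite mem_index_enum; split => //; apply/esum_eqyP.
      by move=> k _; exact: WN.
    by exists j; rewrite mem_index_enum ij.
  by rewrite gt0_muley ?lte_fin// addey// mulN.
move=> /existsNP[i Vi].
have Vy : V (tnth x i) = +oo%E.
  by move/negP: Vi; rewrite fin_numE VN/= negbK => /eqP.
have -> : (\sum_(i < n.+1) V (tnth x i) = +oo)%E.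
  apply/esum_eqyP; first by move=> k _; exact: VN.
  by exists i; rewrite mem_index_enum.
by rewrite gt0_muley ?lte_fin// addye// mulN.
Qed.

Lemma sum_pairs_cst (r : R) : \sum_(i < n.+1) \sum_(j < n.+1 | i != j) r = N * (N - 1) * r.
Proof.
have h (i : 'I_n.+1) : \sum_(j < n.+1 | i != j) r = (N - 1) * r.
  have h : \sum_(j < n.+1) r = r + \sum_(j < n.+1 | j != i) r by rewrite (bigD1 i).
  rewrite sumr_const card_ord in h.
  under eq_bigl do rewrite eq_sym.
  rewrite mulrBl mul1r mulr_natl; apply/eqP; rewrite -subr_eq opprK addrC.
  by apply/eqP; rewrite h.
under eq_bigr do rewrite h.
by rewrite sumr_const card_ord -mulrA mulr_natl.
Qed.

Lemma sum_pairs_fst (v : 'I_n.+1 -> R) :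
  \sum_(i < n.+1) \sum_(j < n.+1 | i != j) v i = (N - 1) * \sum_i v i.
Proof.
rewrite mulr_sumr; apply: eq_bigr => i _.
have h : \sum_(j < n.+1) v i = v i + \sum_(j < n.+1 | j != i) v i by rewrite (bigD1 i).
rewrite sumr_const card_ord in h.
under eq_bigl do rewrite eq_sym.
rewrite mulrBl mul1r mulr_natl; apply/eqP; rewrite -subr_eq opprK addrC.
by apply/eqP; rewrite h.
Qed.

Lemma sum_pairs_snd (v : 'I_n.+1 -> R) :
  \sum_(i < n.+1) \sum_(j < n.+1 | i != j) v j = (N - 1) * \sum_i v i.
Proof.
rewrite -sum_pairs_fst (exchange_big_dep xpredT)//=.
by apply: eq_bigr => i _; apply: eq_bigl => j; rewrite eq_sym.
Qed.

Section real_sums.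
Context (x : n.+1.-tuple E) (fx : finite_energy x).
Let v i := fine (V (tnth x i)).
Let w i j := fine (W (tnth x i, tnth x j)).
Let Sv := \sum_(i < n.+1) v i.
Let Sw := \sum_(i < n.+1) \sum_(j < n.+1 | i != j) w i j.

Lemma VE i : V (tnth x i) = (v i)%:E.
Proof. by rewrite fineK//; apply: fx.1. Qed.

Lemma WE i j : i != j -> W (tnth x i, tnth x j) = (w i j)%:E.
Proof. by move=> ij; rewrite fineK//; apply: fx.2. Qed.

Lemma energy_real : energy V W x = (N^-1 * Sv + (2 * N ^+ 2)^-1 * Sw)%:E.
Proof.
rewrite /energy; under eq_bigr do rewrite VE.
under [X in (_ + _ * X)%E]eq_bigr => i _.
  under eq_bigr => j ij do rewrite WE//.
  rewrite sumEFin; over.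
by rewrite !sumEFin -!EFinM -EFinD.
Qed.

Lemma Xi_real : Xi x = ((N ^+ 2)^-1 *
  (Sw + 2 * (N - 1) * Sv - N * (N - 1) * (2 * kappa)))%:E.
Proof.
have gE i j : i != j -> pair_energy (tnth x i, tnth x j) =
    (w i j + v i + v j - 2 * kappa)%:E.
  move=> ij; have := pair_energyE (tnth x i, tnth x j).
  rewrite /= WE// !VE -!EFinD => h.
  by rewrite EFinB h addeK.
rewrite /Xi; under eq_bigr => i _.
  under eq_bigr => j ij do rewrite gE//.
  rewrite sumEFin; over.
rewrite sumEFin -EFinM; congr (_ * _)%:E.
under eq_bigr do rewrite sumrB !big_split/=.
rewrite sumrB !big_split/= sum_pairs_cst sum_pairs_fst sum_pairs_snd -/Sv -/Sw.
by ring.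
Qed.

Lemma shifted_energy_real : shifted_energy x =
  (2 * ((1 - a) + a / N) / N * (Sv - N * c) + (N ^+ 2)^-1 *
  (Sw + 2 * a * (N - 1) * Sv - N * (N - 1) * c))%:E.
Proof.
rewrite /shifted_energy.
have -> : (\sum_(i < n.+1) V0 (tnth x i) = (Sv - N * c)%:E)%E.
  under eq_bigr do rewrite /V0 VE -EFinB.
  by rewrite sumEFin sumrB sumr_const card_ord mulr_natl.
have -> : (\sum_(i < n.+1) \sum_(j < n.+1 | i != j) W0 (tnth x i, tnth x j) =
    (Sw + 2 * a * (N - 1) * Sv - N * (N - 1) * c)%:E)%E.
  have WE' i j : i != j -> W0 (tnth x i, tnth x j) =
      (w i j + a * (v i + v j) - c)%:E.
    by move=> ij; rewrite /W0/= WE// !VE.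
  under eq_bigr => i _.
    under eq_bigr => j ij do rewrite WE'//.
    rewrite sumEFin; over.
  rewrite sumEFin; congr (_)%:E.
  under eq_bigr do rewrite sumrB big_split/= -mulr_sumr big_split/=.
  rewrite sumrB big_split/= -mulr_sumr big_split/= sum_pairs_cst sum_pairs_fst.
  by rewrite sum_pairs_snd -/Sv -/Sw; ring.
by rewrite -!EFinM -EFinD.
Qed.

Lemma Sv_ge : N * c <= Sv.
Proof.
rewrite mulr_natl -[n.+1 in X in X <= _]card_ord -sumr_const; apply: ler_sum => i _.
by rewrite -lee_fin -VE.
Qed.

Lemma Sw_ge : N * (N - 1) * c <= Sw + 2 * a * (N - 1) * Sv.
Proof.
have -> : Sw + 2 * a * (N - 1) * Sv =
    \sum_(i < n.+1) \sum_(j < n.+1 | i != j) (w i j + a * (v i + v j)).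
  under [RHS]eq_bigr do rewrite big_split/= -mulr_sumr big_split/=.
  by rewrite big_split/= -mulr_sumr big_split/= sum_pairs_fst sum_pairs_snd -/Sv -/Sw; ring.
rewrite -sum_pairs_cst; apply: ler_sum => i _; apply: ler_sum => j ij.
have := Wc (tnth x i, tnth x j); rewrite /= WE// !VE => h.
by rewrite -lee_fin; exact: h.
Qed.

Lemma N_gt0 : 0 < N. Proof. by []. Qed.

Lemma energy_shifted :
  energy V W x = (fine (shifted_energy x) / 2 + kappa_ N)%:E.
Proof.
rewrite energy_real shifted_energy_real/= /kappa_; congr (_)%:E.
have := N_gt0; move: (N) => M M0; field; lra.
Qed.

(** A fraction [N / b] of the pair energy is given up to produce the term
    [(1 - a) V], the exponential of which is integrable. What is discarded is
    nonnegative because [V - c] and the shifted interaction are. *)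
Lemma boltzmann_exponent_le (b : R) : N <= b ->
  - (b * (N^-1 * Sv + (2 * N ^+ 2)^-1 * Sw)) <=
  - ((1 - a) * Sv) + (N * (1 - a) * c -
     b * (kappa_ N + (1 - N / b) / 2 * fine (Xi x))).
Proof.
move=> Nb; rewrite Xi_real/=.
have Sv0 := Sv_ge; have Sw0 := Sw_ge; have M1 : 1 <= N by rewrite ler1n.
move: Nb Sv0 Sw0 M1 => {}; move: (N) Sv Sw => M s w' Mb s0 w0 M1.
rewrite -subr_ge0 /kappa_ /kappa.
have M0 : 0 < M by lra.
have b0 : 0 < b by lra.
rewrite [X in 0 <= X](_ : _ = (s - M * c) * ((1 - a) * (b - M) + a * b) / M ^+ 2 +
  (w' + 2 * a * (M - 1) * s - M * (M - 1) * c) / (2 * M)); last first.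
  by field; rewrite !gt_eqF.
have h1 : 0 <= (1 - a) * (b - M) + a * b.
  have a1' : 0 <= 1 - a by rewrite subr_ge0 ltW.
  apply: addr_ge0; apply: mulr_ge0 => //; [by rewrite subr_ge0 | exact: ltW].
apply: addr_ge0; apply: divr_ge0.
- by apply: mulr_ge0 => //; lra.
- by rewrite exprn_ge0// ltW.
- lra.
- lra.
Qed.

End real_sums.

Lemma boltzmann_le (beta : nat -> R) x (y : R) : N <= beta n.+1 ->
  (y%:E <= Xi x)%E ->
  (boltzmann V W beta x <=
   (\prod_(i < n.+1) expeR (- ((1 - a)%:E * V (tnth x i)))) *
   (expR (N * (1 - a) * c - beta n.+1 * (kappa_ N +
     (1 - N / beta n.+1) / 2 * y)))%:E)%E.
Proof.
move=> Nb yXi; have b0 : 0 < beta n.+1 by exact: lt_le_trans (N_gt0) Nb.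
have [fx|nfx] := pselect (finite_energy x); last first.
  rewrite /boltzmann energy_eqy// gt0_muley ?lte_fin//= mule_ge0 ?lee_fin ?expR_ge0//.
  by apply: prode_ge0 => i _; exact: expeR_ge0.
have -> : (\prod_(i < n.+1) expeR (- ((1 - a)%:E * V (tnth x i))) =
    (expR (- ((1 - a) * \sum_(i < n.+1) fine (V (tnth x i)))))%:E)%E.
  rewrite mulr_sumr -sumrN expR_sum -prodEFin; apply: eq_bigr => i _.
  by rewrite {1}VE.
rewrite /boltzmann energy_real// -EFinM -EFinN -EFinM lee_fin -expRD ler_expR.
apply: (le_trans (boltzmann_exponent_le fx Nb)).
rewrite lerD2l lerD2l lerN2 ler_wpM2l ?(ltW b0)// lerD2l ler_wpM2l//.
  by rewrite divr_ge0// subr_ge0 ler_pdivrMr// mul1r.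
by rewrite -lee_fin fineK// Xi_real.
Qed.

Lemma finite_energy_shifted x : (shifted_energy x < +oo)%E -> finite_energy x.
Proof.
have le_sum1 (I : finType) (P : pred I) (f : I -> \bar R) i : (forall j, 0 <= f j)%E -> P i ->
    (\sum_(j | P j) f j < +oo -> f i < +oo)%E.
  move=> f0 Pi; apply: le_lt_trans; rewrite (bigD1 i)//= leeDl// sume_ge0//.
have lty_mul (r : R) (u : \bar R) : 0 < r -> (r%:E * u < +oo -> u < +oo)%E.
  by move=> r0; case: u => // [u _|]; rewrite ?ltry// gt0_muley.
have V00 := V0_ge0; have W00 := W0_ge0.
have sV0 : (0 <= \sum_(i < n.+1) V0 (tnth x i))%E by apply: sume_ge0.
have sW0 : (0 <= \sum_(i < n.+1) \sum_(j < n.+1 | i != j) W0 (tnth x i, tnth x j))%E.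
  by do 2 apply: sume_ge0 => ? _.
have N0 : 0 < N by [].
have r1 : 0 < 2 * ((1 - a) + a / N) / N.
  rewrite divr_gt0// mulr_gt0// ltr_pwDl// ?subr_gt0//.
  by rewrite divr_ge0.
have r2 : 0 < (N ^+ 2)^-1 by rewrite invr_gt0 exprn_gt0.
move=> h.
have h1 : (\sum_(i < n.+1) V0 (tnth x i) < +oo)%E.
  apply: (lty_mul _ _ r1); apply: le_lt_trans h; rewrite leeDl// mule_ge0// lee_fin ltW//.
have h2 : (\sum_(i < n.+1) \sum_(j < n.+1 | i != j) W0 (tnth x i, tnth x j) < +oo)%E.
  apply: (lty_mul _ _ r2); apply: le_lt_trans h; rewrite leeDr// mule_ge0// lee_fin ltW//.
have fV i : V (tnth x i) \is a fin_num.
  have : (V0 (tnth x i) < +oo)%E by apply: (le_sum1 _ xpredT (fun j => V0 (tnth x j)) i).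
  by rewrite /V0; move: (V_gtNy (tnth x i)); case: (V _).
split => // i j ij.
have : (W0 (tnth x i, tnth x j) < +oo)%E.
  apply: (le_sum1 _ (fun j => i != j) (fun j => W0 (tnth x i, tnth x j)) j) => //.
  apply: (le_sum1 _ xpredT (fun i => \sum_(j < n.+1 | i != j) W0 (tnth x i, tnth x j))%E i) => //.
  by move=> k; apply: sume_ge0.
rewrite /W0/= -(fineK (fV i)) -(fineK (fV j)).
by move: (W_gtNy (tnth x i, tnth x j)); case: (W _).
Qed.

Lemma boltzmann_ge (beta : nat -> R) x (t : R) : 0 <= beta n.+1 ->
  (shifted_energy x <= t%:E)%E ->
  ((expR (- (beta n.+1 * (t / 2 + kappa_ N))))%:E <= boltzmann V W beta x)%E.
Proof.
move=> b0 xt.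
have fx : finite_energy x by apply: finite_energy_shifted; exact: le_lt_trans xt (ltry _).
rewrite /boltzmann energy_shifted// lee_fin ler_expR lerN2 ler_wpM2l// lerD2r.
by rewrite ler_pM2r// -lee_fin fineK// shifted_energy_real.
Qed.

End finite_configurations.

Lemma kappa_cvg : kappa_ n.+1%:R @[n --> \oo] --> kappa.
Proof.
have h : (n.+1%:R^-1 : R) @[n --> \oo] --> (0 : R) by exact: cvg_harmonic.
rewrite (_ : (fun n => kappa_ n.+1%:R) =
    (fun n : nat => kappa + (a * c - c / 2) * n.+1%:R^-1)); last first.
  apply/funext => n; rewrite /kappa_ /kappa; field.
  by rewrite addrC natr1 pnatr_eq0.
rewrite -[X in _ --> X]addr0 -[X in _ --> _ + X](mulr0 (a * c - c / 2)).
by apply: cvgD; [exact: cvg_cst | apply: cvgM => //; exact: cvg_cst].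
Qed.

Context (lV : lower_semicontinuous V) (lW : lower_semicontinuous W).

Lemma lsc_V0 : lower_semicontinuous V0.
Proof.
apply: lscD => //; first by move=> x; exact: ltNyr.
exact: lsc_cst.
Qed.

Lemma lsc_sum_fst_snd (f : E -> \bar R) (r : R) : (forall x, -oo < f x)%E -> 0 <= r ->
  lower_semicontinuous f ->
  lower_semicontinuous (fun z : E * E => r%:E * (f z.1 + f z.2))%E.
Proof.
move=> fN r0 lf; apply: lsc_scale => //; apply: lscD; try by move=> z; exact: fN.
  by apply: (@lsc_comp R (E * E)%type E f fst) => // z; exact: cvg_fst.
by apply: (@lsc_comp R (E * E)%type E f snd) => // z; exact: cvg_snd.
Qed.

Lemma gtNy_scale (f : E -> \bar R) (r : R) z : (forall x, -oo < f x)%E -> 0 <= r ->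
  (-oo < r%:E * (f z.1 + f z.2))%E.
Proof.
move=> fN; rewrite le_eqVlt => /predU1P[<-|r0]; first by rewrite mul0e.
move: (fN z.1) (fN z.2); case: (f z.1) => [u| |]//; case: (f z.2) => [v| |]// _ _.
- by rewrite -EFinM ltNyr.
- by rewrite addey// gt0_muley.
- by rewrite addye// gt0_muley.
- by rewrite addye// gt0_muley.
Qed.

Lemma lsc_W0 : lower_semicontinuous W0.
Proof.
apply: lscD; [|by move=> x; exact: ltNyr| |exact: lsc_cst].
  by move=> z; exact: lt_le_trans (ltNyr _) (Wc z).
apply: lscD => //; first by move=> z; exact: gtNy_scale.
exact: lsc_sum_fst_snd.
Qed.

Lemma V0_gtNy x : (-oo < V0 x)%E.
Proof. by exact: lt_le_trans (V0_ge0 x). Qed.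

Lemma lsc_pair_energy : lower_semicontinuous pair_energy.
Proof.
have a1' : 0 <= 1 - a by rewrite subr_ge0 ltW.
apply: lscD; [|by move=> z; apply: gtNy_scale => // x; exact: V0_gtNy|exact: lsc_W0|].
  by move=> z; exact: lt_le_trans (W0_ge0 z).
by apply: lsc_sum_fst_snd => //; [exact: V0_gtNy | exact: lsc_V0].
Qed.

Lemma measurable_pair_energy : measurable_fun setT pair_energy.
Proof. by apply: lsc_measurable2; exact: lsc_pair_energy. Qed.

Lemma J_pair_energy (mu : Prob R d) :
  (J V W mu = 2^-1%:E * (\int[mu \x mu]_z pair_energy z + (2 * kappa)%:E))%E.
Proof.
rewrite /J; congr (_ * _)%E.
rewrite -(@integral_addr_cst _ _ _ (mu \x mu)%E); first last.
- by move=> z; exact: pair_energy_ge0.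
- exact: measurable_pair_energy.
by apply: eq_integral => z _; exact: pair_energyE.
Qed.

Lemma lt_J_pair_energy (mu : Prob R d) (r : R) :
  (r%:E < J V W mu)%E = ((2 * (r - kappa))%:E < \int[mu \x mu]_z pair_energy z)%E.
Proof.
rewrite J_pair_energy.
have := @integral_ge0 _ _ _ (mu \x mu)%E setT pair_energy (fun z _ => pair_energy_ge0 z).
case: (\int[_]_z _)%E => [u| |]// _.
  rewrite -EFinD -EFinM !lte_fin; apply/idP/idP; lra.
by rewrite addye// gt0_muley ?lte_fin ?invr_gt0// !ltry.
Qed.

Lemma J_closed (r : R) : closed [set mu : Prob R d | (J V W mu <= r%:E)%E].
Proof.
rewrite -openC openE => mu /= /negP; rewrite -ltNge lt_J_pair_energy => h.
have := lsc_integral2_near lsc_pair_energy pair_energy_ge0 h.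
by apply: filterS => nu /=; rewrite -lt_J_pair_energy => H; apply/negP; rewrite -ltNge.
Qed.

Lemma J_ge_kappa (mu : Prob R d) : (kappa%:E <= J V W mu)%E.
Proof.
rewrite leNgt; apply/negP => h.
have : (\int[mu \x mu]_z pair_energy z < 0)%E.
  move: h; rewrite J_pair_energy.
  case: (\int[_]_z _)%E => [u| |]//; last by rewrite addye// gt0_muley ?lte_fin ?invr_gt0.
  rewrite -EFinD -EFinM !lte_fin; lra.
by apply/negP; rewrite -leNgt integral_ge0// => z _; exact: pair_energy_ge0.
Qed.

End energy.

(** * Upper bounds *)

Section upper_bounds.
Context (R : realType) (d : nat).
Local Notation E := 'rV[R]_d.
Context (ell : {sigma_finite_measure set E -> \bar R})
  (V : E -> \bar R) (W : E * E -> \bar R) (beta : nat -> R) (a c : R)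
  (V_gtNy : forall x, (-oo < V x)%E) (W_gtNy : forall z, (-oo < W z)%E)
  (a0 : 0 <= a) (a1 : a < 1)
  (Vc : forall x, (c%:E <= V x)%E)
  (Wc : forall z, (c%:E <= W z + a%:E * (V z.1 + V z.2))%E)
  (lV : lower_semicontinuous V) (lW : lower_semicontinuous W)
  (ell_atomless : atomless ell)
  (beta_gt0 : forall n, (0 < n)%N -> 0 < beta n)
  (beta_n_cvgy : beta n / n%:R @[n --> \oo] --> +oo).
Local Notation g := (pair_energy V W a c).

Lemma atomless_set1 x : ell [set x] = 0%E.
Proof.
apply/eqP; rewrite -measure_le0 leNgt; apply/negP => x0; apply: ell_atomless.
exists [set x]; split => //; first exact: measurable_set1_rV.
move=> B mB Bx; have [->|/set0P[y By]] := eqVneq B set0; first by rewrite measure0.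
suff -> : B = [set x] by rewrite ltxx.
by apply/seteqP; split => // z ->; move: (By); rewrite (Bx _ By).
Qed.

Lemma speed_cvgy : beta n.+1 @[n --> \oo] --> +oo.
Proof.
apply/cvgryPge => A.
have := beta_n_cvgy; rewrite -(cvg_shiftS (fun n => beta n / n%:R)).
move=> /cvgryPge /(_ (Num.max A 0)); apply: filterS => n /=.
rewrite ler_pdivlMr// => h; apply: le_trans h.
rewrite (@le_trans _ _ (Num.max A 0 * 1))// ?mulr1 ?le_max ?lexx//.
by rewrite -{1}[Num.max A 0]mulr1 ler_wpM2l ?le_max ?lexx ?orbT// ler1n.
Qed.

Lemma ratio_cvg0 : n.+1%:R / beta n.+1 @[n --> \oo] --> (0 : R).
Proof.
apply/cvgrPdist_lt => e e0.
have := beta_n_cvgy; rewrite -(cvg_shiftS (fun n => beta n / n%:R)).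
move=> /cvgryPgt /(_ (e^-1)); apply: filterS => n /= h.
have b0 := beta_gt0 (ltn0Sn n).
rewrite sub0r normrN ger0_norm ?divr_ge0// ?ltW//.
have : (beta n.+1 / n.+1%:R)^-1 < e by rewrite -[e]invrK ltf_pV2// ?posrE ?invr_gt0// divr_gt0.
by rewrite invf_div.
Qed.

Lemma harmonic_cvg0 : (n.+1%:R^-1 : R) @[n --> \oo] --> (0 : R).
Proof. exact: cvg_harmonic. Qed.

(** At the speed [beta] an exponent may be replaced by its limit, up to an
    arbitrarily small error. *)
Lemma exponent_near (f : nat -> R) (l r : R) : f n @[n --> \oo] --> l -> l < - r ->
  \forall n \near \oo, expR (beta n.+1 * f n) <= expR (- (beta n.+1 * r)).
Proof.
move=> fl lr; have : \forall n \near \oo, f n < - r by exact: (cvgr_lt l fl _ lr).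
apply: filterS => n fr.
by rewrite ler_expR -mulrN ler_wpM2l ?ltW// beta_gt0.
Qed.

(** A product bound for the Boltzmann factor decouples the particles. *)
Lemma le_gibbs_mass_prod n (A : set (n.+1.-tuple E)) (f : E -> \bar R) (K q : R) :
  measurable A -> measurable_fun setT f -> (forall x, 0 <= f x)%E ->
  (\int[ell]_x f x <= (expR q)%:E)%E ->
  (forall x : n.+1.-tuple E, uniq x -> A x ->
    boltzmann V W beta x <= (\prod_(i < n.+1) f (tnth x i)) * (expR K)%:E)%E ->
  (gibbs_mass ell V W beta A <= (expR (n.+1%:R * q + K))%:E)%E.
Proof.
move=> mA mf f0 fq le.
have mp : measurable_fun setT (fun x : n.+1.-tuple E => \prod_(i < n.+1) f (tnth x i))%E.
  exact: measurable_prod_tnth.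
have p0 (x : n.+1.-tuple E) : (0 <= \prod_(i < n.+1) f (tnth x i))%E by apply: prode_ge0.
apply: (@le_trans _ _ (iterated_integral ell (fun x : n.+1.-tuple E =>
    (expR K)%:E * \prod_(i < n.+1) f (tnth x i))%E)).
  apply: le_iterated_integral_uniq => //.
  - exact: atomless_set1.
  - by apply: measurable_indic_boltzmann => //; [exact: lsc_measurable|exact: lsc_measurable2].
  - exact: measurable_funeM.
  - by move=> x; rewrite mule_ge0 ?lee_fin// boltzmann_ge0.
  - by move=> x; rewrite mule_ge0 ?lee_fin// expR_ge0.
  - move=> x ux; rewrite indicE; case: (boolP (x \in A)) => [/set_mem Ax|_].
      by rewrite mul1e muleC; exact: le.
    by rewrite mul0e mule_ge0 ?lee_fin// expR_ge0.
rewrite iterated_integralZl ?lee_fin ?expR_ge0//.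
rewrite iterated_integral_prod// expRD EFinM muleC.
apply: lee_wpmul2r; first by rewrite lee_fin expR_ge0.
rewrite expRM_natl EFin_expe.
have i0 : (0 <= \int[ell]_x f x)%E by apply: integral_ge0.
by elim: n.+1 => [|k IH]; rewrite ?expe0// !expeS lee_pmul// expe_ge0.
Qed.

Context (D_fin : (\int[ell]_x expeR (- ((1 - a)%:E * V x)) < +oo)%E).

Lemma measurable_confinement :
  measurable_fun setT (fun x => expeR (- ((1 - a)%:E * V x)))%E.
Proof.
apply: (measurableT_comp (@measurable_expeR R)).
under eq_fun do rewrite -mulN1e; apply: measurable_funeM.
by apply: measurable_funeM; exact: lsc_measurable.
Qed.

Lemma confinement_bound :
  exists q : R, 0 <= q /\ (\int[ell]_x expeR (- ((1 - a)%:E * V x)) <= (expR q)%:E)%E.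
Proof.
have i0 : (0 <= \int[ell]_x expeR (- ((1 - a)%:E * V x)))%E.
  by apply: integral_ge0 => x _; exact: expeR_ge0.
exists (fine (\int[ell]_x expeR (- ((1 - a)%:E * V x))%E)); split; first exact: fine_ge0.
rewrite -{1}[X in (X <= _)%E]fineK ?ge0_fin_numE// lee_fin.
by apply: le_trans (expR_ge1Dx _); rewrite lerDr.
Qed.

Lemma finite_rank_le_Xi n (x : n.+1.-tuple E) (h : E * E -> R) (B : R) :
  finite_rank h -> (forall z, (h z)%:E <= g z)%E -> (forall z, h z <= B) ->
  (\int[empirical x \x empirical x]_z (h z)%:E - (B / n.+1%:R)%:E <= Xi V W a c x)%E.
Proof.
move=> [s hs] hg hB.
have -> : (\int[empirical x \x empirical x]_z (h z)%:E =
    ((n.+1%:R ^+ 2)^-1 * \sum_(i < n.+1) \sum_(j < n.+1) h (tnth x i, tnth x j))%:E)%E.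
  under eq_integral do rewrite hs.
  rewrite integral_finite_rank; congr (_)%:E.
  have ie (f : Cb R d) : (\int[empirical x]_y sval f y)%R =
      n.+1%:R^-1 * \sum_(i < n.+1) sval f (tnth x i).
    rewrite /Rintegral integral_empirical//.
    by apply: continuous_measurable_rV; exact: (svalP f).1.
  under eq_bigr do rewrite !ie mulrACA -invfM -expr2.
  rewrite -mulr_sumr; congr (_ * _).
  under [RHS]eq_bigr do under eq_bigr do rewrite hs/=.
  under [RHS]eq_bigr do rewrite exchange_big/=.
  rewrite [RHS]exchange_big/=; apply: eq_bigr => p _.
  by rewrite mulr_suml; apply: eq_bigr => i _; rewrite mulr_sumr.
apply: (@le_trans _ _ ((n.+1%:R ^+ 2)^-1%:E *
    (\sum_(i < n.+1) \sum_(j < n.+1 | i != j) h (tnth x i, tnth x j))%:E)%E).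
  rewrite -EFinN -EFinD -EFinM lee_fin lerBlDr.
  have -> : B / n.+1%:R = (n.+1%:R ^+ 2)^-1 * \sum_(i < n.+1) B.
    rewrite sumr_const card_ord -mulr_natl expr2; field.
    by rewrite addrC natr1 pnatr_eq0.
  rewrite -mulrDr ler_wpM2l ?invr_ge0 ?exprn_ge0// -big_split/=; apply: ler_sum => i _.
  rewrite (bigD1 i)//= addrC; apply: lerD => //.
  by under eq_bigl do rewrite eq_sym.
apply: lee_wpmul2l; first by rewrite lee_fin invr_ge0 exprn_ge0.
rewrite -sumEFin; apply: lee_sum => i _; rewrite -sumEFin; apply: lee_sum => j _.
exact: hg.
Qed.

(** Close to [mu] the off-diagonal double sum of the interaction is bounded
    below by the double integral of a bounded continuous minorant, the diagonal
    contributing only [B / n]. *)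
Lemma local_upper_bound (mu : Prob R d) (r : R) : (r%:E < J V W mu)%E ->
  exists N, [/\ open N, N mu & \forall n \near \oo,
    (gibbs_mass ell V W beta (@empirical R d n @^-1` N) <=
     (expR (- (beta n.+1 * r)))%:E)%E].
Proof.
rewrite (lt_J_pair_energy V_gtNy W_gtNy a0 a1 Vc Wc lV lW) => rJ.
have [t rt tJ] : exists2 t : R, 2 * (r - kappa a c) < t &
    (t%:E < \int[mu \x mu]_z g z)%E.
  have : (0 <= \int[mu \x mu]_z g z)%E.
    by apply: integral_ge0 => z _; exact: pair_energy_ge0.
  move: rJ; case: (\int[mu \x mu]_z g z)%E => [u| |]//.
    rewrite lte_fin => h _; exists ((2 * (r - kappa a c) + u) / 2); first by rewrite midf_lt.
    by rewrite lte_fin midf_lt.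
  by move=> _ _; exists (2 * (r - kappa a c) + 1); rewrite ?ltrDl// ltry.
have [h [fh h0 [B hB] hg th]] := lsc_finite_rank_minorant
  (lsc_pair_energy V_gtNy W_gtNy a0 a1 Vc Wc lV lW) (pair_energy_ge0 a1 Vc Wc) tJ.
have := finite_rank_integral_near fh th; rewrite nbhsE => -[N [oN Nmu] Nh].
exists N; split => //.
have [q [q0 Dq]] := confinement_bound.
pose f n := n.+1%:R / beta n.+1 * (q + (1 - a) * c) - kappa_ a c n.+1%:R -
  (1 - n.+1%:R / beta n.+1) / 2 * (t - B * n.+1%:R^-1).
have fl : f n @[n --> \oo] --> - kappa a c - t / 2.
  rewrite (_ : - kappa a c - t / 2 =
    0 * (q + (1 - a) * c) - kappa a c - (1 - 0) / 2 * (t - B * 0)); last by ring.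
  apply: cvgB; [apply: cvgB|].
  - by apply: cvgM; [exact: ratio_cvg0|exact: cvg_cst].
  - exact: kappa_cvg.
  - apply: cvgM.
      by apply: cvgM; [apply: cvgB; [exact: cvg_cst|exact: ratio_cvg0]|exact: cvg_cst].
    by apply: cvgB; [exact: cvg_cst|apply: cvgM; [exact: cvg_cst|exact: harmonic_cvg0]].
have flr : - kappa a c - t / 2 < - r by lra.
have ratio1 : \forall n \near \oo, n.+1%:R / beta n.+1 < 1.
  exact: (cvgr_lt 0 ratio_cvg0 _ ltr01).
have := exponent_near fl flr; apply: filterS2 ratio1 => n r1.
rewrite -lee_fin; apply: le_trans.
have b0 := beta_gt0 (ltn0Sn n).
have Nb : n.+1%:R <= beta n.+1 by move: r1; rewrite ltr_pdivrMr// mul1r => /ltW.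
rewrite (_ : beta n.+1 * f n = n.+1%:R * q + (n.+1%:R * (1 - a) * c - beta n.+1 *
    (kappa_ a c n.+1%:R + (1 - n.+1%:R / beta n.+1) / 2 * (t - B / n.+1%:R)))); last first.
  rewrite /f; field; rewrite addrC natr1 pnatr_eq0/=; exact: lt0r_neq0.
apply: (le_gibbs_mass_prod _ measurable_confinement) => //.
- by apply: tuple_open_measurable; exact: tuple_open_preimage_empirical.
- by move=> x; exact: expeR_ge0.
move=> x _ Nx; apply: boltzmann_le => //.
apply: le_trans (finite_rank_le_Xi x fh hg hB).
by rewrite EFinB leeD2r// ltW//; exact: Nh.
Qed.

Lemma ge0_integral_empirical2 n (x : n.+1.-tuple E) (f : E * E -> \bar R) :
  measurable_fun setT f -> (forall z, 0 <= f z)%E ->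
  (\int[empirical x \x empirical x]_z f z = ((n.+1%:R ^+ 2)^-1)%:E *
    \sum_(i < n.+1) \sum_(j < n.+1) f (tnth x i, tnth x j))%E.
Proof.
move=> mf f0; rewrite fubini_tonelli1//.
have mF : measurable_fun setT (fubini_F (empirical x) f) by exact: measurable_fun_fubini_tonelli_F.
have F0 y : (0 <= fubini_F (empirical x) f y)%E by apply: integral_ge0.
rewrite ge0_integral_empirical// expr2 invfM EFinM -muleA; congr (_ * _)%E.
rewrite ge0_sume_distrr; last by move=> i _; apply: sume_ge0.
apply: eq_bigr => i _; rewrite /fubini_F ge0_integral_empirical//.
exact: measurableT_comp mf (pair1_measurable _).
Qed.

Lemma Xi_ge0 n (x : n.+1.-tuple E) : (0 <= Xi V W a c x)%E.
Proof.
apply: mule_ge0; first by rewrite lee_fin invr_ge0 exprn_ge0.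
by do 2 apply: sume_ge0 => ? _; exact: pair_energy_ge0.
Qed.

Lemma measurable_offdiagonal : measurable [set z : E * E | z.1 != z.2].
Proof.
apply: open_measurable_rV2.
rewrite (_ : [set _ | _] = (fun z : E * E => `|z.1 - z.2|) @^-1` [set t | 0 < t]).
  apply: open_comp; last exact: open_gt.
  move=> z _; apply: cvg_norm; apply: (@cvgB _ _ _ _ (nbhs_filter z)).
    exact: cvg_fst.
  exact: cvg_snd.
by apply/seteqP; split => z /=; rewrite normr_gt0 subr_eq0.
Qed.

Context (gamma : E -> R) (A : set E) (r_ : nat -> R) (C Gam : R)
  (lgamma : lower_semicontinuous (EFin \o gamma))
  (gamma_growth : forall k : R, exists T : R, forall x, T < enorm x -> k <= gamma x)
  (gamma_ge : forall x, - Gam <= gamma x)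
  (mA : measurable A) (r_cvgy : r_ n @[n --> \oo] --> +oo).
Let A1 n := A `&` eball (r_ n).
Let A2 n := A `\` eball (r_ n).
Context
  (C1i : forall x y, ((gamma x * \1_(~` A) x + gamma y * \1_(~` A) y)%:E <=
     V x + V y + W (x, y) + C%:E)%E)
  (C1ii : forall n (x : n.+1.-tuple E), uniq x ->
     (\int[empirical x]_(y in A1 n.+1) (gamma y)%:E <=
     \int[empirical x \x empirical x]_(z in (A1 n.+1 `*` A1 n.+1) `&`
                          [set z | z.1 != z.2]) (V z.1 + V z.2 + W z) + C%:E)%E)
  (C1iii : forall n, (0 < n)%N -> ((n%:R / beta n)%:E *
     lne (\int[ell]_(x in A2 n)
       expeR ((beta n / n%:R * gamma x)%:E - (1 - a)%:E * V x)) < C%:E)%E).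

Lemma measurable_eball r : measurable (eball r : set E).
Proof.
apply: closed_measurable_rV.
exact: (preimage_closed (fun x _ => @continuous_enorm R d x) (@closed_le R r)).
Qed.

Lemma measurable_gamma : measurable_fun setT gamma.
Proof. by apply/measurable_EFinP; exact: lsc_measurable. Qed.

Lemma pair_energyE' z : (V z.1 + V z.2 + W z = g z + (2 * kappa a c)%:E)%E.
Proof. by rewrite -pair_energyE// addeC addeA. Qed.

(** The double integral in [C1ii] avoids the diagonal, so it is at most [Xi] up
    to a constant. *)
Lemma avg_gamma_A1 n (x : n.+1.-tuple E) : uniq x ->
  ((n.+1%:R^-1 * \sum_(i < n.+1) gamma (tnth x i) * \1_(A1 n.+1) (tnth x i))%:E <=
   Xi V W a c x + (2 * `|kappa a c| + `|C|)%:E)%E.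
Proof.
have mA1 : measurable (A1 n.+1) by apply: measurableI => //; exact: measurable_eball.
move=> ux; have := C1ii ux.
rewrite integral_mkcond.
have -> : (EFin \o gamma) \_ (A1 n.+1) = EFin \o (fun y => gamma y * \1_(A1 n.+1) y).
  apply/funext => y; rewrite /= /patch indicE; by case: ifPn => _; rewrite ?mulr1 ?mulr0.
rewrite integral_empirical; last first.
  by apply: measurable_funM; [exact: measurable_gamma|exact: measurable_indic].
move=> /le_trans; apply.
rewrite [X in (_ <= _ + X)%E]EFinD addeA; apply: leeD; last by rewrite lee_fin ler_norm.
set D := (_ `&` _).
have mD : measurable D.
  by apply: measurableI; [exact: measurableX|exact: measurable_offdiagonal].
have mg : measurable_fun setT g by exact: measurable_pair_energy.
have g0 := pair_energy_ge0 a1 Vc Wc.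
pose gD z := (g z * (\1_D z)%:E)%E.
have mgD : measurable_fun setT gD.
  by apply: emeasurable_funM => //; apply/measurable_EFinP; exact: measurable_indic.
have gD0 z : (0 <= gD z)%E by rewrite mule_ge0// lee_fin.
apply: (@le_trans _ _ (\int[empirical x \x empirical x]_z (gD z + (2 * `|kappa a c|)%:E))%E).
  rewrite integral_mkcond; apply: le_integralT => z.
  rewrite /patch /gD indicE; case: ifPn => _.
    by rewrite mule1 pair_energyE' leeD2l// lee_fin ler_wpM2l// ler_norm.
  by rewrite mule0 add0e lee_fin mulr_ge0.
rewrite ge0_integralD//.
rewrite integral_probability_cst leeD2r//.
rewrite ge0_integral_empirical2//; apply: lee_wpmul2l.
  by rewrite lee_fin invr_ge0 exprn_ge0.
apply: lee_sum => i _; rewrite (bigD1 i)//= {1}/gD.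
rewrite indicE memNset ?mule0 ?add0e; last by move=> -[_]/=; rewrite eqxx.
under [X in (_ <= X)%E]eq_bigl do rewrite eq_sym.
apply: lee_sum => j _; rewrite /gD -[X in (_ <= X)%E]mule1; apply: lee_wpmul2l => //.
by rewrite lee_fin indicE lern1 leq_b1.
Qed.

(** In the sum of [C1i] over all pairs each particle occurs [2 * n] times, which
    compares with the normalization [n.+1 ^ 2] of [Xi] as soon as there are two
    particles. *)
Lemma avg_gamma_notA n (x : n.+1.-tuple E) : (0 < n)%N ->
  ((n.+1%:R^-1 * \sum_(i < n.+1) gamma (tnth x i) * \1_(~` A) (tnth x i))%:E <=
   Xi V W a c x + (`|kappa a c| + `|C|)%:E)%E.
Proof.
move=> n0; set S := \sum_(i < n.+1) _.
have N2 : 2 <= n.+1%:R :> R by rewrite ler_nat.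
have N20 : 0 < (n.+1%:R ^+ 2)^-1 :> R by rewrite invr_gt0 exprn_gt0.
have key : (((n.+1%:R ^+ 2)^-1 * (2 * (n.+1%:R - 1) * S))%:E <=
    Xi V W a c x + ((n.+1%:R ^+ 2)^-1 * (n.+1%:R * (n.+1%:R - 1) * (2 * kappa a c + C)))%:E)%E.
  rewrite EFinM [X in (_ <= _ + X)%E]EFinM /Xi -muleDr ?fin_num_adde_defl//.
  apply: lee_wpmul2l; first by rewrite lee_fin ltW.
  rewrite -sum_pairs_cst -sumEFin; under [X in (_ <= _ + X)%E]eq_bigr do rewrite -sumEFin.
  have -> : 2 * (n.+1%:R - 1) * S = \sum_(i < n.+1) \sum_(j < n.+1 | i != j)
      (gamma (tnth x i) * \1_(~` A) (tnth x i) + gamma (tnth x j) * \1_(~` A) (tnth x j)).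
    under eq_bigr do rewrite big_split/=.
    by rewrite big_split/= sum_pairs_fst sum_pairs_snd -/S; ring.
  rewrite -sumEFin -big_split/=; apply: lee_sum => i _.
  rewrite -sumEFin -big_split/=; apply: lee_sum => j _.
  apply: le_trans (C1i _ _) _.
  by rewrite (pair_energyE' (tnth x i, tnth x j)) EFinD addeA.
have := Xi_ge0 x; move: key; case: (Xi V W a c x) => [X| |]//; last first.
  by move=> _ _; rewrite addye// leey.
rewrite -!EFinD !lee_fin; move: (n.+1%:R) N2 N20 S => N N2 N20 S key X0.
have N0 : 0 < N by lra.
rewrite -(ler_pM2l (_ : 0 < 2 * (N - 1) / N)); last by rewrite divr_gt0//; lra.
have -> : 2 * (N - 1) / N * (N^-1 * S) = (N ^+ 2)^-1 * (2 * (N - 1) * S).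
  by field; exact: lt0r_neq0.
apply: (le_trans key).
have -> : (N ^+ 2)^-1 * (N * (N - 1) * (2 * kappa a c + C)) = (N - 1) / N * (2 * kappa a c + C).
  by field; exact: lt0r_neq0.
have -> : 2 * (N - 1) / N * (X + (`|kappa a c| + `|C|)) =
  2 * ((N - 1) / N) * X + (N - 1) / N * (2 * `|kappa a c| + 2 * `|C|) by ring.
have h : 1 / 2 <= (N - 1) / N by rewrite ler_pdivlMr//; lra.
apply: lerD; first by rewrite -{1}[X]mul1r ler_wpM2r//; lra.
apply: ler_wpM2l; first lra.
have := ler_norm (kappa a c); have := ler_norm C; have := normr_ge0 C; lra.
Qed.

Let G x := gamma x + Gam.

Lemma lsc_shifted_gamma : lower_semicontinuous (EFin \o G).
Proof.
apply: (@lscD R _ (EFin \o gamma) (cst Gam%:E)).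
- by move=> x; exact: ltNyr.
- by move=> x; exact: ltNyr.
- exact: lgamma.
- exact: lsc_cst.
Qed.

Lemma shifted_gamma_ge0 x : 0 <= G x.
Proof. by rewrite /G; have := gamma_ge x; lra. Qed.

Let K := 3 * `|kappa a c| + 2 * `|C|.

(** Outside of [A2] the average of [gamma] is bounded by the interaction, so a
    large average forces a large interaction unless the particles in [A2] account
    for it. *)
Lemma Xi_ge_gamma n (x : n.+1.-tuple E) (M : R) : (0 < n)%N -> uniq x ->
  ~ sublevel G M (empirical x) ->
  (((M - Gam - K - n.+1%:R^-1 * \sum_(i < n.+1)
     gamma (tnth x i) * \1_(A2 n.+1) (tnth x i)) / 2)%:E <= Xi V W a c x)%E.
Proof.
move=> n0 ux; rewrite /sublevel /= integral_empirical; last first.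
  by apply: measurable_funD => //; exact: measurable_gamma.
move=> /negP; rewrite lee_fin -ltNge.
have -> : \sum_(i < n.+1) G (tnth x i) = \sum_(i < n.+1) gamma (tnth x i) + n.+1%:R * Gam.
  by rewrite /G big_split/= sumr_const card_ord mulr_natl.
rewrite mulrDr mulKf ?pnatr_eq0// => h.
have := avg_gamma_notA x n0; have := avg_gamma_A1 ux.
case: (Xi V W a c x) (Xi_ge0 x) => [X| |]//; last by move=> _ _ _; rewrite leey.
move=> _; rewrite -!EFinD !lee_fin => h1 h2.
have hs : \sum_(i < n.+1) gamma (tnth x i) =
    \sum_(i < n.+1) gamma (tnth x i) * \1_(A1 n.+1) (tnth x i) +
    \sum_(i < n.+1) gamma (tnth x i) * \1_(~` A) (tnth x i) +
    \sum_(i < n.+1) gamma (tnth x i) * \1_(A2 n.+1) (tnth x i).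
  rewrite -!big_split/=; apply: eq_bigr => i _; rewrite -!mulrDr !indicE.
  rewrite /A1 /A2 in_setC in_setI in_setD.
  by case: (_ \in A); case: (_ \in eball _); rewrite /= ?addr0 ?add0r mulr1.
move: h h1 h2; rewrite hs 2!mulrDr /K.
set s1 := _^-1 * \sum_(i < n.+1) _ * \1_(A1 _) _; set s2 := _^-1 * \sum_(i < n.+1) _ * \1_(~` A) _.
by set s3 := _^-1 * \sum_(i < n.+1) _ * \1_(A2 _) _; lra.
Qed.

Lemma gamma_A2_ge0 : \forall n \near \oo, forall x, A2 n.+1 x -> 0 <= gamma x.
Proof.
have [T hT] := gamma_growth 0.
have := r_cvgy; rewrite -(cvg_shiftS r_) => /cvgryPge /(_ T).
apply: filterS => n /= Tr x [_ /negP]; rewrite -ltNge => rx; apply: hT.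
exact: le_lt_trans rx.
Qed.

(** By [C1iii] the exponential moment of [gamma] over [A2] is of the order of
    [exp (C * beta n.+1 / n.+1)], the power [n.+1] of which stays at the speed
    [beta]. *)
Lemma confinement_A2 n (q : R) : 0 <= q ->
  (\int[ell]_x expeR (- ((1 - a)%:E * V x)) <= (expR q)%:E)%E ->
  (\int[ell]_x (expeR (- ((1 - a)%:E * V x)) *
     (expR (beta n.+1 / n.+1%:R * (gamma x * \1_(A2 n.+1) x)))%:E) <=
  (expR (q + 1 + beta n.+1 * `|C| / n.+1%:R))%:E)%E.
Proof.
move=> q0 Dq; have b0 := beta_gt0 (ltn0Sn n).
have N0 : 0 < n.+1%:R :> R by [].
have mA2 : measurable (A2 n.+1) by apply: measurableD => //; exact: measurable_eball.
pose I := (\int[ell]_(x in A2 n.+1)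
       expeR ((beta n.+1 / n.+1%:R * gamma x)%:E - (1 - a)%:E * V x))%E.
have I0 : (0 <= I)%E by apply: integral_ge0 => x _; exact: expeR_ge0.
have IC : (I <= (expR (beta n.+1 * `|C| / n.+1%:R))%:E)%E.
  have /eqP <- : expeR (lne I) == I by rewrite lneK_eq.
  have : (lne I <= (beta n.+1 * `|C| / n.+1%:R)%:E)%E.
    have := C1iii (ltn0Sn n); rewrite -/I.
    case: (lne I) => [l| |]; [|by rewrite gt0_muley// lte_fin divr_gt0|by rewrite leNye].
    rewrite -EFinM lte_fin lee_fin mulrAC ltr_pdivrMr// => h.
    rewrite ler_pdivlMr// mulrC (le_trans (ltW h))// mulrC ler_wpM2l ?ler_norm// ltW//.
  by case: (lne I) => [l| |]//=; rewrite ?lee_fin ?ler_expR// expR_ge0.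
have mf1 := measurable_confinement.
have mf2 : measurable_fun setT ((fun x => expeR ((beta n.+1 / n.+1%:R * gamma x)%:E -
    (1 - a)%:E * V x)%E) \_ (A2 n.+1)).
  apply/(measurable_restrictT _ mA2); apply: measurable_funTS.
  apply: (measurableT_comp (@measurable_expeR R)); apply: emeasurable_funB.
    by apply/measurable_EFinP; apply: measurable_funM => //; exact: measurable_gamma.
  by apply: measurable_funeM; exact: lsc_measurable.
apply: (@le_trans _ _ (\int[ell]_x (expeR (- ((1 - a)%:E * V x)) +
   ((fun x => expeR ((beta n.+1 / n.+1%:R * gamma x)%:E -
    (1 - a)%:E * V x)%E) \_ (A2 n.+1)) x))%E).
  apply: le_integralT => x; rewrite /patch indicE; case: ifPn => xA.
    rewrite mulr1 -[(expR _)%:E]/(expeR _%:E) -expeRD addeC leeDr// expeR_ge0//.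
  by rewrite !mulr0 expR0 mule1 adde0.
rewrite ge0_integralD//; last 2 first.
- by move=> x _; exact: expeR_ge0.
- by move=> x _; rewrite /patch; case: ifPn => // _; exact: expeR_ge0.
rewrite -integral_mkcond -/I; apply: (le_trans (leeD Dq IC)).
rewrite -EFinD lee_fin expRD [expR (q + 1)]expRD.
have B0 : 0 <= beta n.+1 * `|C| / n.+1%:R by rewrite divr_ge0// mulr_ge0// ltW.
set u := expR q; set v := expR (_ / _).
have u1 : 1 <= u by rewrite -expR0 ler_expR.
have v1 : 1 <= v by rewrite -expR0 ler_expR.
have e2 : 2 <= expR 1 :> R by have := @expR_ge1Dx R 1; lra.
apply: (@le_trans _ _ (u * 2 * v)); first nra.
by rewrite ler_wpM2r ?ler_wpM2l//; lra.
Qed.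

(** If the average of [gamma] is large, either the particles in [A2] account for
    it, which [confinement_A2] makes unlikely, or the interaction is large by
    [Xi_ge_gamma]. *)
Lemma exponential_tightness (L : R) : exists M, \forall n \near \oo,
  (gibbs_mass ell V W beta (@empirical R d n @^-1` (~` sublevel G M)) <=
     (expR (- (beta n.+1 * L)))%:E)%E.
Proof.
have [q [q0 Dq]] := confinement_bound.
(* The exponent tends to [`|C| - kappa - M' / 4], which this choice makes
   [- L - 1]. *)
pose M' := 4 * (L + `|C| - kappa a c + 1).
exists (M' + Gam + K).
pose f n := n.+1%:R / beta n.+1 * (q + 1 + (1 - a) * c) + `|C| - kappa_ a c n.+1%:R -
  (1 - n.+1%:R / beta n.+1) / 4 * M'.
have fl : f n @[n --> \oo] --> `|C| - kappa a c - M' / 4.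
  rewrite (_ : `|C| - kappa a c - M' / 4 =
    0 * (q + 1 + (1 - a) * c) + `|C| - kappa a c - (1 - 0) / 4 * M'); last by ring.
  apply: cvgB; [apply: cvgB; [apply: cvgD|]|].
  - by apply: cvgM; [exact: ratio_cvg0|exact: cvg_cst].
  - exact: cvg_cst.
  - exact: kappa_cvg.
  - apply: cvgM; last exact: cvg_cst.
    by apply: cvgM; [apply: cvgB; [exact: cvg_cst|exact: ratio_cvg0]|exact: cvg_cst].
have flr : `|C| - kappa a c - M' / 4 < - L by rewrite /M'; lra.
have ratio1 : \forall n \near \oo, n.+1%:R / beta n.+1 < 1.
  exact: (cvgr_lt 0 ratio_cvg0 _ ltr01).
near=> n.
have n0 : (0 < n)%N by near: n; exact: nbhs_infty_gt.
have r1 : n.+1%:R / beta n.+1 < 1 by near: n.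
have gA2 : forall x, A2 n.+1 x -> 0 <= gamma x by near: n; exact: gamma_A2_ge0.
have : expR (beta n.+1 * f n) <= expR (- (beta n.+1 * L)).
  by near: n; exact: exponent_near fl flr.
rewrite -lee_fin; apply: le_trans.
have b0 := beta_gt0 (ltn0Sn n).
have N0 : 0 < n.+1%:R :> R by [].
have Nb : n.+1%:R <= beta n.+1 by move: r1; rewrite ltr_pdivrMr// mul1r => /ltW.
pose K0 := n.+1%:R * (1 - a) * c - beta n.+1 * kappa_ a c n.+1%:R -
  beta n.+1 * ((1 - n.+1%:R / beta n.+1) / 4) * M'.
rewrite (_ : beta n.+1 * f n = n.+1%:R * (q + 1 + beta n.+1 * `|C| / n.+1%:R) + K0); last first.
  by rewrite /f /K0; field; rewrite ?[1 + _]addrC ?natr1 ?pnatr_eq0 ?(lt0r_neq0 b0).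
have mA2 : measurable (A2 n.+1) by apply: measurableD => //; exact: measurable_eball.
have mG : measurable_fun setT (fun x => expR (beta n.+1 / n.+1%:R * (gamma x * \1_(A2 n.+1) x))).
  apply: measurableT_comp => //; apply: measurable_funM => //; apply: measurable_funM => //.
  exact: measurable_gamma.
apply: (le_gibbs_mass_prod _ _ _ (confinement_A2 n q0 Dq)) => //.
- apply: tuple_open_measurable; apply: tuple_open_preimage_empirical.
  rewrite openC; apply: sublevel_closed => [|x]; first exact: lsc_shifted_gamma.
  exact: shifted_gamma_ge0.
- by apply: emeasurable_funM; [exact: measurable_confinement | exact/measurable_EFinP].
- by move=> x; rewrite mule_ge0 ?expeR_ge0// lee_fin expR_ge0.
move=> x ux nx; pose Y := n.+1%:R^-1 * \sum_(i < n.+1)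
     gamma (tnth x i) * \1_(A2 n.+1) (tnth x i).
have Y0 : 0 <= Y.
  rewrite mulr_ge0//; apply: sumr_ge0 => i _; rewrite indicE.
  by case: (boolP (_ \in _)) => [/set_mem/gA2 h|_]; rewrite ?mulr1// mulr0.
have yX := Xi_ge_gamma n0 ux nx.
apply: (le_trans (boltzmann_le V_gtNy W_gtNy a0 a1 Vc Wc Nb yX)).
rewrite big_split/= -muleA; apply: lee_wpmul2l.
  by apply: prode_ge0 => i _; exact: expeR_ge0.
rewrite prodEFin -expR_sum -EFinM -expRD lee_fin ler_expR -mulr_sumr.
have -> : beta n.+1 / n.+1%:R * \sum_(i < n.+1) gamma (tnth x i) * \1_(A2 n.+1) (tnth x i) =
  beta n.+1 * Y by rewrite -mulrA.
rewrite -/Y /K0 (_ : M' + Gam + K - Gam - K = M'); last by ring.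
have h : (1 - n.+1%:R / beta n.+1) / 4 <= 1 by have := divr_ge0 (ltW N0) (ltW b0); lra.
have h' : 0 <= beta n.+1 * ((1 - (1 - n.+1%:R / beta n.+1) / 4) * Y).
  by rewrite mulr_ge0 ?(ltW b0)// mulr_ge0//; lra.
move: h' {h}; move: (n.+1%:R / beta n.+1) => rho h'; lra.
Unshelve. all: by end_near.
Qed.

End upper_bounds.

(** * The lower bound *)

Section product_samples.
Context (R : realType) (d : nat).
Local Notation E := 'rV[R]_d.

Lemma measurable_real_sum_tnth n (h : E -> R) : measurable_fun setT h ->
  measurable_fun setT (fun x : n.-tuple E => \sum_(i < n) h (tnth x i)).
Proof.
move=> mh; apply/measurable_EFinP.
rewrite (_ : _ \o _ = fun x : n.-tuple E => (\sum_(i < n) (h (tnth x i))%:E)%E).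
  by apply: (@measurable_sum_tnth R d n (EFin \o h)); exact/measurable_EFinP.
by apply/funext => x /=; rewrite sumEFin.
Qed.

(** Independent centred variables: the cross terms of the square vanish one
    coordinate at a time. *)
Lemma iterated_integral_sqr_sum (nu : Prob R d) (h : Cb R d) (B : R) n (s : R) :
  (\int[nu]_x sval h x)%R = 0 -> (forall x, `|sval h x| <= B) ->
  (iterated_integral nu (fun x : n.-tuple E =>
     ((s + \sum_(i < n) sval h (tnth x i)) ^+ 2)%:E) <= (s ^+ 2 + n%:R * B ^+ 2)%:E)%E.
Proof.
move=> h0 hB; elim: n s => [|n IH] s.
  by rewrite /= big_ord0 addr0 mul0r addr0.
have hE : (\int[nu]_x (sval h x)%:E = 0)%E.
  have : (\int[nu]_x (sval h x)%:E)%E \is a fin_num.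
    by apply: integrable_fin_num => //; exact: Cb_integrable.
  by move=> /fineK <-; rewrite -/(Rintegral _ _ _) h0.
apply: (@le_trans _ _ (\int[nu]_x ((s ^+ 2 + B ^+ 2 + n%:R * B ^+ 2)%:E +
    (2 * s)%:E * (sval h x)%:E))%E).
  apply: le_integralT => x.
  have -> : (fun y : n.-tuple E =>
      ((s + \sum_(i < n.+1) sval h (tnth [tuple of x :: y] i)) ^+ 2)%:E) =
     (fun y => ((s + sval h x + \sum_(i < n) sval h (tnth y i)) ^+ 2)%:E).
    apply/funext => y; rewrite big_ord_recl addrA; congr ((_ + _) ^+ 2)%:E.
    by apply: eq_bigr => i _; rewrite tnthS.
  apply: (le_trans (IH _)); rewrite -EFinM -EFinD lee_fin.
  have : sval h x ^+ 2 <= B ^+ 2.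
    by rewrite -real_normK ?num_real// lerXn2r// nnegrE// (le_trans _ (hB x)).
  move: (n%:R * _) (sval h x) => w u; lra.
rewrite integralD//; first last.
- by apply: integrableZl => //; exact: Cb_integrable.
- exact: finite_measure_integrable_cst.
rewrite integralZl//; last exact: Cb_integrable.
rewrite hE mule0 adde0 integral_probability_cst lee_fin -[n.+1]addn1 natrD; lra.
Qed.

Lemma measurable_weak_gap (nu : Prob R d) (s : seq (Cb R d)) n :
  measurable_fun setT (fun x : n.+1.-tuple E => (weak_gap s nu (empirical x))%:E).
Proof.
under eq_fun do rewrite /weak_gap -sumEFin.
apply: emeasurable_sum => f; apply/measurable_EFinP; apply: measurable_funX.
apply: measurable_funB => //.
have mf : measurable_fun setT (sval f) by apply: continuous_measurable_rV; exact: (svalP f).1.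
under eq_fun do rewrite /Rintegral integral_empirical//=.
by apply: measurable_funM => //; exact: measurable_real_sum_tnth.
Qed.

Lemma weak_gap_expectation (nu : Prob R d) (s : seq (Cb R d)) :
  exists2 C, 0 <= C & forall n, (iterated_integral nu (fun x : n.+1.-tuple E =>
    (weak_gap s nu (empirical x))%:E) <= (C / n.+1%:R)%:E)%E.
Proof.
elim: s => [|f s [C C0 IH]].
  exists 0 => // n; under [X in iterated_integral _ X]eq_fun do rewrite /weak_gap big_nil.
  by rewrite iterated_integral_cst mul0r.
set m := (\int[nu]_x sval f x)%R.
have hC := is_CbD (svalP f) (@is_Cb_cst R d (- m)).
pose h : Cb R d := exist _ _ hC.
have h0 : (\int[nu]_x sval h x)%R = 0.
  rewrite /h/= RintegralD//; [|exact: Cb_integrable|exact: finite_measure_integrable_cst].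
  by rewrite /Rintegral integral_probability_cst/= -/(Rintegral _ _ _) subrr.
have [B B0 hB] := bounded_fun_ge0 (svalP h).2.
exists (B ^+ 2 + C) => [|n]; first by rewrite addr_ge0// exprn_ge0.
under [X in iterated_integral _ X]eq_fun do rewrite /weak_gap big_cons EFinD.
rewrite iterated_integralD; first last.
- by move=> x; rewrite lee_fin; exact: weak_gap_ge0.
- by move=> x; rewrite lee_fin sqr_ge0.
- exact: measurable_weak_gap.
- have := @measurable_weak_gap nu [:: f] n.
  by under eq_fun do rewrite /weak_gap big_seq1.
rewrite mulrDl EFinD; apply: leeD; last exact: IH.
have -> : (fun x : n.+1.-tuple E => (((\int[empirical x]_y sval f y)%R - m) ^+ 2)%:E) =
   (fun x => ((n.+1%:R ^+ 2)^-1)%:E * ((0 + \sum_(i < n.+1) sval h (tnth x i)) ^+ 2)%:E)%E.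
  apply/funext => x; rewrite -EFinM; congr (_)%:E.
  rewrite add0r -exprVn -exprMn; congr (_ ^+ 2).
  rewrite /Rintegral integral_empirical/=; last first.
    by apply: continuous_measurable_rV; exact: (svalP f).1.
  by rewrite sumrB sumr_const card_ord -(mulr_natl m) mulrBr mulKf ?pnatr_eq0.
rewrite iterated_integralZl; first last.
- by rewrite lee_fin invr_ge0 exprn_ge0.
- by move=> x; rewrite lee_fin sqr_ge0.
- apply/measurable_EFinP; apply: measurable_funX; apply: measurable_funD => //.
  by apply: measurable_real_sum_tnth; apply: continuous_measurable_rV; exact: (svalP h).1.
apply: (@le_trans _ _ (((n.+1%:R ^+ 2)^-1)%:E * (0 ^+ 2 + n.+1%:R * B ^+ 2)%:E)%E).
  by apply: lee_wpmul2l; [rewrite lee_fin invr_ge0 exprn_ge0|exact: iterated_integral_sqr_sum].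
rewrite -EFinM lee_fin expr0n add0r expr2 invfM mulrACA mulVf ?pnatr_eq0// mul1r mulrC.
exact: lexx.
Qed.

End product_samples.

Section lower_bounds.
Context (R : realType) (d : nat).
Local Notation E := 'rV[R]_d.
Context (ell : {sigma_finite_measure set E -> \bar R})
  (V : E -> \bar R) (W : E * E -> \bar R) (beta : nat -> R) (a c : R)
  (V_gtNy : forall x, (-oo < V x)%E) (W_gtNy : forall z, (-oo < W z)%E)
  (a0 : 0 <= a) (a1 : a < 1)
  (Vc : forall x, (c%:E <= V x)%E)
  (Wc : forall z, (c%:E <= W z + a%:E * (V z.1 + V z.2))%E)
  (lV : lower_semicontinuous V) (lW : lower_semicontinuous W)
  (beta_gt0 : forall n, (0 < n)%N -> 0 < beta n)
  (beta_n_cvgy : beta n / n%:R @[n --> \oo] --> +oo).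
Local Notation g := (pair_energy V W a c).

Lemma measurable_V0 : measurable_fun setT (V0 V c).
Proof. by apply: lsc_measurable; exact: lsc_V0. Qed.

Lemma measurable_W0 : measurable_fun setT (W0 V W a c).
Proof. by apply: lsc_measurable2; exact: lsc_W0. Qed.

Lemma integral_pair_energy (nu : probability E R) :
  (\int[nu \x nu]_z g z = \int[nu \x nu]_z W0 V W a c z +
    (1 - a)%:E * (\int[nu]_x V0 V c x + \int[nu]_x V0 V c x))%E.
Proof.
have a1' : 0 <= 1 - a by rewrite subr_ge0 ltW.
have V00 := V0_ge0 Vc; have W00 := W0_ge0 Wc; have mV0 := measurable_V0.
have m1 : measurable_fun setT (fun z : E * E => V0 V c z.1).
  exact: measurableT_comp mV0 measurable_fst.
have m2 : measurable_fun setT (fun z : E * E => V0 V c z.2).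
  exact: measurableT_comp mV0 measurable_snd.
rewrite /pair_energy ge0_integralD//; first last.
- by apply: measurable_funeM; exact: emeasurable_funD.
- by move=> z _; rewrite mule_ge0// adde_ge0.
- exact: measurable_W0.
congr (_ + _)%E; rewrite ge0_integralZl//; first last.
- by move=> z _; rewrite adde_ge0.
- exact: emeasurable_funD.
congr (_ * _)%E; rewrite ge0_integralD// integral_prod_fst//; congr (_ + _)%E.
rewrite fubini_tonelli1//=; under eq_integral do rewrite /fubini_F/=.
exact: integral_probability_cst.
Qed.

Lemma measurable_shifted_energy n :
  measurable_fun setT (@shifted_energy R d V W a c n).
Proof.
apply: emeasurable_funD; apply: measurable_funeM.
  by apply: measurable_sum_tnth; exact: measurable_V0.
by apply: measurable_sum_pairs; exact: measurable_W0.
Qed.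

Lemma shifted_energy_ge0 n (x : n.+1.-tuple E) : (0 <= shifted_energy V W a c x)%E.
Proof.
have a1' : 0 <= 1 - a by rewrite subr_ge0 ltW.
apply: adde_ge0; apply: mule_ge0.
- by rewrite lee_fin divr_ge0// mulr_ge0// addr_ge0// divr_ge0.
- by apply: sume_ge0 => i _; exact: V0_ge0.
- by rewrite lee_fin invr_ge0 exprn_ge0.
- by do 2 apply: sume_ge0 => ? _; exact: W0_ge0.
Qed.

(** The off-diagonal sum has mean [n / n.+1] times a double integral, and the
    external energy enters with a weight larger by [2 * a / n.+1] than in the
    double integral of [pair_energy]. *)
Lemma shifted_energy_expectation (nu : probability E R) n :
  (iterated_integral nu (@shifted_energy R d V W a c n) <=
   (1 + a / (1 - a) / n.+1%:R)%:E * \int[nu \x nu]_z g z)%E.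
Proof.
have a1' : 0 < 1 - a by rewrite subr_gt0.
have V00 := V0_ge0 Vc; have W00 := W0_ge0 Wc.
have mV0 := measurable_V0; have mW0 := measurable_W0.
have N0 : 0 < n.+1%:R :> R by [].
have r1 : 0 < 2 * ((1 - a) + a / n.+1%:R) / n.+1%:R.
  by rewrite divr_gt0// mulr_gt0// ltr_pwDl// divr_ge0.
have r2 : 0 < (n.+1%:R ^+ 2)^-1 :> R by rewrite invr_gt0 exprn_gt0.
have k0 : 0 < 1 + a / (1 - a) / n.+1%:R.
  by rewrite ltr_pwDl// divr_ge0// divr_ge0// ltW.
rewrite integral_pair_energy /shifted_energy iterated_integralD; first last.
- move=> x; rewrite mule_ge0 ?lee_fin ?(ltW r2)//.
  by do 2 apply: sume_ge0 => ? _.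
- by move=> x; rewrite mule_ge0 ?lee_fin ?(ltW r1)// sume_ge0.
- by apply: measurable_funeM; exact: measurable_sum_pairs.
- by apply: measurable_funeM; exact: measurable_sum_tnth.
rewrite iterated_integralZl; first last.
- by rewrite lee_fin ltW.
- by move=> x; rewrite sume_ge0.
- exact: measurable_sum_tnth.
rewrite iterated_integralZl; first last.
- by rewrite lee_fin ltW.
- by move=> x; do 2 apply: sume_ge0 => ? _.
- exact: measurable_sum_pairs.
rewrite iterated_integral_sum; first last.
- by move=> i x.
- by move=> i; exact: measurable_tnth_comp.
under eq_bigr do rewrite iterated_integral_tnth.
have mp (i : 'I_n.+1) : measurable_fun setT
    (fun x : n.+1.-tuple E => \sum_(j < n.+1 | i != j) W0 V W a c (tnth x i, tnth x j))%E.
  under eq_fun do rewrite big_mkcond; apply: emeasurable_sum => j.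
  by case: (i != j) => //; exact: measurable_tnth2_comp.
rewrite iterated_integral_sum//; last by move=> i x; apply: sume_ge0.
have -> : (\sum_(i < n.+1) iterated_integral nu (fun x : n.+1.-tuple E =>
     \sum_(j < n.+1 | i != j) W0 V W a c (tnth x i, tnth x j)) =
   \sum_(i < n.+1) \sum_(j < n.+1 | i != j) \int[nu \x nu]_z W0 V W a c z)%E.
  apply: eq_bigr => i _; rewrite [RHS]big_mkcond.
  under [X in iterated_integral _ X]eq_fun do rewrite big_mkcond.
  rewrite (@iterated_integral_sum R d nu n.+1 _ _ (fun j x =>
    if i != j then W0 V W a c (tnth x i, tnth x j) else 0)%E); first last.
  - by move=> j x; case: (i != j).
  - by move=> j; case: (i != j) => //; exact: measurable_tnth2_comp.
  apply: eq_bigr => j _; case: ifPn => ij; last exact: iterated_integral_cst.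
  exact: iterated_integral_tnth2.
have : (0 <= \int[nu]_x V0 V c x)%E by apply: integral_ge0.
have : (0 <= \int[nu \x nu]_z W0 V W a c z)%E by apply: integral_ge0.
case: (\int[nu \x nu]_z W0 V W a c z)%E => [w| |]//; last first.
  move=> _; case: (\int[nu]_x V0 V c x)%E => [v| |]// v0.
    by rewrite -EFinD -EFinM addye// gt0_muley ?lte_fin// leey.
  by rewrite addye// ?gt0_muley ?lte_fin ?leey// gt0_muley.
case: (\int[nu]_x V0 V c x)%E => [v| |]//; last first.
  by move=> _ _; rewrite addye// gt0_muley ?lte_fin// addey// gt0_muley ?lte_fin// leey.
rewrite !lee_fin => w0 v0.
rewrite sumEFin; under [X in (_ + _ * X)%E]eq_bigr do rewrite sumEFin.
rewrite sumEFin sum_pairs_cst sumr_const card_ord -[v *+ _]mulr_natl.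
move: (n.+1%:R : R) N0 {r1 r2 k0 mp} => N N0.
suff key : 2 * (1 - a + a / N) / N * (N * v) + N ^- 2 * (N * (N - 1) * w) <=
    (1 + a / (1 - a) / N) * (w + (1 - a) * (v + v)).
  by rewrite -lee_fin in key; exact: key.
rewrite -subr_ge0 (_ : _ - _ = (a / (1 - a) + 1) / N * w).
  by rewrite mulr_ge0// divr_ge0 ?addr_ge0 ?divr_ge0// ltW.
by field; rewrite !gt_eqF.
Qed.

(** Under the law of independent samples of [nu] the empirical measure is close
    to [nu] and the energy is close to its mean, by the inequalities of
    Chebyshev and Markov; bounding the density of [nu] transfers this to [ell]
    at a cost that is exponential in [n], hence negligible at the speed
    [beta]. *)
Lemma dominated_lower_bound (nu : Prob R d) (M : {nonneg R}) (G : set (Prob R d))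
    (r : R) : (forall B, measurable B -> nu B <= M%:num%:E * ell B)%E ->
  open G -> G nu -> (J V W nu < r%:E)%E ->
  \forall n \near \oo, ((expR (- (beta n.+1 * r)))%:E <=
    gibbs_mass ell V W beta (@empirical R d n @^-1` G))%E.
Proof.
move=> nuM oG Gnu Jr; set I := (\int[nu \x nu]_z g z)%E.
have I0 : (0 <= I)%E by apply: integral_ge0 => z _; exact: pair_energy_ge0.
have If : I \is a fin_num.
  move: Jr; rewrite (J_pair_energy V_gtNy W_gtNy a0 a1 Vc Wc lV lW) -/I.
  move: I0; case: I => // _; rewrite addye// gt0_muley// lte_fin invr_gt0//.
set i := fine I; have iE : I = i%:E by rewrite fineK.
have i0 : 0 <= i by rewrite -lee_fin -iE.
have ir : i < 2 * (r - kappa a c).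
  move: Jr; rewrite (J_pair_energy V_gtNy W_gtNy a0 a1 Vc Wc lV lW) -/I iE.
  by rewrite -EFinD -EFinM lte_fin => h; lra.
pose t := (i + 2 * (r - kappa a c)) / 2.
have it : i < t by rewrite midf_lt.
have tr : t < 2 * (r - kappa a c) by rewrite midf_lt.
have t0 : 0 < t by exact: le_lt_trans it.
have [s [e [e0 sG]]] := weak_nbhs_gap (open_nbhs_nbhs (conj oG Gnu)).
have [C C0 gapC] := weak_gap_expectation nu s.
pose T n := [set x : n.+1.-tuple E | G (empirical x) /\ (shifted_energy V W a c x <= t%:E)%E].
have mT n : measurable (T n).
  apply: measurableI.
    by apply: tuple_open_measurable; exact: tuple_open_preimage_empirical.
  have := @measurable_shifted_energy n measurableT _ (emeasurable_itv `]-oo, t%:E]).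
  rewrite setTI; congr measurable; apply/seteqP; split => x /=; rewrite in_itv//.
have mind n : measurable_fun setT (fun x => (\1_(T n) x)%:E : \bar R).
  by apply/measurable_EFinP; apply: measurable_indic; exact: mT.
pose p n := 1 - C / e * n.+1%:R^-1 - i / t * (1 + a / (1 - a) * n.+1%:R^-1).
(* Outside of [T n] either the gap is at least [e] or the energy exceeds [t]:
   the inequalities of Chebyshev and Markov bound both events. *)
have pT n : ((p n)%:E <= iterated_integral nu (fun x => (\1_(T n) x)%:E))%E.
  have : (iterated_integral nu (fun _ : n.+1.-tuple E => 1%E) <=
      iterated_integral nu (fun x => (\1_(T n) x)%:E + (e^-1%:E * (weak_gap s nu (empirical x))%:E +
        t^-1%:E * shifted_energy V W a c x)))%E.
    apply: le_iterated_integral => x.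
    have g0 : (0 <= e^-1%:E * (weak_gap s nu (empirical x))%:E)%E.
      by rewrite mule_ge0// lee_fin ?invr_ge0 ?weak_gap_ge0// ltW.
    have X0 : (0 <= t^-1%:E * shifted_energy V W a c x)%E.
      by rewrite mule_ge0 ?shifted_energy_ge0// lee_fin invr_ge0 ltW.
    rewrite indicE; have [|nT] := boolP (x \in T n); first by rewrite leeDl// adde_ge0.
    rewrite add0e; have [Gx|nG] := pselect (G (empirical x)).
      have : (t%:E < shifted_energy V W a c x)%E.
        by rewrite ltNge; apply/negP => h; move/negP: nT; apply; apply/mem_set.
      move=> /ltW tx; apply: (@le_trans _ _ (t^-1%:E * t%:E)%E).
        by rewrite -EFinM mulVf// gt_eqF.
      apply: (@le_trans _ _ (t^-1%:E * shifted_energy V W a c x)%E); last by rewrite leeDr.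
      by apply: lee_wpmul2l => //; rewrite lee_fin invr_ge0 ltW.
    have eg : e <= weak_gap s nu (empirical x).
      by rewrite leNgt; apply/negP => /sG.
    apply: (@le_trans _ _ (e^-1%:E * (weak_gap s nu (empirical x))%:E)%E); last by rewrite leeDl.
    by rewrite -EFinM lee_fin mulrC ler_pdivlMr// mul1r.
  rewrite iterated_integral_cst iterated_integralD//; first last.
  - move=> x; rewrite adde_ge0// mule_ge0 ?lee_fin ?weak_gap_ge0 ?invr_ge0 ?(ltW e0) ?(ltW t0)//.
    exact: shifted_energy_ge0.
  - apply: emeasurable_funD; apply: measurable_funeM; first exact: measurable_weak_gap.
    exact: measurable_shifted_energy.
  rewrite iterated_integralD//; first last.
  - by move=> x; rewrite mule_ge0 ?shifted_energy_ge0// lee_fin invr_ge0 ltW.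
  - by move=> x; rewrite mule_ge0 ?lee_fin ?weak_gap_ge0 ?invr_ge0 ?(ltW e0).
  - by apply: measurable_funeM; exact: measurable_shifted_energy.
  - by apply: measurable_funeM; exact: measurable_weak_gap.
  rewrite iterated_integralZl//; first last.
  - by rewrite lee_fin invr_ge0 ltW.
  - by move=> x; rewrite lee_fin weak_gap_ge0.
  - exact: measurable_weak_gap.
  rewrite iterated_integralZl//; first last.
  - by rewrite lee_fin invr_ge0 ltW.
  - by move=> x; exact: shifted_energy_ge0.
  - exact: measurable_shifted_energy.
  have h1 : (e^-1%:E * iterated_integral nu (fun x : n.+1.-tuple E =>
      (weak_gap s nu (empirical x))%:E) <=
     (C / e * n.+1%:R^-1)%:E)%E.
    apply: (@le_trans _ _ (e^-1%:E * (C / n.+1%:R)%:E)%E).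
      by apply: lee_wpmul2l => //; rewrite lee_fin invr_ge0 ltW.
    by rewrite -EFinM lee_fin mulrCA mulrA.
  have h2 : (t^-1%:E * iterated_integral nu (@shifted_energy R d V W a c n) <=
      (i / t * (1 + a / (1 - a) * n.+1%:R^-1))%:E)%E.
    apply: (@le_trans _ _ (t^-1%:E * ((1 + a / (1 - a) / n.+1%:R)%:E * I))%E).
      apply: lee_wpmul2l; first by rewrite lee_fin invr_ge0 ltW.
      exact: shifted_energy_expectation.
    by rewrite iE -!EFinM lee_fin [_ * i]mulrC mulrA [_ * i]mulrC.
  move=> /le_trans /(_ (leeD2l _ (leeD h1 h2))); rewrite -EFinD -leeBlDr//.
  by rewrite -EFinB /p opprD addrA.
(* [expR k] bounds the density, and [expR q] the mass of [T n] from below. *)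
pose k := Num.max 0 (ln M%:num).
have Mk : M%:num <= expR k.
  have [M0|M0] := leP M%:num 0; first exact: le_trans M0 (expR_ge0 _).
  by rewrite -[leLHS](lnK M0) ler_expR le_max lexx orbT.
have it1 : i / t < 1 by rewrite ltr_pdivrMr// mul1r.
pose q := ln ((1 - i / t) / 2).
have qE : expR q = (1 - i / t) / 2 by rewrite lnK// posrE divr_gt0// subr_gt0.
have pq : \forall n \near \oo, expR q <= p n.
  have : p n @[n --> \oo] --> 1 - C / e * 0 - i / t * (1 + a / (1 - a) * 0).
    apply: cvgB; [apply: cvgB; first exact: cvg_cst|].
      by apply: cvgM; [exact: cvg_cst|exact: harmonic_cvg0].
    apply: cvgM; first exact: cvg_cst.
    apply: cvgD; first exact: cvg_cst.
    by apply: cvgM; [exact: cvg_cst|exact: harmonic_cvg0].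
  rewrite !mulr0 subr0 addr0 mulr1 => pl; rewrite qE.
  by apply: (cvgr_ge _ pl); lra.
pose f n := q * (n.+1%:R / beta n.+1) * n.+1%:R^-1 - n.+1%:R / beta n.+1 * k -
  (t / 2 + kappa_ a c n.+1%:R).
have rf : \forall n \near \oo, - r < f n.
  have : f n @[n --> \oo] --> q * 0 * 0 - 0 * k - (t / 2 + kappa a c).
    have ratio := ratio_cvg0 beta_gt0 beta_n_cvgy.
    apply: cvgB; [apply: cvgB|].
    - apply: cvgM; last exact: harmonic_cvg0.
      by apply: cvgM; [exact: cvg_cst|exact: ratio].
    - by apply: cvgM; [exact: ratio|exact: cvg_cst].
    - by apply: cvgD; [exact: cvg_cst|exact: kappa_cvg].
  move=> fl; apply: (cvgr_gt _ fl); lra.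
apply: filterS2 pq rf => n pqn rfn.
have b0 := beta_gt0 (ltn0Sn n).
set u := iterated_integral ell (fun x => (\1_(T n) x)%:E).
have u0 : (0 <= u)%E by apply: iterated_integral_ge0 => x; rewrite lee_fin.
have qu : ((expR (q - n.+1%:R * k))%:E <= u)%E.
  have : ((expR q)%:E <= (expR (n.+1%:R * k))%:E * u)%E.
    apply: (@le_trans _ _ (p n)%:E); first by rewrite lee_fin.
    apply: (le_trans (pT n)); apply: (le_trans (le_measure_iterated_integral nuM _ _)) => //.
    apply: lee_wpmul2r => //; rewrite lee_fin expRM_natl lerXn2r// nnegrE//.
  move=> h; rewrite expRD expRN mulrC EFinM.
  apply: (@le_trans _ _ ((expR (n.+1%:R * k))^-1%:E * ((expR (n.+1%:R * k))%:E * u))%E).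
    by apply: lee_wpmul2l => //; rewrite lee_fin invr_ge0 expR_ge0.
  by rewrite muleA -EFinM mulVf ?mul1e// gt_eqF// expR_gt0.
apply: (@le_trans _ _ ((expR (- (beta n.+1 * (t / 2 + kappa_ a c n.+1%:R))))%:E * u)%E).
  apply: (@le_trans _ _ ((expR (- (beta n.+1 * (t / 2 + kappa_ a c n.+1%:R))))%:E *
     (expR (q - n.+1%:R * k))%:E)%E); last by apply: lee_wpmul2l => //; rewrite lee_fin expR_ge0.
  rewrite -EFinM lee_fin -expRD ler_expR.
  rewrite (_ : - _ + _ = beta n.+1 * f n).
    by rewrite -mulrN ler_wpM2l// ltW.
  rewrite /f; move: (kappa_ a c _) => K.
  by field; rewrite ?[1 + _]addrC ?natr1 ?pnatr_eq0 ?(lt0r_neq0 b0).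
rewrite /u -iterated_integralZl//.
apply: le_iterated_integral => x; rewrite muleC.
rewrite [X in ((X%:E * _) <= _)%E]indicE; case: (boolP (x \in T n)) => [/set_mem[Gx tx]|_].
  rewrite indicE mem_set// !mul1e; apply: boltzmann_ge => //; exact: ltW.
by rewrite mul0e mule_ge0 ?lee_fin// boltzmann_ge0.
Qed.

(** Conditioning on the sets where the density of [mu] is bounded gives
    measures dominated by [ell] which converge to [mu], and the energies of
    which are asymptotically at most that of [mu]. *)
Lemma dominated_approximation (mu : Prob R d) (G : set (Prob R d)) (r : R) :
  mu `<< ell -> open G -> G mu -> (J V W mu < r%:E)%E ->
  exists (nu : Prob R d) (M : {nonneg R}),
    [/\ forall B, measurable B -> (nu B <= M%:num%:E * ell B)%E, G nu &
      (J V W nu < r%:E)%E].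
Proof.
move=> mul oG Gmu Jr.
have [rho [rho0 rhof irho rhoE]] := radon_nikodym_sigma_finite mul.
pose D k := [set x | (rho x <= k%:R%:E)%E].
have mrho : measurable_fun setT rho by exact: measurable_int irho.
have mD k : measurable (D k).
  have := mrho measurableT _ (emeasurable_itv `]-oo, k%:R%:E]).
  rewrite setTI; congr measurable; apply/seteqP; split => x /=; rewrite in_itv//.
have DT : \bigcup_k D k = setT.
  apply/seteqP; split => // x _; exists (Num.truncn (fine (rho x))).+1 => //=.
  by rewrite /D/= -(fineK (rhof x)) lee_fin ltW// truncnS_gt.
have muD : (mu (D k)) @[k --> \oo] --> 1%E.
  rewrite -(@probability_setT _ _ _ mu) -DT; apply: nondecreasing_cvg_mu => //.
  - by rewrite DT.
  - move=> k l kl; apply/subsetPset => x; rewrite /D /= => /le_trans; apply.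
    by rewrite lee_fin ler_nat.
pose p k := fine (mu (D k)).
have pE k : (p k)%:E = mu (D k) by exact: probE.
have p0 k : 0 <= p k by rewrite fine_ge0.
have p1 k : p k <= 1 by rewrite -lee_fin pE; exact: probability_le1.
have pcvg : p k @[k --> \oo] --> (1 : R) by apply: fine_cvg.
have pinv k : 0 <= (p k)^-1 by rewrite invr_ge0.
pose nuk k : {measure set E -> \bar R} := mscale (NngNum (pinv k)) (mrestr mu (mD k)).
have nukE k B : nuk k B = ((p k)^-1%:E * mu (B `&` D k))%E by [].
have : exists nu_ : nat -> Prob R d, forall k, 0 < p k -> forall B, nu_ k B = nuk k B.
  suff : forall k, exists nu : Prob R d, 0 < p k -> forall B, nu B = nuk k B.
    by move=> /choice[nu_ h]; exists nu_.
  move=> k; have [pk|pk] := pselect (0 < p k); last by exists mu.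
  have nuT : nuk k setT = 1%E.
    by rewrite nukE setTI -pE -EFinM mulVf// gt_eqF.
  pose nu : probability E R := HB.pack (Measure.sort (nuk k))
    (Measure_isProbability.Build _ E R (nuk k) nuT).
  by exists nu.
move=> [nu_ nuE].
have pos : \forall k \near \oo, 0 < p k by exact: (cvgr_gt _ pcvg).
have cvg_nu : nu_ k @[k --> \oo] --> mu.
  apply: portmanteau => U oU e e0.
  have mU := open_measurable_rV oU.
  have pe : \forall k \near \oo, 1 - e < p k by apply: (cvgr_gt _ pcvg); rewrite ltrBlDr ltrDl.
  apply: filterS2 pos pe => k pk pek /=.
  rewrite nuE// nukE.
  have : (mu U <= mu (U `&` D k) + (1 - p k)%:E)%E.
    have -> : (1 - p k)%:E = mu (~` D k).
      by rewrite probability_setC// EFinB pE.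
    apply: (@le_trans _ _ (mu ((U `&` D k) `|` ~` D k))).
      apply: le_measure; rewrite ?inE//.
        by apply: measurableU; [exact: measurableI|exact: measurableC].
      by move=> x Ux; have [Dx|nDx] := pselect (D k x); [left|right].
    by apply: measureU2; [exact: measurableI|exact: measurableC].
  move=> /le_trans; apply; apply: leeD; last by rewrite lee_fin lerBlDr addrC -lerBlDr ltW.
  rewrite -[leLHS]mul1e; apply: lee_wpmul2r => //.
  by rewrite lee_fin invf_ge1.
have g0 := pair_energy_ge0 a1 Vc Wc.
have mg := measurable_pair_energy V_gtNy W_gtNy a0 a1 Vc Wc lV lW.
have int_nu k : 0 < p k -> (\int[nu_ k \x nu_ k]_z g z <=
    ((p k)^-1 ^+ 2)%:E * \int[mu \x mu]_z g z)%E.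
  move=> pk.
  have le_nu f : measurable_fun setT f -> (forall x, 0 <= f x)%E ->
      (\int[nu_ k]_x f x <= (p k)^-1%:E * \int[mu]_x f x)%E.
    move=> mf f0; rewrite -(@ge0_integral_mscale _ _ _ mu setT measurableT (NngNum (pinv k)))//.
    apply: le_measure_ge0_integral => // B mB.
    rewrite [leLHS](nuE _ pk B) nukE; apply: lee_wpmul2l; first by rewrite lee_fin.
    by apply: le_measure; rewrite ?inE//; exact: measurableI.
  rewrite fubini_tonelli1// fubini_tonelli1//.
  have mF (m : probability E R) : measurable_fun setT (fubini_F m g).
    exact: measurable_fun_fubini_tonelli_F.
  have F0 (m : probability E R) x : (0 <= fubini_F m g x)%E by apply: integral_ge0.
  apply: (le_trans (le_nu _ (mF _) (F0 _))).
  rewrite expr2 EFinM -muleA; apply: lee_wpmul2l; first by rewrite lee_fin.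
  have <- : (\int[mu]_x ((p k)^-1%:E * fubini_F mu g x) =
      (p k)^-1%:E * \int[mu]_x fubini_F mu g x)%E by rewrite ge0_integralZl// lee_fin.
  apply: (@le_integralT _ _ _ mu) => x.
  by apply: le_nu => //; exact: measurableT_comp mg (pair1_measurable _).
have near_G : \forall k \near \oo, G (nu_ k).
  by apply: cvg_nu; exact: open_nbhs_nbhs.
set I := (\int[mu \x mu]_z g z)%E.
have I0 : (0 <= I)%E by apply: integral_ge0.
have Jmu : J V W mu = (2^-1%:E * (I + (2 * kappa a c)%:E))%E.
  exact: J_pair_energy.
have If : I \is a fin_num.
  move: Jr; rewrite Jmu; move: I0; case: (I) => // _.
  by rewrite addye// gt0_muley// lte_fin invr_gt0.
have near_J : \forall k \near \oo, 2^-1 * ((p k)^-1 ^+ 2 * fine I + 2 * kappa a c) < r.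
  have : 2^-1 * ((p k)^-1 ^+ 2 * fine I + 2 * kappa a c) @[k --> \oo] -->
      2^-1 * (1^-1 ^+ 2 * fine I + 2 * kappa a c).
    apply: cvgM; first exact: cvg_cst.
    apply: cvgD; last exact: cvg_cst.
    apply: cvgM; last exact: cvg_cst.
    by rewrite expr2; under eq_fun do rewrite expr2; apply: cvgM; apply: cvgV.
  move=> h; apply: (cvgr_lt _ h).
  by rewrite invr1 expr1n mul1r -lte_fin EFinM EFinD fineK// -Jmu.
near \oo => k.
have pk : 0 < p k by near: k.
exists (nu_ k), (NngNum (mulr_ge0 (pinv k) (ler0n R k))); split.
- move=> B mB; rewrite nuE// nukE /= EFinM -muleA; apply: lee_wpmul2l; first by rewrite lee_fin.
  rewrite rhoE; last exact: measurableI.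
  apply: (@le_trans _ _ (\int[ell]_(x in B `&` D k) (k%:R%:E))%E).
    apply: ge0_le_integral => //; first exact: measurableI.
    - exact: measurable_funTS.
    - by move=> x [].
  rewrite integral_cst//; last exact: measurableI.
  apply: lee_wpmul2l; first by rewrite lee_fin.
  by apply: le_measure; rewrite ?inE//; exact: measurableI.
- by near: k.
- rewrite (J_pair_energy V_gtNy W_gtNy a0 a1 Vc Wc lV lW).
  have : 2^-1 * ((p k)^-1 ^+ 2 * fine I + 2 * kappa a c) < r by near: k.
  rewrite -lte_fin; apply: le_lt_trans; rewrite [leRHS]EFinM; apply: lee_wpmul2l.
    by rewrite lee_fin invr_ge0.
  rewrite EFinD; apply: leeD2r; rewrite EFinM fineK//; exact: int_nu.
Unshelve. all: by end_near.
Qed.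

Context (C2 : assumptionC2 ell V W).

(** [C2] reduces to absolutely continuous measures, and truncating their densities
    to measures dominated by [ell]. *)
Lemma gibbs_lower_bound (mu : Prob R d) (G : set (Prob R d)) (r : R) :
  open G -> G mu -> (J V W mu < r%:E)%E ->
  \forall n \near \oo, ((expR (- (beta n.+1 * r)))%:E <=
    gibbs_mass ell V W beta (@empirical R d n @^-1` G))%E.
Proof.
move=> oG Gmu Jr.
have [mu_ [mul mu_cvg Jcvg]] := C2 (lt_trans Jr (ltry r)).
have nG : \forall k \near \oo, G (mu_ k) by apply: mu_cvg; exact: open_nbhs_nbhs.
have nJ : \forall k \near \oo, (J V W (mu_ k) < r%:E)%E.
  have /Jcvg : nbhs (J V W mu) [set y | (y < r%:E)%E].
    by apply: open_nbhs_nbhs; split => //; exact: open_ereal_lt_ereal.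
  by [].
have [k [Gk Jk]] := filter_ex (filterI nG nJ).
have [nu [M [nuM Gnu Jnu]]] := dominated_approximation (mul k) oG Gk Jk.
exact: dominated_lower_bound nuM oG Gnu Jnu.
Qed.

End lower_bounds.

(** * A measure of finite energy *)

Section finite_infimum.
Context (R : realType) (d : nat).
Local Notation E := 'rV[R]_d.
Context (ell : {sigma_finite_measure set E -> \bar R})
  (V : E -> \bar R) (W : E * E -> \bar R) (a c : R)
  (V_gtNy : forall x, (-oo < V x)%E) (W_gtNy : forall z, (-oo < W z)%E)
  (a0 : 0 <= a) (a1 : a < 1)
  (Vc : forall x, (c%:E <= V x)%E)
  (Wc : forall z, (c%:E <= W z + a%:E * (V z.1 + V z.2))%E)
  (lV : lower_semicontinuous V) (lW : lower_semicontinuous W)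
  (D_fin : (\int[ell]_x expeR (- ((1 - a)%:E * V x)) < +oo)%E).
Local Notation g := (pair_energy V W a c).

Lemma exists_finite_subset (A : set E) : measurable A -> (0 < ell A)%E ->
  exists B, [/\ measurable B, B `<=` A, (0 < ell B)%E & (ell B < +oo)%E].
Proof.
move=> mA A0; have [F TF /all_and2[mF Foo]] := sigma_finiteT ell.
have [[i Fi]|nF] := pselect (exists i, (0 < ell (A `&` F i))%E).
  exists (A `&` F i); split => //; first exact: measurableI.
  by apply: le_lt_trans (Foo i); apply: le_measure; rewrite ?inE//; exact: measurableI.
have : (ell A <= \sum_(i <oo) ell (A `&` F i))%E.
  apply: measure_sigma_subadditive => //; first by move=> i; exact: measurableI.
  by rewrite -setI_bigcupr -TF setIT.
rewrite eseries0 => [h|i _ _]; first by move: (lt_le_trans A0 h); rewrite ltxx.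
by apply/eqP; rewrite -measure_le0 leNgt; apply/negP => h; apply: nF; exists i.
Qed.

Lemma integral_mrestr_le (A : set E) (mA : measurable A) (f : E -> \bar R) :
  measurable_fun setT f -> (forall x, 0 <= f x)%E ->
  (\int[mrestr ell mA]_x f x <= \int[ell]_x (f \_ A) x)%E.
Proof.
move=> mf f0.
rewrite (@ge0_negligible_integral _ _ _ (mrestr ell mA) setT (~` A))//; first last.
- by change (ell (~` A `&` A) = 0%E); rewrite setICl measure0.
- exact: measurableC.
rewrite setTD setCK integral_mkcond.
apply: le_measure_ge0_integral => [B mB|x].
  by apply: le_measure; rewrite ?inE//; exact: measurableI.
by rewrite /patch; case: ifPn.
Qed.

(** The negative part of [V z.1 + V z.2 + W z] lives on the square of a sublevel
    set of [V], and [ell] is finite on such sets because [exp (- (1 - a) V)] is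
    integrable. *)
Lemma negative_energy_bounded (z : E * E) : (V z.1 + V z.2 + W z < 0)%E ->
  (V z.1 <= (- c / (1 - a) - c)%:E)%E /\ (V z.2 <= (- c / (1 - a) - c)%:E)%E.
Proof.
move: (V_gtNy z.1) (V_gtNy z.2) (W_gtNy z) (Vc z.1) (Vc z.2) (Wc z).
case: (V z.1) => [v1| |]//; case: (V z.2) => [v2| |]//; case: (W z) => [w| |]//.
move=> _ _ _; rewrite !lee_fin => h1 h2 h3 h4.
have {}h3 : c <= w + a * (v1 + v2) by rewrite -lee_fin; exact: h3.
have {}h4 : v1 + v2 + w < 0 by rewrite -lte_fin; exact: h4.
have a1' : 0 < 1 - a by rewrite subr_gt0.
have h : v1 + v2 <= - c / (1 - a) by rewrite ler_pdivlMr//; lra.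
by split; lra.
Qed.

(** The uniform distribution on a subset of [A] of finite measure has finite
    energy: the negative part of [V z.1 + V z.2 + W z] being integrable, so is
    its positive part on [A `*` A]. *)
Lemma finite_energy_measure (A : set E) : measurable A -> (0 < ell A)%E ->
  (\int[ell \x ell]_(z in A `*` A) (V z.1 + V z.2 + W z) < +oo)%E ->
  exists nu : Prob R d, (J V W nu < +oo)%E.
Proof.
move=> mA A0 Aoo.
have a1' : 0 < 1 - a by rewrite subr_gt0.
have mV := lsc_measurable lV; have mW := lsc_measurable2 lW.
pose k := `|2 * kappa a c|.
have k0 : 0 <= k by exact: normr_ge0.
have kI S (z : E * E) : (0 <= k%:E * (\1_S z)%:E)%E by rewrite -EFinM lee_fin mulr_ge0.
have g0 := pair_energy_ge0 a1 Vc Wc.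
have mg := measurable_pair_energy V_gtNy W_gtNy a0 a1 Vc Wc lV lW.
have vE z : (V z.1 + V z.2 + W z = g z + (2 * kappa a c)%:E)%E by exact: pair_energyE'.
pose v z := (V z.1 + V z.2 + W z)%E.
have mAA : measurable (A `*` A) by exact: measurableX.
have mv : measurable_fun setT v.
  apply: emeasurable_funD => //; apply: emeasurable_funD.
    exact: measurableT_comp mV measurable_fst.
  exact: measurableT_comp mV measurable_snd.
(* The level of [negative_energy_bounded]. *)
pose K := - c / (1 - a) - c.
pose B := [set x | (V x <= K%:E)%E].
have mB : measurable B.
  have := mV measurableT _ (emeasurable_itv `]-oo, K%:E]).
  rewrite setTI; congr measurable; apply/seteqP; split => x /=; rewrite in_itv//.
have ellB : (ell B < +oo)%E.
  apply: (@le_lt_trans _ _ (\int[ell]_x ((expR ((1 - a) * K))%:E *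
      expeR (- ((1 - a)%:E * V x))))%E).
    rewrite -[X in ell X]setIT -(integral_indic ell measurableT mB).
    apply: le_integralT => x; rewrite indicE; have [|_] := boolP (x \in B); last first.
      by rewrite mule_ge0 ?expeR_ge0// lee_fin expR_ge0.
    move=> /set_mem; rewrite /B /=; move: (V_gtNy x); case: (V x) => [y| |]// _.
    rewrite lee_fin => yK.
    suff h : 1 <= expR ((1 - a) * K) * expR (- ((1 - a) * y)) by rewrite -lee_fin in h; exact: h.
    by rewrite -expRD -[leLHS]expR0 ler_expR subr_ge0 ler_wpM2l// ltW.
  have mD := measurable_confinement a lV.
  rewrite ge0_integralZl// ?lee_fin ?expR_ge0//; last by move=> x _; exact: expeR_ge0.
  rewrite lte_mul_pinfty ?lee_fin ?expR_ge0//.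
have kint S : measurable S -> (\int[ell \x ell]_z (k%:E * (\1_S z)%:E) =
    k%:E * (ell \x ell) S)%E.
  move=> mS; have mi : measurable_fun setT (fun z => (\1_S z)%:E : \bar R).
    by apply/measurable_EFinP; exact: measurable_indic.
  by rewrite ge0_integralZl// integral_indic// setIT.
have mvA : measurable_fun setT (v \_ (A `*` A)).
  by apply/(measurable_restrictT _ mAA); exact: measurable_funTS.
have neg : (\int[ell \x ell]_z ((v \_ (A `*` A))^\- z) < +oo)%E.
  apply: (@le_lt_trans _ _ (\int[ell \x ell]_z (k%:E * (\1_(B `*` B) z)%:E))%E).
    apply: le_integralT => z; rewrite funenegE ge_max; apply/andP; split; last first.
      exact: kI.
    rewrite /patch; case: ifPn => _; last by rewrite oppe0.
    have [vz|vz] := ltP (v z) 0%E; last first.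
      by rewrite (@le_trans _ _ 0%E)// oppe_le0.
    have [V1 V2] := negative_energy_bounded vz.
    rewrite indicE mem_set// mule1 leeNl /v vE.
    apply: (@le_trans _ _ (2 * kappa a c)%:E); last by rewrite leeDr.
    by rewrite -EFinN lee_fin lerNl /k -normrN ler_norm.
  rewrite kint; last exact: measurableX.
  rewrite product_measure1E//.
  by rewrite lte_mul_pinfty ?lee_fin// lte_mul_pinfty// ge0_fin_numE.
have pos : (\int[ell \x ell]_z ((v \_ (A `*` A))^\+ z) < +oo)%E.
  move: Aoo; rewrite integral_mkcond integralE -/v.
  have : (0 <= \int[ell \x ell]_z ((v \_ (A `*` A))^\- z))%E by apply: integral_ge0.
  move: neg; case: (\int[_]_z ((v \_ (A `*` A))^\- z))%E => [q| |]// _ _.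
  have h (P : \bar R) : (P - q%:E < +oo -> P < +oo)%E by case: P => // x _; rewrite ltry.
  exact: h.
have [A' [mA' A'A A'0 A'oo]] := exists_finite_subset mA A0.
have gA : (\int[ell \x ell]_z (g \_ (A' `*` A')) z < +oo)%E.
  apply: (@le_lt_trans _ _ (\int[ell \x ell]_z ((v \_ (A `*` A))^\+ z +
     k%:E * (\1_(A' `*` A') z)%:E))%E).
    apply: le_integralT => z; rewrite /patch; case: ifPn => [zA|_]; last first.
      by rewrite adde_ge0.
    have /set_mem[z1 z2] := zA.
    rewrite indicE zA mule1 funeposE /patch mem_set; last by split; exact: A'A.
    apply: (@le_trans _ _ (v z + k%:E)%E); last by rewrite leeD2r// le_max lexx.
    rewrite /v vE -addeA -EFinD leeDl// lee_fin /k -lerBlDl sub0r -normrN ler_norm//.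
  have mA2 : measurable (A' `*` A') by exact: measurableX.
  have mi : measurable_fun setT (fun z : E * E => k%:E * (\1_(A' `*` A') z)%:E)%E.
    by apply: measurable_funeM; apply/measurable_EFinP; exact: measurable_indic.
  have mp : measurable_fun setT (v \_ (A `*` A))^\+%E by exact: measurable_funepos.
  rewrite ge0_integralD//.
  rewrite lte_add_pinfty// kint; last exact: measurableX.
  rewrite product_measure1E//.
  by rewrite lte_mul_pinfty ?lee_fin// lte_mul_pinfty// ge0_fin_numE.
have A'f : ell A' \is a fin_num by rewrite ge0_fin_numE.
have p0 : 0 < fine (ell A') by rewrite fine_gt0// A'0.
have p0' : 0 <= (fine (ell A'))^-1 by rewrite invr_ge0 ltW.
(* [ell] conditioned on [A']. *)
pose nu0 : {measure set E -> \bar R} := mscale (NngNum p0') (mrestr ell mA').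
have nuT : nu0 setT = 1%E.
  rewrite /nu0/= /mscale/= /mrestr setTI -(fineK A'f) -EFinM mulVf// gt_eqF//.
pose nu : probability E R := HB.pack (Measure.sort nu0)
  (Measure_isProbability.Build _ E R nu0 nuT).
exists nu.
have le_nu f : measurable_fun setT f -> (forall x, 0 <= f x)%E ->
    (\int[nu]_x f x <= (fine (ell A'))^-1%:E * \int[ell]_x (f \_ A') x)%E.
  move=> mf f0; rewrite (_ : \int[nu]_x f x = \int[nu0]_x f x)%E//.
  rewrite ge0_integral_mscale//; apply: lee_wpmul2l; first by rewrite lee_fin.
  exact: integral_mrestr_le.
have mF : measurable_fun setT (fubini_F nu g) by exact: measurable_fun_fubini_tonelli_F.
have F0 x : (0 <= fubini_F nu g x)%E by apply: integral_ge0.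
have mgA : measurable_fun setT (g \_ (A' `*` A')).
  by apply/(measurable_restrictT _ (measurableX mA' mA')); exact: measurable_funTS.
have gA0 z : (0 <= (g \_ (A' `*` A')) z)%E by rewrite /patch; case: ifPn.
have I_fin : (\int[nu \x nu]_z g z < +oo)%E.
  rewrite fubini_tonelli1//; apply: (le_lt_trans (le_nu _ mF F0)).
  apply: (@le_lt_trans _ _ ((fine (ell A'))^-1%:E * \int[ell]_x
     ((fine (ell A'))^-1%:E * fubini_F ell (g \_ (A' `*` A')) x))%E).
    apply: lee_wpmul2l; first by rewrite lee_fin.
    apply: le_integralT => x; rewrite {1}/patch; case: ifPn => xA; last first.
      by rewrite mule_ge0// ?lee_fin//; apply: integral_ge0.
    apply: (le_trans (le_nu _ _ _)) => //.
      exact: measurableT_comp mg (pair1_measurable _).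
    apply: lee_wpmul2l; first by rewrite lee_fin.
    apply: le_integralT => y; rewrite /patch; case: ifPn => yA; last by case: ifPn.
    rewrite mem_set//; split => /=; exact: set_mem.
  have mFA : measurable_fun setT (fubini_F ell (g \_ (A' `*` A'))).
    exact: measurable_fun_fubini_tonelli_F.
  rewrite ge0_integralZl//; last by move=> x _; apply: integral_ge0.
  rewrite -fubini_tonelli1//.
  by rewrite !lte_mul_pinfty ?lee_fin//.
rewrite (J_pair_energy V_gtNy W_gtNy a0 a1 Vc Wc lV lW).
by rewrite lte_mul_pinfty ?lee_fin ?invr_ge0// lte_add_pinfty// ltry.
Qed.

End finite_infimum.

(** * The two large deviation principles *)

Section gibbs_LDP.
Local Open Scope ereal_scope.
Context (R : realType) (d : nat).
Local Notation E := 'rV[R]_d.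
Context (ell : {sigma_finite_measure set E -> \bar R})
  (V : E -> \bar R) (W : E * E -> \bar R) (beta : nat -> R) (a c : R)
  (V_gtNy : forall x, -oo < V x) (W_gtNy : forall z, -oo < W z)
  (a0 : (0 <= a)%R) (a1 : (a < 1)%R)
  (Vc : forall x, c%:E <= V x)
  (Wc : forall z, c%:E <= W z + a%:E * (V z.1 + V z.2))
  (lV : lower_semicontinuous V) (lW : lower_semicontinuous W)
  (ell_atomless : atomless ell)
  (beta_gt0 : forall n, (0 < n)%N -> (0 < beta n)%R)
  (beta_n_cvgy : (beta n / n%:R)%R @[n --> \oo] --> +oo%R)
  (D_fin : \int[ell]_x expeR (- ((1 - a)%:E * V x)) < +oo)
  (J_fin : exists nu : Prob R d, J V W nu < +oo)
  (C2 : assumptionC2 ell V W).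
Context (G : E -> R) (lG : lower_semicontinuous (EFin \o G))
  (G0 : forall x, (0 <= G x)%R) (G_coercive : coercive G)
  (G_tight : forall L : R, exists M, \forall n \near \oo,
    gibbs_mass ell V W beta (@empirical R d n @^-1` (~` sublevel G M)) <=
    (expR (- (beta n.+1 * L)))%:E).

Let alpha n := beta n.+1.

Definition empirical_mass n (F : set (Prob R d)) : \bar R :=
  gibbs_mass ell V W beta (@empirical R d n @^-1` F).

Lemma alpha_gt0 n : (0 < alpha n)%R.
Proof. exact: beta_gt0. Qed.

Lemma alpha_cvg : alpha n @[n --> \oo] --> +oo%R.
Proof. exact: speed_cvgy. Qed.

Lemma empirical_mass_ge0 n F : 0 <= empirical_mass n F.
Proof. exact: gibbs_mass_ge0. Qed.

Lemma le_empirical_mass n F F' : F `<=` F' -> empirical_mass n F <= empirical_mass n F'.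
Proof. by move=> FF'; apply: le_gibbs_mass => x; exact: FF'. Qed.

Lemma measurable_preimage_empirical n F : borel_set F ->
  measurable (@empirical R d n @^-1` F).
Proof.
apply: borel_preimage_measurable => U oU.
by apply: tuple_open_measurable; exact: tuple_open_preimage_empirical.
Qed.

Lemma empirical_massU n F F' : borel_set F -> borel_set F' ->
  empirical_mass n (F `|` F') <= empirical_mass n F + empirical_mass n F'.
Proof.
move=> bF bF'; apply: gibbs_massU; [exact: lsc_measurable|exact: lsc_measurable2| |];
  exact: measurable_preimage_empirical.
Qed.

Lemma empirical_lawE n F :
  empirical_law ell V W beta n F = empirical_mass n F / empirical_mass n setT.
Proof. by rewrite /empirical_law /gibbs /empirical_mass preimage_setT gibbs_massT. Qed.

Lemma empirical_tight (L : R) : exists K, [/\ compact K, closed K &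
  \forall n \near \oo, empirical_mass n (~` K) <= (expR (- (alpha n * L)))%:E].
Proof.
have [M hM] := G_tight L; exists (sublevel G M); split => //.
  exact: sublevel_compact.
exact: sublevel_closed.
Qed.

Lemma empirical_lower_bound : lower_bound empirical_mass alpha (J V W).
Proof. by move=> F mu r oF Fmu Jr; 
exact: (gibbs_lower_bound V_gtNy W_gtNy a0 a1 Vc Wc lV lW beta_gt0 beta_n_cvgy C2 oF Fmu Jr). Qed.

Lemma empirical_upper_bound : upper_bound empirical_mass alpha (J V W).
Proof.
apply: tight_upper_bound.
- exact: le_empirical_mass.
- exact: empirical_massU.
- exact: alpha_cvg.
- by move=> mu r rJ; 
  exact: (local_upper_bound V_gtNy W_gtNy a0 a1 Vc Wc lV lW ell_atomless beta_gt0
    beta_n_cvgy D_fin rJ).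
- exact: empirical_tight.
Qed.

Lemma inf_J_fin_num : ereal_inf (range (J V W)) \is a fin_num.
Proof.
have [nu Jnu] := J_fin; rewrite fin_numE; apply/andP; split; apply/eqP => h.
  have : (kappa a c)%:E <= ereal_inf (range (J V W)).
    apply: le_ereal_inf_tmp => _ [mu _ <-]; exact: J_ge_kappa.
  by rewrite h.
have : ereal_inf (range (J V W)) <= J V W nu by apply: ereal_inf_lbound; exists nu.
by rewrite h leye_eq => /eqP e; rewrite e in Jnu.
Qed.

Let m := fine (ereal_inf (range (J V W))).

Lemma inf_J : ereal_inf (range (J V W)) = m%:E.
Proof. by rewrite fineK// inf_J_fin_num. Qed.

Lemma partition_near : \forall n \near \oo,
  0 < gibbs_mass ell V W beta [set: n.+1.-tuple E] /\
  gibbs_mass ell V W beta [set: n.+1.-tuple E] < +oo.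
Proof.
exact: (normalization_fin empirical_lower_bound empirical_upper_bound inf_J).
Qed.

Lemma Jstar_rate_function : rate_function (Jstar V W).
Proof.
apply: (good_rate_function alpha_gt0 empirical_lower_bound _ inf_J).
- by apply/funext => mu; rewrite /Jstar inf_J.
- by move=> r; exact: (J_closed V_gtNy W_gtNy a0 a1 Vc Wc lV lW).
- exact: empirical_tight.
Qed.

Lemma weak_LDP : LDP (empirical_law ell V W beta) (fun n => beta n.+1) (Jstar V W).
Proof.
have -> : empirical_law ell V W beta =
    (fun n F => empirical_mass n F / empirical_mass n setT).
  by apply/funext => n; apply/funext => F; exact: empirical_lawE.
apply: (abstract_LDP empirical_mass_ge0 le_empirical_mass alpha_gt0 alpha_cvg
  empirical_lower_bound empirical_upper_bound inf_J).
- by apply/funext => mu; rewrite /Jstar inf_J.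
- apply: filterS partition_near => n [Z0 Zoo].
  have -> : (fun F => empirical_mass n F / empirical_mass n setT) =
      (fun F => gibbs ell V W beta (@empirical R d n @^-1` F)).
    by apply/funext => F; rewrite -empirical_lawE.
  apply: gibbs_borel_probability => //; [exact: lsc_measurable|exact: lsc_measurable2|].
  by move=> U oU; apply: tuple_open_measurable; exact: tuple_open_preimage_empirical.
- exact: Jstar_rate_function.
Qed.

Section psi_space.
Context (psi : Psi R d) (psiG : forall e : R, (0 < e)%R -> exists T : R, (0 <= T)%R /\
    forall x, (psi x <= Num.min (psi x) T + e * G x)%R).
Local Notation S := (Ppsi psi).
Let psi_c := @Psi_continuous R d psi.
Let psi_0 := @Psi_ge0 R d psi.

Lemma sublevel_Ppsi M (mu : Prob R d) : sublevel G M mu -> \int[mu]_x (psi x)%:E < +oo.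
Proof.
have [T [T0 h]] := sublevel_psi_bound psi_c psi_0 lG G0 psiG M ltr01.
by move=> /h[].
Qed.

(** On the sets of exponential tightness the weak topology is as fine as that
    of [dpsi]: this is all that separates the two large deviation
    principles. *)
Lemma dpsi_near (M e : R) (mu : S) : (0 < e)%R -> sublevel G M (sval mu) ->
  exists N, [/\ open N, N (sval mu) & forall nu : S, N (sval nu) ->
    sublevel G M (sval nu) -> (dpsi mu nu < e)%R].
Proof.
move=> e0 Kmu; have e20 : (0 < e / 2)%R by rewrite divr_gt0.
have e40 : (0 < e / 2 / 2)%R by rewrite divr_gt0.
have := @filterI _ _ (nbhs_filter (sval mu)) _ _ (levy_prokhorov_near (sval mu) e40)
  (sublevel_psi_near psi_c psi_0 lG G0 psiG e20 Kmu).
rewrite nbhsE => -[N [oN Nmu] hN]; exists N; split => // nu /hN[h1 h2] Knu.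
rewrite /dpsi; have {}h2 := h2 Knu; rewrite /= in h1.
have : (e / 2 / 2 < e / 2)%R by rewrite ltr_pdivrMr// ltr_pMr// ltr1n.
lra.
Qed.

Definition empirical_mass_psi n (F : set S) : \bar R :=
  empirical_mass n [set sval mu | mu in F].

Definition J_psi (mu : S) : \bar R := J V W (sval mu).

Lemma empirical_mass_psiT n : empirical_mass_psi n setT = empirical_mass n setT.
Proof.
apply/eqP; rewrite eq_le; apply/andP; split; first exact: le_empirical_mass.
apply: le_gibbs_mass => x _ /=.
have mpsi : measurable_fun setT psi by exact: continuous_measurable_rV.
have h : \int[empirical x]_y (psi y)%:E < +oo by rewrite integral_empirical// ltry.
by exists (exist _ (empirical x) h).
Qed.

(** Bounded energy bounds the integral of [G], by comparison of the lower bound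
    with exponential tightness. *)
Lemma J_fin_sublevel (r : R) : exists M, forall mu : Prob R d, J V W mu <= r%:E ->
  sublevel G M mu.
Proof.
have [M hM] := G_tight (r + 1)%R; exists M => mu Jr; apply: contrapT => nK.
have oK : open (~` sublevel G M) by apply: closed_openC; exact: sublevel_closed.
have := lower_bound_open_null alpha_gt0 empirical_lower_bound oK hM nK.
by move=> /le_trans/(_ Jr); rewrite lee_fin; lra.
Qed.

Lemma J_fin_psi (mu : Prob R d) : J V W mu < +oo -> \int[mu]_x (psi x)%:E < +oo.
Proof.
move=> Joo; have Jf : J V W mu \is a fin_num.
  have := J_ge_kappa V_gtNy W_gtNy a0 a1 Vc Wc lV lW mu.
  by move: Joo; case: (J V W mu).
have [M hM] := J_fin_sublevel (fine (J V W mu)).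
by apply: (@sublevel_Ppsi M); apply: hM; rewrite fineK.
Qed.

(** Measures that do not integrate [psi] have infinite energy. *)
Lemma inf_J_psi : ereal_inf (range J_psi) = m%:E.
Proof.
rewrite -inf_J; apply/eqP; rewrite eq_le; apply/andP; split; last first.
  by apply: ereal_inf_le_tmp => _ [mu _ <-]; exists (sval mu).
apply: le_ereal_inf_tmp => _ [mu _ <-].
have [Jy|] := eqVneq (J V W mu) +oo; first by rewrite Jy leey.
rewrite -ltey => /J_fin_psi h; apply: ereal_inf_lbound.
by exists (exist _ mu h).
Qed.

(** Inside a set of exponential tightness a ball of [dpsi] contains a weak
    neighbourhood; what lies outside is of smaller order. *)
Lemma psi_lower_bound : lower_bound empirical_mass_psi alpha J_psi.
Proof.
move=> F mu r oF Fmu Jr.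
have [r' Jr' r'r] : exists2 r' : R, J_psi mu < r'%:E & (r' < r)%R.
  move: Jr; have := J_ge_kappa V_gtNy W_gtNy a0 a1 Vc Wc lV lW (sval mu).
  rewrite /J_psi; case: (J V W _) => [j| |]// _; rewrite lte_fin => jr.
  by exists ((j + r) / 2)%R; rewrite ?lte_fin midf_lt.
have [M hM] := G_tight r.
have [M1 hM1] := J_fin_sublevel r.
have le_sub : sublevel G M `<=` sublevel G (Num.max M M1).
  by move=> nu /= /le_trans; apply; rewrite lee_fin le_max lexx.
have Kmu : sublevel G (Num.max M M1) (sval mu).
  have := hM1 _ (ltW Jr); rewrite /sublevel /= => /le_trans; apply.
  by rewrite lee_fin le_max lexx orbT.
have [e e0 eF] : exists2 e : R, (0 < e)%R & ball mu e `<=` F.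
  by have := open_nbhs_nbhs (conj oF Fmu); move=> /nbhs_ballP[e e0 h]; exists e.
have [N [oN Nmu hN]] := dpsi_near e0 Kmu.
have UN := empirical_lower_bound oN Nmu Jr'.
have rr0 : (0 < r - r')%R by rewrite subr_gt0.
have c2 := absorb_constant 2 alpha_cvg rr0.
have cK : closed (sublevel G (Num.max M M1)) by exact: sublevel_closed.
have oNK : borel_set (N `&` sublevel G (Num.max M M1)).
  have -> : N `&` sublevel G (Num.max M M1) = ~` (~` N `|` ~` sublevel G (Num.max M M1)).
    by rewrite setCU !setCK.
  apply: sigma_algebraC; rewrite -bigcup2E; apply: sigma_algebra_bigcup => -[|[|i]] /=.
  - by apply: borel_closed; exact: open_closedC.
  - by apply: borel_open; exact: closed_openC.
  - exact: sigma_algebra0.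
apply: filterS (filterI (filterI UN hM) c2) => n [[h1 h2] h3].
have : empirical_mass n N <= empirical_mass_psi n F + (expR (- (alpha n * r)))%:E.
  apply: (@le_trans _ _ (empirical_mass n ((N `&` sublevel G (Num.max M M1)) `|`
      ~` sublevel G (Num.max M M1)))).
    apply: le_empirical_mass => nu Nnu.
    by have [Knu|nK] := pselect (sublevel G (Num.max M M1) nu); [left|right].
  apply: (le_trans (empirical_massU _ _ _)) => //.
    by apply: borel_open; exact: closed_openC.
  apply: leeD.
    apply: le_empirical_mass => nu [Nnu Knu].
    exists (exist _ nu (sublevel_Ppsi Knu)) => //; apply: eF; exact: hN.
  apply: le_trans h2; apply: le_empirical_mass; exact: subsetC.
move=> /(le_trans h1); rewrite -leeBlDr// => /(le_trans _); apply.
rewrite -EFinB lee_fin lerBrDr -mulr2n -mulr_natl.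
rewrite (_ : - (alpha n * r') = alpha n * (r - r') + - (alpha n * r))%R; last by lra.
by rewrite expRD ler_wpM2r// expR_ge0.
Qed.

(** A weak limit point in the sublevel set integrates [psi], so it belongs to the
    space in which [F] is closed, and [dpsi_near] applies at this point. *)
Lemma psi_closed_sublevel (F : set S) M : closed F ->
  closed ([set sval mu | mu in F] `&` sublevel G M).
Proof.
move=> cF; rewrite -[X in closed X]setCK; apply: open_closedC; rewrite openE => nu /= nF.
have cK : closed (sublevel G M) by exact: sublevel_closed.
have [Knu|nK] := pselect (sublevel G M nu); last first.
  have : nbhs nu (~` sublevel G M) by apply: open_nbhs_nbhs; split => //; exact: closed_openC.
  by apply: filterS => nu' h [].
pose nu' : S := exist _ nu (sublevel_Ppsi Knu).
have nFnu : ~ F nu' by move=> h; apply: nF; split => //; exists nu'.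
have [e e0 eF] : exists2 e : R, (0 < e)%R & ball nu' e `<=` ~` F.
  have : nbhs nu' (~` F) by apply: open_nbhs_nbhs; split => //; exact: closed_openC.
  by move=> /nbhs_ballP[e e0 h]; exists e.
have [N [oN Nnu hN]] := @dpsi_near M e nu' e0 Knu.
have : nbhs nu N by exact: open_nbhs_nbhs.
apply: filterS => rho Nrho [[mu Fmu murho] Krho]; subst rho.
by apply: (eF mu) => //; exact: hN.
Qed.

Lemma psi_upper_bound : upper_bound empirical_mass_psi alpha J_psi.
Proof.
move=> F r e cF Fr e0; have [M hM] := G_tight r.
have cFK := @psi_closed_sublevel F M cF.
have e20 : (0 < e / 2)%R by rewrite divr_gt0.
have ub : \forall n \near \oo, empirical_mass n ([set sval mu | mu in F] `&` sublevel G M) <=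
    (expR (- (alpha n * (r - e / 2))))%:E.
  by apply: empirical_upper_bound => // mu [[nu Fnu <-] _]; exact: Fr.
have c2 := absorb_constant 2 alpha_cvg e20.
have cK : closed (sublevel G M) by exact: sublevel_closed.
apply: filterS (filterI (filterI ub hM) c2) => n [[h1 h2] h3].
apply: (@le_trans _ _ (empirical_mass n (([set sval mu | mu in F] `&` sublevel G M) `|`
    ~` sublevel G M))).
  apply: le_empirical_mass => nu Fnu.
  by have [Knu|nK] := pselect (sublevel G M nu); [left|right].
apply: (le_trans (empirical_massU _ (borel_closed cFK) (borel_open (closed_openC cK)))).
apply: (le_trans (leeD h1 h2)); rewrite -EFinD lee_fin.
apply: (@le_trans _ _ (2 * expR (- (alpha n * (r - e / 2))))%R).
  rewrite mulr_natl mulr2n lerD2l ler_expR lerN2 ler_wpM2l ?(ltW (alpha_gt0 n))//.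
  by rewrite lerBlDr lerDl ltW.
rewrite (_ : - (alpha n * (r - e)) = alpha n * (e / 2) + - (alpha n * (r - e / 2)))%R; last by lra.
by rewrite expRD ler_wpM2r// expR_ge0.
Qed.

Lemma dpsi_empirical_near n (x : n.+1.-tuple E) (e : R) : (0 < e)%R ->
  tuple_nbhs x [set y | levy_prokhorov (empirical x) (empirical y) +
    `|(\int[empirical x]_z psi z)%R - (\int[empirical y]_z psi z)%R| < e]%R.
Proof.
move=> e0; have e20 : (0 < e / 2)%R by rewrite divr_gt0.
have mpsi : measurable_fun setT psi by exact: continuous_measurable_rV.
have RE (y : n.+1.-tuple E) : (\int[empirical y]_z psi z)%R =
    (n.+1%:R^-1 * \sum_(i < n.+1) psi (tnth y i))%R.
  by rewrite /Rintegral integral_empirical.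
have e40 : (0 < e / 2 / 2)%R by rewrite divr_gt0.
have h1 : tuple_nbhs x [set y | levy_prokhorov (empirical x) (empirical y) <= e / 2 / 2]%R.
  exact: empirical_cvg (levy_prokhorov_near (empirical x) e40).
have /cvgrPdist_lt/(_ _ e20) h2 := @average_cvg R d n x psi psi_c.
apply: filterS (filterI h1 h2) => y [] /=; rewrite !RE => h1' h2'.
have : (e / 2 / 2 < e / 2)%R by rewrite ltr_pdivrMr// ltr_pMr// ltr1n.
lra.
Qed.

Lemma psi_borel_probability : \forall n \near \oo,
  borel_probability (fun F : set S => empirical_mass_psi n F / empirical_mass_psi n setT).
Proof.
apply: filterS partition_near => n [Z0 Zoo].
have mpsi : measurable_fun setT psi by exact: continuous_measurable_rV.
have h (x : n.+1.-tuple E) : \int[empirical x]_y (psi y)%:E < +oo.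
  by rewrite integral_empirical// ltry.
pose f (x : n.+1.-tuple E) : S := exist _ (empirical x) (h x).
have -> : (fun F : set S => empirical_mass_psi n F / empirical_mass_psi n setT) =
    (fun F => gibbs ell V W beta (f @^-1` F)).
  apply/funext => F; rewrite empirical_mass_psiT -empirical_lawE /empirical_law.
  congr gibbs; apply/seteqP; split => x /=.
    move=> [[mu hmu] Fmu /= muE]; subst mu.
    by rewrite /f (Prop_irrelevance (h x) hmu).
  by move=> Fx; exists (f x).
apply: gibbs_borel_probability => //; [exact: lsc_measurable|exact: lsc_measurable2|].
move=> U oU; apply: tuple_open_measurable; apply: tuple_nbhs_open => x Ux.
have := open_nbhs_nbhs (conj oU Ux); move=> /nbhs_ballP[e e0 eU].
by apply: filterS (dpsi_empirical_near x e0) => y hy; exact: eU.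
Qed.

(** Weak limits of ultrafilters on a level of [J] exist by compactness, and they
    are limits for [dpsi] since the level lies in a sublevel set of [G]. *)
Lemma psi_rate_function : rate_function (@Jstar_psi R d V W psi).
Proof.
have HE : @Jstar_psi R d V W psi = fun mu => J_psi mu - m%:E.
  by apply/funext => mu; rewrite /Jstar_psi -inf_J_psi.
rewrite HE; split => [mu|M M0].
  by rewrite sube_ge0// -inf_J_psi; apply: ereal_inf_lbound; exists mu.
rewrite (_ : [set x | _] = [set mu : S | J_psi mu <= (M + m)%:E]); last first.
  by apply/seteqP; split => x; rewrite /mkset leeBlDr.
have [M1 hM1] := J_fin_sublevel (M + m).
rewrite compact_ultra => F FU FJ.
have cJ : compact [set mu : Prob R d | J V W mu <= (M + m)%:E].
  have cK := @sublevel_compact R d G M1 lG G0 G_coercive.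
  apply: (subclosed_compact _ cK); last by move=> mu; exact: hM1.
  exact: (J_closed V_gtNy W_gtNy a0 a1 Vc Wc lV lW).
have [nu [Jnu Fnu]] : [set mu | J V W mu <= (M + m)%:E] `&`
    [set nu | (fun mu : S => sval mu) @ F --> nu] !=set0.
  move: cJ; rewrite compact_ultra.
  by move=> /(_ ((fun mu : S => sval mu) @ F) (ultra_fmap _ FU)); apply; exact: FJ.
have Knu := hM1 _ Jnu.
pose nu' : S := exist _ nu (sublevel_Ppsi Knu).
exists nu'; split => // A /nbhs_ballP[e e0 eA].
have [N [oN Nnu hN]] := @dpsi_near M1 e nu' e0 Knu.
have FN : F [set mu : S | N (sval mu)] by apply: Fnu; exact: open_nbhs_nbhs.
apply: filterS (filterI FN FJ) => mu [Nmu Jmu]; apply: eA.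
by apply: hN => //; exact: hM1.
Qed.

Lemma psi_LDP : LDP (@empirical_law_psi R d ell V W beta psi)
  (fun n => beta n.+1) (@Jstar_psi R d V W psi).
Proof.
have -> : @empirical_law_psi R d ell V W beta psi =
    (fun n F => empirical_mass_psi n F / empirical_mass_psi n setT).
  apply/funext => n; apply/funext => F.
  by rewrite empirical_mass_psiT /empirical_law_psi empirical_lawE.
apply: (@abstract_LDP _ _ empirical_mass_psi alpha J_psi _ _ alpha_gt0 alpha_cvg
  psi_lower_bound psi_upper_bound m inf_J_psi).
- by move=> n F; exact: empirical_mass_ge0.
- by move=> n F F' FF'; apply: le_empirical_mass => _ [mu Fmu <-]; exists mu => //; exact: FF'.
- by apply/funext => mu; rewrite /Jstar_psi -inf_J_psi.
- exact: psi_borel_probability.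
- exact: psi_rate_function.
Qed.

End psi_space.
End gibbs_LDP.

Section growth.
Context (R : realType) (d : nat).
Local Notation E := 'rV[R]_d.

Lemma norm_le_enorm (x : E) : `|x| <= enorm x.
Proof.
rewrite /Num.norm /=; have [->|/mx_norm_neq0[[i j] /= ->]] := eqVneq (mx_norm x) 0.
  exact: sqrtr_ge0.
rewrite (ord1 i) -sqrtr_sqr ler_sqrt; last by apply: sumr_ge0 => k _; exact: sqr_ge0.
by rewrite (bigD1 j)//= lerDl sumr_ge0// => k _; exact: sqr_ge0.
Qed.

Lemma coercive_of_growth (G : E -> R) :
  (forall k : R, exists T : R, forall x, T < enorm x -> k <= G x) -> coercive G.
Proof.
move=> h k; have [T hT] := h k; exists T => x Tx; apply: hT.
exact: lt_le_trans (norm_le_enorm x).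
Qed.

(** Coercivity bounds [G] from below outside of a ball, and compactness inside. *)
Lemma lsc_coercive_bounded_below (G : E -> R) : lower_semicontinuous (EFin \o G) ->
  coercive G -> exists2 Gam : R, 0 <= Gam & forall x, - Gam <= G x.
Proof.
move=> lG cG; have [T hT] := cG 0.
have cK : compact [set x : E | `|x| <= T].
  apply: bounded_closed_compact; last exact: closed_norm_le.
  by exists T; split; rewrite ?num_real// => M TM x /= /le_trans; apply; exact: ltW.
pose O (n : nat) := [set x | - n%:R < G x].
have oO n : open (O n).
  by have /lower_semicontinuousP/(_ (- n%:R)) := lG.
have [n hn] : exists n, [set x : E | `|x| <= T] `<=` O n.
  apply: compact_nondecreasing_cover => //.
    move=> n k nk x; rewrite /O /=; apply: le_lt_trans.
    by rewrite lerN2 ler_nat.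
  move=> x _; exists (Num.truncn `|G x|).+1 => //; rewrite /O /= ltrNl.
  by rewrite (le_lt_trans _ (truncnS_gt _))// -normrN ler_norm.
exists n%:R => // x; have [xT|Tx] := leP `|x| T; first exact: ltW (hn x xT).
by rewrite (le_trans _ (hT _ Tx))// oppr_le0.
Qed.

(** Superlinear growth of [phi] makes [psi] uniformly integrable on the sets
    where the integrals of [G] are bounded. *)
Lemma superlinear_domination (psi : Psi R d) (gamma : E -> R) (Gam : R) :
  0 <= Gam -> (forall x, - Gam <= gamma x) -> assumptionC3 psi gamma ->
  forall e : R, 0 < e -> exists T : R, 0 <= T /\
    forall x, psi x <= Num.min (psi x) T + e * (gamma x + Gam).
Proof.
move=> Gam0 gGam [phi [_ phiy] gE] e e0.
have /cvgryPge/(_ e^-1)[T [_ hT]] := phiy.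
exists (Num.max T 0); split; first by rewrite le_max lexx orbT.
move=> x; have [xT|Tx] := leP (psi x) (Num.max T 0).
  by rewrite lerDl mulr_ge0 ?(ltW e0)//; have := gGam x; lra.
have T0 : 0 <= Num.max T 0 by rewrite le_max lexx orbT.
have p0 : 0 < psi x by exact: le_lt_trans Tx.
have := hT (psi x); rewrite ler_pdivlMr// gE => /(_ _) h.
have {}h : e^-1 * psi x <= phi (psi x).
  by apply: h; apply: le_lt_trans Tx; rewrite le_max lexx.
have : psi x <= e * phi (psi x).
  by rewrite -(ler_pM2l (_ : 0 < e^-1)) ?invr_gt0// mulKf ?gt_eqF.
have : 0 <= e * Gam by rewrite mulr_ge0// ltW.
rewrite mulrDr; lra.
Qed.

End growth.

Theorem theorem2p9 (R : realType) (d : nat)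
    (ell : {sigma_finite_measure set 'rV[R]_d -> \bar R})
    (V : 'rV[R]_d -> \bar R) (W : 'rV[R]_d * 'rV[R]_d -> \bar R)
    (beta : nat -> R) (a : R) (gamma : 'rV[R]_d -> R)
    (ell_atomless : atomless ell)
    (V_gtNy : forall x, (-oo < V x)%E)
    (W_gtNy : forall z, (-oo < W z)%E)
    (beta_gt0 : forall n, (0 < n)%N -> 0 < beta n)
    (beta_n_cvgy : beta n / n%:R @[n --> \oo] --> +oo)
    (hA : assumptionA ell V W a)
    (hC1 : assumptionC1 ell V W beta a gamma)
    (hC2 : assumptionC2 ell V W) :
  LDP (empirical_law ell V W beta) (fun n => beta n.+1) (Jstar V W) /\
  forall psi : Psi R d, assumptionC3 psi gamma ->
    LDP (@empirical_law_psi R d ell V W beta psi) (fun n => beta n.+1)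
      (@Jstar_psi R d V W psi).
Proof.
have [[lV lW] /andP[a0 a1] D_fin [c [cV cW]] [A [mA A0 Aoo]]] := hA.
have Vc x : (c%:E <= V x)%E.
  by apply: ltW; apply: lt_le_trans cV _; apply: ereal_inf_lbound; exists x.
have Wc z : (c%:E <= W z + a%:E * (V z.1 + V z.2))%E.
  by apply: ltW; apply: lt_le_trans cW _; apply: ereal_inf_lbound; exists z.
have J_fin := finite_energy_measure V_gtNy W_gtNy a0 a1 Vc Wc lV lW D_fin mA A0 Aoo.
have [lg [phi [gphi phiy]] [B [r [C [mB [_ ry] C1i C1ii C1iii]]]]] := hC1.
have growth (k : R) : exists T : R, forall x, T < enorm x -> k <= gamma x.
  have /cvgryPge/(_ k)[T [_ hT]] := phiy.
  by exists T => x Tx; rewrite gphi; exact: hT.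
have [Gam Gam0 gGam] := lsc_coercive_bounded_below lg (coercive_of_growth growth).
pose G x := gamma x + Gam.
have lG : lower_semicontinuous (EFin \o G) .
  exact: lsc_shifted_gamma.
have G0 x : 0 <= G x by rewrite /G; have := gGam x; lra.
have G_coercive : coercive G.
  move=> k; have [T hT] := coercive_of_growth growth (k - Gam).
  by exists T => x /hT; rewrite /G lerBlDr.
have C1iii' n : (0 < n)%N -> ((n%:R / beta n)%:E *
    lne (\int[ell]_(x in B `\` eball (r n))
      expeR ((beta n / n%:R * gamma x)%:E - (1 - a)%:E * V x)) < C%:E)%E.
  by move=> n0; apply: le_lt_trans C1iii; apply: ereal_sup_ubound; exists n.
have G_tight := exponential_tightness V_gtNy W_gtNy a0 a1 Vc Wc lV lW ell_atomless beta_gt0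
  beta_n_cvgy D_fin lg growth gGam mB ry C1i C1ii C1iii'.
split.
  exact: (weak_LDP V_gtNy W_gtNy a0 a1 Vc Wc lV lW ell_atomless beta_gt0 beta_n_cvgy
    D_fin J_fin hC2 lG G0 G_coercive G_tight).
move=> psi hC3.
exact: (psi_LDP V_gtNy W_gtNy a0 a1 Vc Wc lV lW ell_atomless beta_gt0 beta_n_cvgy
    D_fin J_fin hC2 lG G0 G_coercive G_tight (superlinear_domination Gam0 gGam hC3)).
Qed.
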